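(* Let $\mathcal{F}=\{f_1,\dots,f_m\}$ be a set of functions in $L^2(\mathbb{R}^d)$ and let $n$ be a positive integer. Then: (1) There exists $V\in\mathcal{V}_n$ such that $$\sum_{i=1}^m\|f_i-P_Vf_i\|^2\le\sum_{i=1}^m\|f_i-P_{V'}f_i\|^2\qquad\text{for all } V'\in\mathcal{V}_n.\qquad( * )$$ (2) The optimal shift-invariant space $V$ in $( * )$ can be chosen such that $V\subset\mathcal{S}(\mathcal{F})$.
   Context: $L^2(\mathbb{R}^d)$ is the space of complex-valued square-integrable functions with norm $\|\cdot\|$. For a finite set $\Phi=\{\varphi_1,\dots,\varphi_s\}\subset L^2(\mathbb{R}^d)$, let $\mathcal{S}(\Phi)=\mathcal{S}(\varphi_1,\dots,\varphi_s)$ be the closure in $L^2(\mathbb{R}^d)$ of $\operatorname{span}\{\varphi_i(\cdot-k): i=1,\dots,s,\ k\in\mathbb{Z}^d\}$. Any such space is called a finitely generated shift-invariant space (FSIS), and $\Phi$ is called a set of generators of it. The length of an FSIS $\mathcal{S}$ is the minimal $\ell$ such that there are $\varphi_1,\dots,\varphi_\ell\in\mathcal{S}$ with $\mathcal{S}=\mathcal{S}(\varphi_1,\dots,\varphi_\ell)$. $\mathcal{V}_n$ is the set of all shift-invariant spaces of length at most $n$, i.e. those having a set of $s$ generators with $s\le n$. $P_{V}$ is the orthogonal projection of $L^2(\mathbb{R}^d)$ onto the closed subspace $V$. *)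

(* Defs.v *)
From HB Require Import structures.
From mathcomp Require Import all_boot all_order all_algebra.
From mathcomp Require Import complex.
From mathcomp Require Import all_classical all_reals all_analysis.

Set Implicit Arguments.
Unset Strict Implicit.
Unset Printing Implicit Defensive.

Import Order.TTheory GRing.Theory Num.Theory.
Import numFieldNormedType.Exports.

Local Open Scope classical_set_scope.
Local Open Scope ring_scope.

(* Carries the product of the Borel sigma-algebras: every Lebesgue measurable
   function agrees a.e. with a Borel measurable one. *)
Notation Rd R d := (d.-tuple (measurableTypeR R)).

Section lebesgue_step.
Context (R : realType) (d : nat).
Variable mu :
  {sigma_finite_measure set (Rd R d) -> \bar R}.

Definition cons_point (x : measurableTypeR R * Rd R d) :
  Rd R d.+1 := [tuple of x.1 :: x.2].

Lemma measurable_cons_point : measurable_fun [set: _] cons_point.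
Proof. exact: measurable_cons. Qed.

HB.instance Definition _ :=
  isMeasurableFun.Build _ _ _ _ cons_point measurable_cons_point.

Definition lebesgue_step :=
  pushforward (@lebesgue_measure R \x mu)%E cons_point.

Let lebesgue_step0 : lebesgue_step set0 = 0%E.
Proof. exact: measure0. Qed.

Let lebesgue_step_ge0 A : (0 <= lebesgue_step A)%E.
Proof. exact: measure_ge0. Qed.

Let lebesgue_step_sigma_additive : semi_sigma_additive lebesgue_step.
Proof. exact: measure_semi_sigma_additive. Qed.

HB.instance Definition _ := isMeasure.Build _ _ _ lebesgue_step
  lebesgue_step0 lebesgue_step_ge0 lebesgue_step_sigma_additive.

Let lebesgue_step_sigma_finite : sigma_finite setT lebesgue_step.
Proof.
have /sigma_finiteP[F [TF ndF Foo]] := sigma_finiteT (@lebesgue_measure R).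
have /sigma_finiteP[G [TG ndG Goo]] := sigma_finiteT mu.
pose box k := [set t : Rd R d.+1 |
  F k (thead t) /\ G k [tuple of behead t]].
exists box.
  apply/esym/seteqP; split=> // t _.
  have [k _ Fk] : (\bigcup_i F i) (thead t) by rewrite -TF.
  have [l _ Gl] : (\bigcup_i G i) [tuple of behead t] by rewrite -TG.
  exists (maxn k l) => //; split.
  - by move: Fk; exact/subsetPset/ndF/leq_maxl.
  - by move: Gl; exact/subsetPset/ndG/leq_maxr.
move=> k; have [mF Fk] := Foo k; have [mG Gk] := Goo k.
split.
  apply: measurableI.
  - by rewrite -[X in measurable X]setTI; exact: measurable_tnth.
  - by rewrite -[X in measurable X]setTI; exact: measurable_behead.
rewrite /lebesgue_step /pushforward.
rewrite (_ : cons_point @^-1` box k = F k `*` G k).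
  by rewrite product_measure1E// lte_mul_pinfty// ge0_fin_numE.
have bhK x t : [tuple of behead (cons_point (x, t))] = t :> d.-tuple _.
  exact/val_inj.
by apply/seteqP; split=> -[x t]; rewrite /box /= bhK theadE.
Qed.

HB.instance Definition _ := Measure_isSigmaFinite.Build _ _ _ lebesgue_step
  lebesgue_step_sigma_finite.

End lebesgue_step.

(* Lebesgue measure on R^d, as an iterated product measure. *)
Fixpoint lebesgueX (R : realType) (d : nat) :
    {sigma_finite_measure set (Rd R d) -> \bar R} :=
  if d is d'.+1 then lebesgue_step (lebesgueX R d') else \d_[tuple].

Lemma lebesgueX_box (R : realType) (d : nat) (A : 'I_d -> set R) :
  (forall i, measurable (A i : set (measurableTypeR R))) ->
  lebesgueX R d [set x | forall i, A i (tnth x i)] =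
    (\prod_(i < d) lebesgue_measure (A i))%E.
Proof.
elim: d A => [|d IH] A mA.
  by rewrite big_ord0 /= diracE mem_set// => -[].
rewrite big_ord_recl -(IH (fun i => A (lift ord0 i)))//.
rewrite -product_measure1E//; last first.
  rewrite [X in measurable X](_ : _ =
      \bigcap_(i in [set: 'I_d]) (@tnth d _ ^~ i) @^-1` A (lift ord0 i)).
    apply: fin_bigcap_measurable => // i _.
    by rewrite -[X in measurable X]setTI; exact: measurable_tnth.
  by apply/seteqP; split=> x /= Ax i; [move=> _|]; exact: Ax.
congr (_ \x _)%E.
apply/seteqP; split=> -[x t] /=.
  move=> At; split=> [|i]; first exact: (At ord0).
  by have := At (lift ord0 i); rewrite tnthS.
move=> [Ax At] i; case: (unliftP ord0 i) => [j ->|-> //].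
by rewrite tnthS; exact: At.
Qed.

Section shift_invariant_spaces.
Context (R : realType) (d : nat).
Local Notation mu := (lebesgueX R d).
Local Notation fct := (Rd R d -> R[i]).
Implicit Types (f g p : fct) (V : set fct).

(* Elements of L^2(R^d) are represented by functions rather than by classes
   modulo a.e. equality. Norms and inner products only depend on the classes,
   and the spaces [sis phi] below are stable under a.e. equality since they are
   closed for the L^2 seminorm; so subspaces, inclusions and generators
   correspond exactly to those of the quotient. *)
Definition L2 : set fct :=
  [set f : fct | (@complex.Re R \o f) \in Lfun mu 2%:E /\
           (@complex.Im R \o f) \in Lfun mu 2%:E].

Definition L2norm f : R := Num.sqrt (\int[mu]_x (Normc.normc (f x) ^+ 2)).

Definition L2dot f g : R[i] :=
  Complex (\int[mu]_x complex.Re (f x * conjc (g x)))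
          (\int[mu]_x complex.Im (f x * conjc (g x))).

Definition translate (k : d.-tuple int) f : fct :=
  fun x => f [tuple tnth x i - (tnth k i)%:~R | i < d].

Definition span_translates s (phi : 'I_s -> fct) : set fct :=
  [set g | exists (K : seq (d.-tuple int)) (c : 'I_s -> d.-tuple int -> R[i]),
    g = (fun x => \sum_(i < s) \sum_(k <- K) c i k * translate k (phi i) x)].

Definition sis s (phi : 'I_s -> fct) : set fct :=
  [set g | L2 g /\
    forall e : R, 0 < e ->
      exists2 h, span_translates phi h & L2norm (g - h) < e].

Definition fsis V := exists s (phi : 'I_s -> fct),
  (forall i, L2 (phi i)) /\ V = sis phi.

Definition generated_by V (l : nat) := exists phi : 'I_l -> fct,
  (forall i, V (phi i)) /\ V = sis phi.

Definition has_length V (l : nat) :=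
  generated_by V l /\ forall l', generated_by V l' -> (l <= l')%N.

Definition fsis_length_le (n : nat) : set (set fct) :=
  [set V | fsis V /\ exists2 l, has_length V l & (l <= n)%N].

Definition is_orthogonal_projection V f p :=
  V p /\ forall v, V v -> L2dot (f - p) v = 0.

(* The projection is unique up to a.e. equality; this picks a representative. *)
Definition orthogonal_projection V f : fct :=
  xget 0 [set p | is_orthogonal_projection V f p].

Lemma L2norm0 : L2norm 0 = 0.
Proof.
rewrite /L2norm (_ : (fun _ => _) = cst 0).
  by rewrite Rintegral_cst// ?mul0r ?sqrtr0.
by apply/funext => x; rewrite /= !expr0n/= addr0 sqrtr0 expr0n.
Qed.

Lemma sub_sis s (phi : 'I_s -> fct) i : L2 (phi i) -> sis phi (phi i).
Proof.
move=> phi2; split=> // e e0; exists (phi i); last by rewrite subrr L2norm0.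
pose k0 : d.-tuple int := [tuple 0 | _ < d].
exists [:: k0], (fun j _ => (j == i)%:R); apply/funext => x.
rewrite (bigD1 i)//= big_seq1 eqxx mul1r big1 ?addr0.
  rewrite /translate; congr phi; apply/eq_from_tnth => j.
  by rewrite !tnth_mktuple subr0.
by move=> j /negbTE ji; rewrite big_seq1 ji mul0r.
Qed.

Lemma fsis_length_leP n V : fsis_length_le n V <->
  exists s (phi : 'I_s -> fct),
    [/\ (s <= n)%N, forall i, L2 (phi i) & V = sis phi].
Proof.
split=> [[_ [l [[phi [Vphi VE]] _] ln]]|[s [phi [sn phi2 VE]]]].
  by exists l, phi; split=> // i; move: (Vphi i); rewrite VE => -[].
split; first by exists s, phi.
have gs : generated_by V s.
  by exists phi; split=> // i; rewrite VE; exact: sub_sis.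
have exl : exists l, `[< generated_by V l >] by exists s; exact/asboolP.
have [l /asboolP gl minl] := ex_minnP exl.
have lmin l' : generated_by V l' -> (l <= l')%N by move=> ?; exact/minl/asboolP.
by exists l; [split | exact: leq_trans (lmin _ gs) sn].
Qed.

End shift_invariant_spaces.

(* Main.v *)
(* Idea. For f and g in L^2(R^d), the bracket [f, g] is the integrable function on
   the torus whose Fourier coefficients are the numbers <T_k f, g>. It is the
   fiberwise inner product of f and g on the Fourier side, but it can be built
   without the Fourier transform, by approximating f and g by functions of bounded
   support, for which it is a trigonometric polynomial. The Gram matrices
   G(t) = ([f_i, f_j](t)) are almost everywhere positive semidefinite, and the sum of
   the |f_i|^2 is the integral of tr G. If V' has s generators, the Gram matrix M of
   the projections of the f_i on V' has rank at most s almost everywhere, and the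
   Gram matrix of the residuals is G - M. Pointwise, among all such M with
   0 <= M <= G and rank M <= n, the trace of G - M is minimized by deflating n
   times a top eigenvector of G (Eckart-Young). A top eigenvector v(t) can be chosen
   measurably, as a normalized row of lim G^k / tr(G^k), and since closed
   shift-invariant spaces are stable under multiplication by bounded measurable
   functions of t, the generator psi = sum_j v_j f_j performing the deflation exists
   in S(F). *)

Require Import Defs.
From HB Require Import structures.
From mathcomp Require Import all_boot all_order all_algebra.
From mathcomp Require Import perm complex.
From mathcomp Require Import all_classical all_reals all_analysis.
From mathcomp Require Import measurable_realfun.
From mathcomp Require Import zify ring lra.

Set Implicit Arguments.
Unset Strict Implicit.
Unset Printing Implicit Defensive.

Import Order.TTheory GRing.Theory Num.Theory.
Import numFieldNormedType.Exports.

Local Open Scope classical_set_scope.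
Local Open Scope ring_scope.

(** * Real integrals *)

(** A bracket is determined only almost everywhere, so each pointwise argument on the torus may use
    countably many bracket identities at a time. Positivity of a Gram matrix, for instance, is
    tested on rational vectors and extended by density. The rank bound for a competitor is obtained
    without coefficient functions for its elements: Gram matrices of finite combinations of
    translates factor through s columns, brackets converge almost everywhere along geometrically
    fast approximations, and a rank bound survives limits of matrices. Multiplying f by a function a
    of t means taking the Riesz representative, inside the given closed shift-invariant space, of
    the functional sending g to the integral of a [f, g]. Shift invariance supplies all the Fourier
    coefficients from this single family of integrals, and it keeps every constructed function
    inside S(F). The functions h_i produced by deflation are never identified with projections. It
    is enough that they lie in the constructed space, since projecting can only lower the error. *)

Section real_integrals.
Context d (T : measurableType d) (R : realType) (mu : {measure set T -> \bar R}).
Implicit Types (f g : T -> R) (u w : nat -> T -> R).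

Lemma integrable_dominated f g : measurable_fun setT f ->
  mu.-integrable setT (EFin \o g) -> (forall x, `|f x| <= g x) ->
  mu.-integrable setT (EFin \o f).
Proof.
move=> mf ig fg; apply: (le_integrable _ _ _ ig) => //.
  exact/measurable_EFinP.
move=> x _ /=; rewrite lee_fin (le_trans (fg x))// ler_norm//.
Qed.

Lemma eq_ae_Rintegral f g : measurable_fun setT f -> measurable_fun setT g ->
  {ae mu, forall x, f x = g x} -> \int[mu]_x f x = \int[mu]_x g x.
Proof.
move=> mf mg fg; rewrite /Rintegral; congr fine.
apply: ae_eq_integral => //; [exact/measurable_EFinP|exact/measurable_EFinP|].
by apply: filterS fg => x + _ => ->.
Qed.

Lemma ae_le_Rintegral f g : mu.-integrable setT (EFin \o f) ->
  mu.-integrable setT (EFin \o g) -> {ae mu, forall x, f x <= g x} ->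
  \int[mu]_x f x <= \int[mu]_x g x.
Proof.
move=> intf intg fg.
have mf := measurable_int _ intf; have mg := measurable_int _ intg.
move/measurable_EFinP in mf; move/measurable_EFinP in mg.
(* This function equals f almost everywhere and is below g everywhere, which turns the almost sure
   inequality into a pointwise one. *)
pose h x := Num.min (f x) (g x).
have mh : measurable_fun setT h by exact: measurable_minr.
have hf : \int[mu]_x f x = \int[mu]_x h x.
  apply: eq_ae_Rintegral => //; apply: filterS fg => x fgx.
  by rewrite /h /Num.min; case: ltP => // gf; apply/eqP; rewrite eq_le fgx gf.
rewrite hf; apply: le_Rintegral => //.
  apply: (@integrable_dominated _ (fun x => `|f x| + `|g x|)) => //.
    have := integrableD measurableT (integrable_norm intf) (integrable_norm intg).
    exact: eq_integrable.
  by move=> x; rewrite /h /Num.min; case: ltP => _; rewrite ?lerDl ?lerDr.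
by move=> x _; rewrite /h ge_min lexx orbT.
Qed.

(** The witness is the limit superior made finite by [fine]: it is measurable also across the null
    set where the sequence diverges, and it agrees with the limit elsewhere. *)
Lemma ae_measurable_lim u : (forall n, measurable_fun setT (u n)) ->
  {ae mu, forall x, cvgn (u^~ x)} ->
  exists2 v : T -> R, measurable_fun setT v & {ae mu, forall x, u^~ x @ \oo --> v x}.
Proof.
move=> mu_ cu; exists (fun x => fine (limn_esup (fun n => (u n x)%:E))).
  apply: (measurableT_comp (fine_measurable _)) => //.
  by apply: measurable_fun_limn_esup => n; exact/measurable_EFinP.
apply: filterS cu => x cux; have [/= l ul] := proj1 (cvg_ex _) cux.
have /cvg_limn_einf_sup [_ ->] : (fun n => (u n x)%:E) @ \oo --> l%:E.
  by apply: cvg_EFin => //; exact: nearW.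
exact: ul.
Qed.

Lemma geometric_partial_le (C : R) n : 0 <= C ->
  \sum_(0 <= k < n) C * 2^-1 ^+ k <= 2 * C.
Proof.
move=> C0; suff -> : \sum_(0 <= k < n) C * 2^-1 ^+ k = 2 * C - 2 * C * 2^-1 ^+ n.
  by rewrite lerBlDr lerDl mulr_ge0// ?exprn_ge0// mulr_ge0.
elim: n => [|n IH]; first by rewrite big_geq// expr0 mulr1 subrr.
by rewrite big_nat_recr//= IH exprS; field.
Qed.

(** Beppo Levi: the integral of the whole series is at most 2 * C, so its sum is integrable and
    therefore finite almost everywhere. *)
Lemma ae_summable w (C : R) : (forall n, mu.-integrable setT (EFin \o w n)) ->
  (forall n x, 0 <= w n x) ->
  (forall n, \int[mu]_x w n x <= C * 2^-1 ^+ n) ->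
  mu.-integrable setT (fun x => \sum_(0 <= n <oo) (w n x)%:E)%E /\
  {ae mu, forall x, cvgn (series (w^~ x))}.
Proof.
move=> iw w0 Iw.
have mw n : measurable_fun setT (EFin \o w n) by exact: (measurable_int _ (iw n)).
have C0 : 0 <= C.
  have := Iw 0; rewrite expr0 mulr1; apply: le_trans.
  exact: Rintegral_ge0.
have iS : mu.-integrable setT (fun x => \sum_(0 <= n <oo) (w n x)%:E)%E.
  apply/integrableP; split.
    apply: ge0_emeasurable_sum => [k x _ _|k _]; last exact: mw.
    by rewrite lee_fin.
  rewrite (_ : \int[mu]_x _ = \int[mu]_x (\sum_(0 <= n <oo) (w n x)%:E))%E; last first.
    by apply: eq_integral => x _; rewrite gee0_abs// nneseries_ge0// => n _ _; rewrite lee_fin.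
  rewrite integral_nneseries; [|by []|exact: mw|by move=> n x _; rewrite lee_fin].
  apply: (@le_lt_trans _ _ (2 * C)%:E); last exact: ltry.
  apply: lime_le; first by apply: is_cvg_nneseries => n _ _; apply: integral_ge0 => x _; rewrite lee_fin.
  apply: nearW => n.
  apply: (@le_trans _ _ (\sum_(0 <= k < n) (C * 2^-1 ^+ k)%:E)%E).
    apply: lee_sum => k _.
    have := Iw k; rewrite -lee_fin /Rintegral fineK; first by [].
    exact: (integrable_fin_num _ (iw k)).
  by rewrite sumEFin lee_fin geometric_partial_le.
split => //.
have := integrable_ae measurableT iS; apply: filterS => x /(_ I) Sfin.
apply: nondecreasing_is_cvgn.
  by apply/nondecreasing_seqP => n; rewrite /series/= big_nat_recr//= lerDl.
exists (fine (\sum_(0 <= n <oo) (w n x)%:E)%E) => _ [n _ <-].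
rewrite -lee_fin fineK// /series/= -sumEFin.
by apply: nneseries_lim_ge => k _ _; rewrite lee_fin.
Qed.

Lemma ae_cvg0_of_fast u (C : R) : (forall n, mu.-integrable setT (EFin \o u n)) ->
  (forall n, \int[mu]_x `|u n x| <= C * 2^-1 ^+ n) ->
  {ae mu, forall x, u^~ x @ \oo --> 0}.
Proof.
move=> iu Iu.
have [|n x|n|_] := @ae_summable (fun n x => `|u n x|) C.
- by move=> n; have := integrable_norm (iu n).
- by [].
- exact: Iu.
- by apply: filterS => x cx; apply: norm_cvg0; exact: cvg_series_cvg_0 cx.
Qed.

(** By telescoping, [u n] is [u 0] plus a partial sum of increments. The second conclusion provides
    an integrable dominating function for the whole sequence. *)
Lemma le_ae_cvg_of_increments u w (C : R) :
  (forall n, measurable_fun setT (u n)) ->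
  (forall n, mu.-integrable setT (EFin \o w n)) ->
  (forall n x, `|u n.+1 x - u n x| <= w n x) ->
  (forall n, \int[mu]_x w n x <= C * 2^-1 ^+ n) ->
  {ae mu, forall x, cvgn (u^~ x) /\
    forall n, (`|u n x|%:E <= `|u 0 x|%:E + \sum_(0 <= n <oo) (w n x)%:E)%E}.
Proof.
move=> mu_ iw uw Iw.
have w0 n x : 0 <= w n x by apply: le_trans (uw n x).
have [_] := ae_summable iw w0 Iw.
apply: filterS => x cw.
have uE n : u n x = u 0 x + series (fun k => u k.+1 x - u k x) n.
  by rewrite /series/= telescope_sumr// addrC subrK.
split.
  rewrite (_ : u^~ x = fun n => u 0 x + series (fun k => u k.+1 x - u k x) n); last exact/funext.
  apply: is_cvgD; first exact: is_cvg_cst.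
  apply: normed_cvg; apply: (series_le_cvg _ _ _ cw) => n //=; exact: uw.
move=> n; rewrite uE.
apply: (@le_trans _ _ (`|u 0 x| + series (w^~ x) n)%:E).
  rewrite lee_fin (le_trans (ler_normD _ _))// lerD2l.
  rewrite (le_trans (ler_norm_sum _ _ _))// /series/= ler_sum//.
rewrite EFinD leeD2l// /series/= -sumEFin.
by apply: nneseries_lim_ge => k _ _; rewrite lee_fin.
Qed.

(** Completeness of L^1 with a geometric rate, which avoids extracting a subsequence: the whole
    sequence converges almost everywhere as well as in mean. *)
Lemma L1_fast_cvg u (C : R) :
  (forall n, mu.-integrable setT (EFin \o u n)) ->
  (forall n, \int[mu]_x `|u n.+1 x - u n x| <= C * 2^-1 ^+ n) ->
  exists v : T -> R, [/\ mu.-integrable setT (EFin \o v),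
    {ae mu, forall x, u^~ x @ \oo --> v x} &
    (fun n => \int[mu]_x `|u n x - v x|) @ \oo --> 0].
Proof.
move=> iu Iu.
have mun n : measurable_fun setT (u n).
  by have := measurable_int _ (iu n) => /measurable_EFinP.
pose w n x := `|u n.+1 x - u n x|.
have iw n : mu.-integrable setT (EFin \o w n).
  have := integrable_norm (integrableB measurableT (iu n.+1) (iu n)).
  exact: eq_integrable.
have H := @le_ae_cvg_of_increments u w C mun iw (fun n x => lexx _) Iu.
have [iS _] := ae_summable iw (fun n x => normr_ge0 _) Iu.
have [|v mv uv] := ae_measurable_lim mun.
  by apply: filterS H => x [].
have [] := @dominated_convergence _ _ _ mu setT measurableT
   (fun n x => (u n x)%:E) (EFin \o v)
   (fun x => `|u 0 x|%:E + \sum_(0 <= n <oo) (w n x)%:E)%E.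
- by move=> n; exact/measurable_EFinP.
- exact/measurable_EFinP.
- by apply: filterS uv => x ux _; apply: cvg_EFin => //; exact: nearW.
- by apply: integrableD => //; have := integrable_norm (iu 0).
- by apply: filterS H => x [_ H] n _; exact: H.
move=> iv cv _; exists v; split => //.
have /fine_cvgP[_] := cv.
rewrite /comp /Rintegral.
by [].
Qed.

(** The integrals are extended ones, so that integrability of the limit f is a consequence instead
    of an assumption. *)
Lemma fatou_le w f (B : R) : (forall n, measurable_fun setT (w n)) ->
  (forall n x, 0 <= w n x) -> measurable_fun setT f -> (forall x, 0 <= f x) ->
  {ae mu, forall x, w^~ x @ \oo --> f x} ->
  (forall n, (\int[mu]_x (w n x)%:E <= B%:E)%E) ->
  (\int[mu]_x (f x)%:E <= B%:E)%E.
Proof.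
move=> mw w0 mf f0 wf IB.
rewrite (_ : \int[mu]_x _ = \int[mu]_x limn_einf (fun n => (w n x)%:E))%E; last first.
  apply: ae_eq_integral => //.
  - exact/measurable_EFinP.
  - rewrite (_ : (fun x => _) = (fun x => - limn_esup (fun n => - (w n x)%:E))%E); last first.
      by apply/funext => x; rewrite limn_esupN oppeK.
    apply: measurableT_comp => //.
    apply: measurable_fun_limn_esup => n; apply: measurableT_comp => //.
    exact/measurable_EFinP.
  apply: filterS wf => x wx _.
  have /cvg_limn_einf_sup [-> _] // : (fun n => (w n x)%:E) @ \oo --> (f x)%:E.
  by apply: cvg_EFin => //; exact: nearW.
have := @fatou _ _ _ mu setT measurableT (fun n x => (w n x)%:E).
move=> /(_ _ _)/le_trans -> //.
- by move=> n; exact/measurable_EFinP.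
- by move=> n x _; rewrite lee_fin.
rewrite limn_einf_lim; apply: lime_le; first exact: is_cvg_einfs.
by apply: nearW => n; apply: ge_ereal_inf; exists (\int[mu]_x (w n x)%:E)%E => //; exists n => /=.
Qed.

End real_integrals.

(** * Complex-valued integrals *)

Notation ReC := (@complex.Re _).
Notation ImC := (@complex.Im _).
Notation normcR := Normc.normc.

Section complex_facts.
Variable R : realType.
Implicit Types (z w : R[i]) (a b : R).

Lemma ReD z w : ReC (z + w) = ReC z + ReC w. Proof. by case: z; case: w. Qed.
Lemma ImD z w : ImC (z + w) = ImC z + ImC w. Proof. by case: z; case: w. Qed.
Lemma ReN z : ReC (- z) = - ReC z. Proof. by case: z. Qed.
Lemma ImN z : ImC (- z) = - ImC z. Proof. by case: z. Qed.
Lemma ReB z w : ReC (z - w) = ReC z - ReC w. Proof. by rewrite ReD ReN. Qed.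
Lemma ImB z w : ImC (z - w) = ImC z - ImC w. Proof. by rewrite ImD ImN. Qed.
Lemma ReM z w : ReC (z * w) = ReC z * ReC w - ImC z * ImC w.
Proof. by case: z; case: w. Qed.
Lemma ImM z w : ImC (z * w) = ReC z * ImC w + ImC z * ReC w.
Proof. by case: z => a b; case: w => c e. Qed.
Lemma Re_conj z : ReC (conjc z) = ReC z. Proof. by case: z. Qed.
Lemma Im_conj z : ImC (conjc z) = - ImC z. Proof. by case: z. Qed.
Lemma Re_real a : ReC (a%:C)%C = a. Proof. by []. Qed.
Lemma Im_real a : ImC (a%:C)%C = 0. Proof. by []. Qed.
Definition ReImE := (ReD, ImD, ReN, ImN, ReM, ImM, Re_conj, Im_conj, Re_real, Im_real).

Lemma Re_sum I (s : seq I) (P : pred I) (F : I -> R[i]) :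
  ReC (\sum_(i <- s | P i) F i) = \sum_(i <- s | P i) ReC (F i).
Proof. by apply: (big_morph ReC ReD). Qed.
Lemma Im_sum I (s : seq I) (P : pred I) (F : I -> R[i]) :
  ImC (\sum_(i <- s | P i) F i) = \sum_(i <- s | P i) ImC (F i).
Proof. by apply: (big_morph ImC ImD). Qed.

Lemma complexP z w : ReC z = ReC w -> ImC z = ImC w -> z = w.
Proof. by case: z; case: w => a b c e /= -> ->. Qed.

Lemma conjcD z w : conjc (z + w) = conjc z + conjc w. Proof. exact: rmorphD. Qed.
Lemma conjcN z : conjc (- z) = - conjc z. Proof. exact: rmorphN. Qed.
Lemma conjcM z w : conjc (z * w) = conjc z * conjc w. Proof. exact: rmorphM. Qed.
Lemma conjc_sum I (s : seq I) (P : pred I) (F : I -> R[i]) :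
  conjc (\sum_(i <- s | P i) F i) = \sum_(i <- s | P i) conjc (F i).
Proof. exact: rmorph_sum. Qed.

Lemma normc_sqr z : normcR z ^+ 2 = ReC z ^+ 2 + ImC z ^+ 2.
Proof. by case: z => a b /=; rewrite sqr_sqrtr// addr_ge0// sqr_ge0. Qed.
Lemma normcR_ge0 z : 0 <= normcR z. Proof. by case: z => a b; exact: sqrtr_ge0. Qed.
Lemma normcR_le z a : 0 <= a -> ReC z ^+ 2 + ImC z ^+ 2 <= a ^+ 2 -> normcR z <= a.
Proof.
by move=> a0; rewrite -normc_sqr ler_pXn2r// nnegrE ?normcR_ge0.
Qed.
Lemma le_Re_normc z : `|ReC z| <= normcR z.
Proof.
rewrite -(@ler_pXn2r _ 2)// ?nnegrE ?normcR_ge0// normc_sqr real_normK ?num_real//.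
by rewrite lerDl sqr_ge0.
Qed.
Lemma le_Im_normc z : `|ImC z| <= normcR z.
Proof.
rewrite -(@ler_pXn2r _ 2)// ?nnegrE ?normcR_ge0// normc_sqr real_normK ?num_real//.
by rewrite lerDr sqr_ge0.
Qed.
Lemma normc_le_ReIm z : normcR z <= `|ReC z| + `|ImC z|.
Proof.
apply: normcR_le; first exact: addr_ge0.
rewrite sqrrD !real_normK ?num_real//.
rewrite -addrA lerD2l lerDr. by rewrite mulrn_wge0// mulr_ge0.
Qed.
Lemma normcRM z w : normcR (z * w) = normcR z * normcR w.
Proof. exact: Normc.normcM. Qed.
Lemma normcR_conj z : normcR (conjc z) = normcR z.
Proof. by case: z => a b /=; rewrite sqrrN. Qed.
Lemma normcRN z : normcR (- z) = normcR z.
Proof. by case: z => a b /=; rewrite !sqrrN. Qed.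
Lemma normcR_triangle z w : normcR (z + w) <= normcR z + normcR w.
Proof. exact: le_normcD. Qed.
Lemma mulc_conj z : z * conjc z = ((normcR z ^+ 2)%:C)%C.
Proof. by apply: complexP; rewrite [RHS]/= ?normc_sqr !ReImE; ring. Qed.
Lemma normcR_real a : normcR (a%:C)%C = `|a|.
Proof. by rewrite /= expr0n/= addr0 sqrtr_sqr. Qed.

Lemma Re_normcR_le z : ReC z <= normcR z.
Proof. exact: le_trans (ler_norm _) (le_Re_normc _). Qed.
End complex_facts.

Section complex_integrals.
Context d (T : measurableType d) (R : realType) (mu : {measure set T -> \bar R}).
Implicit Types (f g h : T -> R[i]).

Definition cmeas f := measurable_fun setT (fun x => ReC (f x)) /\
  measurable_fun setT (fun x => ImC (f x)).

Definition cintegrable f :=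
  mu.-integrable setT (fun x => (ReC (f x))%:E) /\
  mu.-integrable setT (fun x => (ImC (f x))%:E).

Definition cint f : R[i] := Complex (\int[mu]_x ReC (f x)) (\int[mu]_x ImC (f x)).

Lemma cmeas_cst c : cmeas (fun=> c). Proof. by split; exact: measurable_cst. Qed.

Lemma cmeasD f g : cmeas f -> cmeas g -> cmeas (fun x => f x + g x).
Proof.
move=> [f1 f2] [g1 g2]; split.
- by under eq_fun do rewrite ReD; exact: measurable_funD.
- by under eq_fun do rewrite ImD; exact: measurable_funD.
Qed.

Lemma cmeasN f : cmeas f -> cmeas (fun x => - f x).
Proof.
move=> [f1 f2]; split.
- by under eq_fun do rewrite ReN; apply: measurableT_comp.
- by under eq_fun do rewrite ImN; apply: measurableT_comp.
Qed.

Lemma cmeasB f g : cmeas f -> cmeas g -> cmeas (fun x => f x - g x).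
Proof. by move=> mf mg; apply: cmeasD => //; exact: cmeasN. Qed.

Lemma cmeasM f g : cmeas f -> cmeas g -> cmeas (fun x => f x * g x).
Proof.
move=> [f1 f2] [g1 g2]; split.
- by under eq_fun do rewrite ReM; apply: measurable_funB; exact: measurable_funM.
- by under eq_fun do rewrite ImM; apply: measurable_funD; exact: measurable_funM.
Qed.

Lemma cmeas_conj f : cmeas f -> cmeas (fun x => conjc (f x)).
Proof.
move=> [f1 f2]; split.
- by under eq_fun do rewrite Re_conj.
- by under eq_fun do rewrite Im_conj; apply: measurableT_comp.
Qed.

Lemma cmeas_sum I (s : seq I) (F : I -> T -> R[i]) : (forall i, cmeas (F i)) ->
  cmeas (fun x => \sum_(i <- s) F i x).
Proof.
move=> mF; split.
- by under eq_fun do rewrite Re_sum; apply: measurable_sum => i; case: (mF i).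
- by under eq_fun do rewrite Im_sum; apply: measurable_sum => i; case: (mF i).
Qed.

Lemma cmeas_prod I (s : seq I) (F : I -> T -> R[i]) : (forall i, cmeas (F i)) ->
  cmeas (fun x => \prod_(i <- s) F i x).
Proof.
move=> mF; elim: s => [|i s IH].
  by under eq_fun do rewrite big_nil; exact: cmeas_cst.
by under eq_fun do rewrite big_cons; exact: cmeasM.
Qed.

Lemma cmeas_real (f : T -> R) : measurable_fun setT f -> cmeas (fun x => ((f x)%:C)%C).
Proof. by move=> mf; split => //=; exact: measurable_cst. Qed.

Lemma measurable_normcR f : cmeas f -> measurable_fun setT (fun x => normcR (f x)).
Proof.
move=> [f1 f2]; rewrite (_ : (fun x => _) =
  (fun x => Num.sqrt (ReC (f x) ^+ 2 + ImC (f x) ^+ 2))).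
  apply: (@measurableT_comp _ _ _ _ _ _ (@Num.sqrt R)).
    by apply: continuous_measurable_fun; exact: sqrt_continuous.
  by apply: measurable_funD; exact: measurable_funX.
by apply/funext => x; case: (f x).
Qed.

Lemma cintegrable_cmeas f : cintegrable f -> cmeas f.
Proof.
by move=> [/measurable_int/measurable_EFinP f1 /measurable_int/measurable_EFinP f2].
Qed.

Lemma cintegrable_dominated f (g : T -> R) : cmeas f ->
  mu.-integrable setT (EFin \o g) -> (forall x, normcR (f x) <= g x) -> cintegrable f.
Proof.
move=> [f1 f2] ig fg; split.
- by apply: (integrable_dominated _ ig) => // x; exact: le_trans (le_Re_normc _) (fg x).
- by apply: (integrable_dominated _ ig) => // x; exact: le_trans (le_Im_normc _) (fg x).
Qed.

Lemma cintegrable_normcR f : cintegrable f ->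
  mu.-integrable setT (fun x => (normcR (f x))%:E).
Proof.
move=> /[dup]/cintegrable_cmeas mf [f1 f2].
apply: (@integrable_dominated _ _ _ _ _ (fun x => `|ReC (f x)| + `|ImC (f x)|)).
- exact: measurable_normcR.
- have := integrableD measurableT (integrable_norm f1) (integrable_norm f2).
  exact: eq_integrable.
- by move=> x; rewrite ger0_norm ?normcR_ge0//; exact: normc_le_ReIm.
Qed.

Lemma cintegrable_eq f g : (forall x, f x = g x) -> cintegrable f -> cintegrable g.
Proof. by move=> /funext ->. Qed.

Lemma cintegrable0 : cintegrable (fun=> 0).
Proof. by split; exact: integrable0. Qed.

Lemma cintegrableD f g : cintegrable f -> cintegrable g ->
  cintegrable (fun x => f x + g x).
Proof.
move=> [f1 f2] [g1 g2]; split.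
- have := integrableD measurableT f1 g1.
  by apply: eq_integrable => // x _ /=; rewrite ReD EFinD.
- have := integrableD measurableT f2 g2.
  by apply: eq_integrable => // x _ /=; rewrite ImD EFinD.
Qed.

Lemma cintegrableMb (b f : T -> R[i]) (K : R) : cmeas b ->
  (forall x, normcR (b x) <= K) -> cintegrable f -> cintegrable (fun x => b x * f x).
Proof.
move=> mb bK cf; apply: (@cintegrable_dominated _ (fun x => K * normcR (f x))).
- by apply: cmeasM => //; exact: cintegrable_cmeas.
- have := integrableZl measurableT K (cintegrable_normcR cf).
  exact: eq_integrable.
- by move=> x; rewrite normcRM ler_wpM2r ?normcR_ge0.
Qed.

Lemma cintegrableZ c f : cintegrable f -> cintegrable (fun x => c * f x).
Proof. by apply: (@cintegrableMb (fun=> c) _ (normcR c)) => //; exact: cmeas_cst. Qed.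

Lemma cintegrableN f : cintegrable f -> cintegrable (fun x => - f x).
Proof. by move=> /(@cintegrableZ (-1)); apply: cintegrable_eq => x; rewrite mulN1r. Qed.

Lemma cintegrableB f g : cintegrable f -> cintegrable g ->
  cintegrable (fun x => f x - g x).
Proof. by move=> cf cg; apply: cintegrableD => //; exact: cintegrableN. Qed.

Lemma cintegrable_conj f : cintegrable f -> cintegrable (fun x => conjc (f x)).
Proof.
move=> cf; apply: (@cintegrable_dominated _ (fun x => normcR (f x))).
- exact/cmeas_conj/cintegrable_cmeas.
- exact: cintegrable_normcR.
- by move=> x; rewrite normcR_conj.
Qed.

Lemma cintegrable_sum I (s : seq I) (F : I -> T -> R[i]) : (forall i, cintegrable (F i)) ->
  cintegrable (fun x => \sum_(i <- s) F i x).
Proof.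
move=> mF; elim: s => [|i s IH].
  by under eq_fun do rewrite big_nil; exact: cintegrable0.
by under eq_fun do rewrite big_cons; exact: cintegrableD.
Qed.

Lemma cintegrable_real (f : T -> R) : mu.-integrable setT (EFin \o f) ->
  cintegrable (fun x => ((f x)%:C)%C).
Proof. by move=> mf; split => //=; exact: integrable0. Qed.

Lemma cint_eq f g : (forall x, f x = g x) -> cint f = cint g.
Proof. by move=> /funext ->. Qed.

Lemma cint0 : cint (fun=> 0) = 0.
Proof. by rewrite /cint /= Rintegral_cst// mul0r. Qed.

Lemma cintD f g : cintegrable f -> cintegrable g ->
  cint (fun x => f x + g x) = cint f + cint g.
Proof.
move=> [f1 f2] [g1 g2]; apply: complexP; rewrite /= -?RintegralD//.
- by apply: eq_Rintegral => x _; rewrite ReD.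
- by apply: eq_Rintegral => x _; rewrite ImD.
Qed.

Lemma cintZ c f : cintegrable f -> cint (fun x => c * f x) = c * cint f.
Proof.
move=> [f1 f2]; apply: complexP; rewrite /= ?(ReM, ImM) /=.
- rewrite -!RintegralZl// -RintegralB//; last 2 first.
  + by have := integrableZl measurableT (ReC c) f1; exact: eq_integrable.
  + by have := integrableZl measurableT (ImC c) f2; exact: eq_integrable.
  by apply: eq_Rintegral => x _; rewrite ReM.
- rewrite -!RintegralZl// -RintegralD//; last 2 first.
  + by have := integrableZl measurableT (ReC c) f2; exact: eq_integrable.
  + by have := integrableZl measurableT (ImC c) f1; exact: eq_integrable.
  by apply: eq_Rintegral => x _; rewrite ImM.
Qed.

Lemma cintN f : cintegrable f -> cint (fun x => - f x) = - cint f.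
Proof. by move=> cf; rewrite -mulN1r -cintZ//; apply: cint_eq => x; rewrite mulN1r. Qed.

Lemma cintB f g : cintegrable f -> cintegrable g ->
  cint (fun x => f x - g x) = cint f - cint g.
Proof. by move=> cf cg; rewrite cintD ?cintN//; exact: cintegrableN. Qed.

Lemma cint_conj f : cintegrable f -> cint (fun x => conjc (f x)) = conjc (cint f).
Proof.
move=> [f1 f2]; apply: complexP => /=.
- by apply: eq_Rintegral => x _; rewrite Re_conj.
- rewrite -mulN1r -RintegralZl//.
  by apply: eq_Rintegral => x _; rewrite Im_conj mulN1r.
Qed.

Lemma cint_sum I (s : seq I) (F : I -> T -> R[i]) : (forall i, cintegrable (F i)) ->
  cint (fun x => \sum_(i <- s) F i x) = \sum_(i <- s) cint (F i).
Proof.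
move=> cF; elim: s => [|i s IH].
  by rewrite big_nil -[RHS]cint0; apply: cint_eq => x; rewrite big_nil.
rewrite big_cons -IH -cintD//; last exact: cintegrable_sum.
by apply: cint_eq => x; rewrite big_cons.
Qed.

Lemma cint_ae_eq f g : cmeas f -> cmeas g -> {ae mu, forall x, f x = g x} ->
  cint f = cint g.
Proof.
move=> [f1 f2] [g1 g2] fg; apply: complexP; apply: eq_ae_Rintegral => //.
- by apply: filterS fg => x ->.
- by apply: filterS fg => x ->.
Qed.

Lemma cintegrable_ae_eq f g : cmeas f -> cintegrable g -> {ae mu, forall x, f x = g x} ->
  cintegrable f.
Proof.
move=> [f1 f2] [g1 g2] fg; split.
- apply/integrableP; split; first exact/measurable_EFinP.
  rewrite (_ : integral _ _ _ = \int[mu]_x `|(ReC (g x))%:E|)%E; first by case/integrableP: g1.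
  apply: ae_eq_integral => //; [| |by apply: filterS fg => x ->].
  + by do 2 apply: measurableT_comp => //.
  + by do 2 apply: measurableT_comp => //; case/integrableP: g1 => /measurable_EFinP.
- apply/integrableP; split; first exact/measurable_EFinP.
  rewrite (_ : integral _ _ _ = \int[mu]_x `|(ImC (g x))%:E|)%E; first by case/integrableP: g2.
  apply: ae_eq_integral => //; [| |by apply: filterS fg => x ->].
  + by do 2 apply: measurableT_comp => //.
  + by do 2 apply: measurableT_comp => //; case/integrableP: g2 => /measurable_EFinP.
Qed.

(** The factor 2 comes from estimating real and imaginary parts separately. It is harmless in the
    uses below, which only need boundedness or convergence to 0. *)
Lemma normcR_cint_le f (g : T -> R) : cintegrable f -> mu.-integrable setT (EFin \o g) ->
  {ae mu, forall x, normcR (f x) <= g x} -> normcR (cint f) <= 2 * \int[mu]_x g x.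
Proof.
move=> [f1 f2] ig fg; apply: (le_trans (normc_le_ReIm _)).
rewrite mulr_natl mulr2n; apply: lerD; rewrite /=.
- apply: (le_trans (le_normr_Rintegral _ _)) => //.
  apply: ae_le_Rintegral => //; first by have := integrable_norm f1.
  by apply: filterS fg => x; apply: le_trans; exact: le_Re_normc.
- apply: (le_trans (le_normr_Rintegral _ _)) => //.
  apply: ae_le_Rintegral => //; first by have := integrable_norm f2.
  by apply: filterS fg => x; apply: le_trans; exact: le_Im_normc.
Qed.

End complex_integrals.

Arguments L2dot : simpl never.

(** * The space L^2(R^d) *)

Definition cscale (X : Type) (R : realType) (c : R[i]) (f : X -> R[i]) : X -> R[i] :=
  fun x => c * f x.

Section square_integrable.
Context (R : realType) (d : nat).
Local Notation mu := (lebesgueX R d).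
Local Notation fct := (Rd R d -> R[i]).
Local Notation "<< f , g >>" := (L2dot f g).
Implicit Types (f g h p : fct) (c : R[i]) (t : R).

Lemma Lfun2P (u : Rd R d -> R) : u \in Lfun mu 2%:E <->
  measurable_fun setT u /\ mu.-integrable setT (fun x => (u x ^+ 2)%:E).
Proof.
split=> [/[dup] u2|[mu_ iu]].
  move=> /Lfun2_integrable_sqr; split => //.
  by move: u2; rewrite inE => /andP[]; rewrite inE.
rewrite inE; apply/andP; split; rewrite inE//=.
rewrite /finite_norm unlock poweR_lty//.
case/integrableP: iu => _; congr (_ < _)%E.
apply: eq_integral => x _; rewrite /= ?powR_mulrn// ger0_norm ?sqr_ge0//.
by rewrite -normrX ger0_norm ?sqr_ge0.
Qed.

Lemma L2P f : L2 f <-> cmeas f /\ mu.-integrable setT (fun x => (normcR (f x) ^+ 2)%:E).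
Proof.
split=> [[/Lfun2P[mf1 if1] /Lfun2P[mf2 if2]]|[[mf1 mf2] ifn]].
  split => //; have := integrableD measurableT if1 if2.
  by apply: eq_integrable => // x _; rewrite normc_sqr EFinD.
split; apply/Lfun2P; split => //; apply: (integrable_dominated _ ifn) => //.
- exact: measurable_funX.
- by move=> x; rewrite ger0_norm ?sqr_ge0// normc_sqr lerDl sqr_ge0.
- exact: measurable_funX.
- by move=> x; rewrite ger0_norm ?sqr_ge0// normc_sqr lerDr sqr_ge0.
Qed.

Lemma L2_cmeas f : L2 f -> cmeas f. Proof. by case/L2P. Qed.

Lemma L2_dominated f g K : cmeas f -> L2 g -> (forall x, normcR (f x) <= K * normcR (g x)) ->
  L2 f.
Proof.
move=> mf /L2P[mg ig] fg; apply/L2P; split => //.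
have := integrableZl measurableT (K ^+ 2) ig; move=> igK.
apply: (integrable_dominated (g := fun x => K ^+ 2 * normcR (g x) ^+ 2)) => //.
- by apply: measurable_funX; exact: measurable_normcR.
- move=> x; rewrite ger0_norm ?sqr_ge0// -exprMn lerXn2r ?nnegrE ?normcR_ge0//.
  exact: le_trans (normcR_ge0 _) (fg x).
Qed.

Lemma L2_0 : L2 (0 : fct).
Proof.
apply/L2P; split; first exact: cmeas_cst.
apply: (integrable_dominated (g := fun=> 0)); [|exact: integrable0|].
- by apply: measurable_funX; apply: measurable_normcR; exact: cmeas_cst.
- by move=> x; rewrite /= expr0n /= addr0 sqrtr0 expr0n normr0.
Qed.

Lemma L2_scale c f : L2 f -> L2 (cscale c f).
Proof.
move=> f2; apply: (@L2_dominated _ f (normcR c)) => //.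
- by apply: cmeasM; [exact: cmeas_cst|exact: L2_cmeas].
- by move=> x; rewrite normcRM.
Qed.

Lemma L2_opp f : L2 f -> L2 (- f).
Proof.
move=> f2; apply: (@L2_dominated _ f 1) => //.
- by apply: cmeasN; exact: L2_cmeas.
- by move=> x; rewrite normcRN mul1r.
Qed.

Lemma L2_add f g : L2 f -> L2 g -> L2 (f + g).
Proof.
move=> /L2P[mf i_f] /L2P[mg ig]; apply/L2P; split; first exact: cmeasD.
have := integrableZl measurableT 2 (integrableD measurableT i_f ig); move=> i2.
apply: (integrable_dominated (g := fun x => 2 * (normcR (f x) ^+ 2 + normcR (g x) ^+ 2))).
- by apply: measurable_funX; apply: measurable_normcR; exact: cmeasD.
- by move: i2; apply: eq_integrable => // x _ /=; rewrite EFinM EFinD.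
move=> x; rewrite ger0_norm ?sqr_ge0//.
apply: (@le_trans _ _ ((normcR (f x) + normcR (g x)) ^+ 2)).
  by rewrite ler_sqr ?nnegrE ?addr_ge0 ?normcR_ge0// normcR_triangle.
rewrite -subr_ge0 (_ : _ - _ = (normcR (f x) - normcR (g x)) ^+ 2) ?sqr_ge0//; ring.
Qed.

Lemma L2_sub f g : L2 f -> L2 g -> L2 (f - g).
Proof. by move=> f2 g2; apply: L2_add => //; exact: L2_opp. Qed.

Lemma L2_sum I (s : seq I) (F : I -> fct) : (forall i, L2 (F i)) -> L2 (\sum_(i <- s) F i).
Proof.
move=> F2; elim: s => [|i s IH]; first by rewrite big_nil; exact: L2_0.
by rewrite big_cons; exact: L2_add.
Qed.

Lemma L2_mul_conj f g : L2 f -> L2 g -> cintegrable mu (fun x => f x * conjc (g x)).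
Proof.
move=> /L2P[mf i_f] /L2P[mg ig].
apply: (@cintegrable_dominated _ _ _ _ _ (fun x => normcR (f x) ^+ 2 + normcR (g x) ^+ 2)).
- by apply: cmeasM => //; exact: cmeas_conj.
- by have := integrableD measurableT i_f ig; exact: eq_integrable.
- move=> x; rewrite normcRM normcR_conj.
  have := sqr_ge0 (normcR (f x) - normcR (g x)).
  have := normcR_ge0 (f x); have := normcR_ge0 (g x); nra.
Qed.

Lemma L2dotE f g : <<f, g>> = cint mu (fun x => f x * conjc (g x)). Proof. by []. Qed.

Lemma L2dotDl f g h : L2 f -> L2 g -> L2 h -> <<f + g, h>> = <<f, h>> + <<g, h>>.
Proof.
move=> f2 g2 h2; rewrite !L2dotE -cintD; [|exact: L2_mul_conj|exact: L2_mul_conj].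
by apply: cint_eq => x; rewrite mulrDl.
Qed.

Lemma L2dotZl c f h : L2 f -> L2 h -> <<cscale c f, h>> = c * <<f, h>>.
Proof.
move=> f2 h2; rewrite !L2dotE -cintZ; last exact: L2_mul_conj.
by apply: cint_eq => x; rewrite mulrA.
Qed.

Lemma L2dot_conj f g : L2 f -> L2 g -> <<g, f>> = conjc <<f, g>>.
Proof.
move=> f2 g2; rewrite !L2dotE -cint_conj; last exact: L2_mul_conj.
by apply: cint_eq => x; rewrite conjcM conjcK mulrC.
Qed.

Lemma oppE_cscale f : - f = cscale (-1) f.
Proof. by apply/funext => x; rewrite /cscale mulN1r. Qed.

Lemma L2dotNl f h : L2 f -> L2 h -> <<- f, h>> = - <<f, h>>.
Proof. by move=> f2 h2; rewrite oppE_cscale L2dotZl// mulN1r. Qed.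

Lemma L2dotBl f g h : L2 f -> L2 g -> L2 h -> <<f - g, h>> = <<f, h>> - <<g, h>>.
Proof. by move=> f2 g2 h2; rewrite L2dotDl ?L2dotNl//; exact: L2_opp. Qed.

Lemma L2dot0l h : <<0, h>> = 0.
Proof.
rewrite L2dotE (_ : (fun x => _) = fun=> 0) ?cint0//.
by apply/funext => x; rewrite mul0r.
Qed.

Lemma L2dotDr f g h : L2 f -> L2 g -> L2 h -> <<h, f + g>> = <<h, f>> + <<h, g>>.
Proof.
move=> f2 g2 h2; rewrite L2dot_conj//; last exact: L2_add.
by rewrite L2dotDl// conjcD -!L2dot_conj.
Qed.

Lemma L2dotZr c f h : L2 f -> L2 h -> <<h, cscale c f>> = conjc c * <<h, f>>.
Proof.
move=> f2 h2; rewrite L2dot_conj//; last exact: L2_scale.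
by rewrite L2dotZl// conjcM -!L2dot_conj.
Qed.

Lemma L2dotNr f h : L2 f -> L2 h -> <<h, - f>> = - <<h, f>>.
Proof.
move=> f2 h2; rewrite L2dot_conj//; last exact: L2_opp.
by rewrite L2dotNl// conjcN -!L2dot_conj.
Qed.

Lemma L2dotBr f g h : L2 f -> L2 g -> L2 h -> <<h, f - g>> = <<h, f>> - <<h, g>>.
Proof. by move=> f2 g2 h2; rewrite L2dotDr ?L2dotNr//; exact: L2_opp. Qed.

Lemma L2dot0r h : <<h, 0>> = 0.
Proof.
rewrite L2dotE (_ : (fun x => _) = fun=> 0) ?cint0//.
by apply/funext => x; rewrite conjc0 mulr0.
Qed.

Lemma L2dot_suml I (s : seq I) (F : I -> fct) h : (forall i, L2 (F i)) -> L2 h ->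
  <<\sum_(i <- s) F i, h>> = \sum_(i <- s) <<F i, h>>.
Proof.
move=> F2 h2; elim: s => [|i s IH]; first by rewrite !big_nil L2dot0l.
by rewrite !big_cons L2dotDl ?IH//; exact: L2_sum.
Qed.

Lemma L2dot_sumr I (s : seq I) (F : I -> fct) h : (forall i, L2 (F i)) -> L2 h ->
  <<h, \sum_(i <- s) F i>> = \sum_(i <- s) <<h, F i>>.
Proof.
move=> F2 h2; elim: s => [|i s IH]; first by rewrite !big_nil L2dot0r.
by rewrite !big_cons L2dotDr ?IH//; exact: L2_sum.
Qed.

Lemma L2norm_ge0 f : 0 <= L2norm f. Proof. exact: sqrtr_ge0. Qed.

Lemma L2norm_sqr f : L2norm f ^+ 2 = \int[mu]_x (normcR (f x) ^+ 2).
Proof. by rewrite sqr_sqrtr// Rintegral_ge0// => x _; exact: sqr_ge0. Qed.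

Lemma L2dot_self f : <<f, f>> = ((L2norm f ^+ 2)%:C)%C.
Proof.
rewrite L2norm_sqr; apply: complexP.
  by apply: eq_Rintegral => x _; rewrite mulc_conj.
rewrite /= -[RHS](mul0r (fine (mu setT))) -Rintegral_cst//.
by apply: eq_Rintegral => x _; rewrite mulc_conj.
Qed.

Lemma L2norm_sqrD f g : L2 f -> L2 g ->
  L2norm (f + g) ^+ 2 = L2norm f ^+ 2 + L2norm g ^+ 2 + 2 * ReC <<f, g>>.
Proof.
move=> f2 g2; apply: (@complexI R); rewrite -L2dot_self.
have fg2 := L2_add f2 g2.
rewrite L2dotDl// !L2dotDr// [<<g, f>>]L2dot_conj// !L2dot_self.
by apply: complexP; rewrite !ReImE /=; ring.
Qed.

Lemma L2norm_sqrZ c f : L2 f -> L2norm (cscale c f) ^+ 2 = normcR c ^+ 2 * L2norm f ^+ 2.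
Proof.
move=> f2; apply: (@complexI R); rewrite -L2dot_self L2dotZl// ?L2dotZr//; last exact: L2_scale.
by rewrite mulrA mulc_conj L2dot_self -rmorphM.
Qed.

Lemma L2normZ c f : L2 f -> L2norm (cscale c f) = normcR c * L2norm f.
Proof.
move=> f2; apply/eqP; rewrite -(@eqrXn2 _ 2)// ?L2norm_ge0// ?mulr_ge0 ?L2norm_ge0 ?normcR_ge0//.
by rewrite exprMn L2norm_sqrZ.
Qed.

Lemma L2normN f : L2norm (- f) = L2norm f.
Proof.
by rewrite /L2norm; congr Num.sqrt; apply: eq_Rintegral => x _; rewrite normcRN.
Qed.

Lemma L2norm_sqrB f g : L2 f -> L2 g ->
  L2norm (f - g) ^+ 2 = L2norm f ^+ 2 + L2norm g ^+ 2 - 2 * ReC <<f, g>>.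
Proof.
move=> f2 g2; rewrite L2norm_sqrD ?L2normN//; last exact: L2_opp.
by rewrite L2dotNr// ReN mulrN.
Qed.

Lemma Re_L2dot_le f g : L2 f -> L2 g -> ReC <<f, g>> <= L2norm f * L2norm g.
Proof.
move=> f2 g2.
have key t : 0 <= t ^+ 2 * L2norm f ^+ 2 + L2norm g ^+ 2 - 2 * t * ReC <<f, g>>.
  have tf2 := L2_scale ((t%:C)%C) f2.
  have := sqr_ge0 (L2norm (cscale ((t%:C)%C) f - g)).
  rewrite L2norm_sqrB// L2norm_sqrZ// normcR_real real_normK ?num_real//.
  by rewrite L2dotZl// !ReImE mul0r subr0 mulrA.
move: key; move: (ReC _) => r key.
have := L2norm_ge0 f; rewrite le_eqVlt => /predU1P[f0|f0].
  rewrite -f0 mul0r leNgt; apply/negP => r0.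
  (* When [L2norm f] is 0 the quadratic is affine in t, and this t gives it the value -1. *)
  have := key ((L2norm g ^+ 2 + 1) / (2 * r)).
  rewrite -f0 expr0n /= mulr0 add0r.
  rewrite (_ : _ - _ = -1); first by rewrite lerNr oppr0 ler10.
  field; exact: lt0r_neq0.
(* This t makes the quadratic a positive multiple of the desired difference, unless [L2norm g] is 0.
   In that case t = r / |f|^2 is used, where the quadratic equals - r^2 / |f|^2. *)
have := key (L2norm g / L2norm f).
rewrite (_ : _ - _ = 2 * (L2norm g / L2norm f) * (L2norm f * L2norm g - r)); last first.
  by field; exact: lt0r_neq0.
have := L2norm_ge0 g; rewrite le_eqVlt => /predU1P[g0 _|g0].
  rewrite -g0 mulr0 leNgt; apply/negP => r0.
  have := key ((L2norm f ^+ 2)^-1 * r).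
  rewrite -g0 expr0n /= addr0 (_ : _ - _ = - ((r) ^+ 2 / L2norm f ^+ 2)).
    by rewrite lerNr oppr0 leNgt divr_gt0// exprn_gt0.
  by field; exact: lt0r_neq0.
by rewrite pmulr_rge0 ?subr_ge0// mulr_gt0// divr_gt0.
Qed.

(** Rotating f by the conjugate of the inner product z replaces z by the real number |z|^2, to which
    the bound on real parts applies. *)
Lemma normc_L2dot_le f g : L2 f -> L2 g -> normcR <<f, g>> <= L2norm f * L2norm g.
Proof.
move=> f2 g2; set z := <<f, g>>.
have [z0|z0] := eqVneq (normcR z) 0.
  by rewrite z0 mulr_ge0 ?L2norm_ge0.
have zp : 0 < normcR z by rewrite lt_neqAle eq_sym z0 normcR_ge0.
have := Re_L2dot_le (L2_scale (conjc z) f2) g2.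
rewrite L2dotZl// -/z mulrC mulc_conj L2normZ// normcR_conj -mulrA Re_real.
by rewrite expr2 ler_pM2l.
Qed.

Lemma L2norm_triangle f g : L2 f -> L2 g -> L2norm (f + g) <= L2norm f + L2norm g.
Proof.
move=> f2 g2; rewrite -(@ler_pXn2r _ 2)// ?nnegrE ?addr_ge0 ?L2norm_ge0//.
rewrite L2norm_sqrD//; have := Re_L2dot_le f2 g2.
move: (ReC _) => r; move: (L2norm f) (L2norm g) => a b; nra.
Qed.

Lemma L2norm_distC f g : L2norm (f - g) = L2norm (g - f).
Proof. by rewrite -L2normN opprB. Qed.

Lemma L2norm_triangleB f g h : L2 f -> L2 g -> L2 h ->
  L2norm (f - h) <= L2norm (f - g) + L2norm (g - h).
Proof.
move=> f2 g2 h2; rewrite (_ : f - h = (f - g) + (g - h)); last by rewrite addrA subrK.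
by apply: L2norm_triangle; exact: L2_sub.
Qed.

(** Riesz-Fischer with a geometric rate: the limit is built pointwise from the real and imaginary
    parts, and the error bound passes to it by Fatou. *)
Lemma L2_complete (u : nat -> fct) C : (forall n, L2 (u n)) ->
  (forall n m, (n <= m)%N -> L2norm (u m - u n) ^+ 2 <= C * 4^-1 ^+ n) ->
  exists2 f, L2 f & forall n, L2norm (u n - f) ^+ 2 <= C * 4^-1 ^+ n.
Proof.
move=> u2 uC.
have mu_ n : cmeas (u n) := L2_cmeas (u2 n).
(* The weight 2^n leaves the integral of W n at most C * 2^-n, while an increment of size a
   satisfies a <= 2^-n + 2^n * a^2. Summability of W thus gives that of the increments. *)
pose W n x := 2 ^+ n * normcR (u n.+1 x - u n x) ^+ 2.
have du2 n m : mu.-integrable setT (fun x => (normcR (u n x - u m x) ^+ 2)%:E).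
  by have [_] := proj1 (L2P _) (L2_sub (u2 n) (u2 m)).
have iW n : mu.-integrable setT (EFin \o W n).
  have := integrableZl measurableT (2 ^+ n) (du2 n.+1 n); exact: eq_integrable.
have IW n : \int[mu]_x W n x <= C * 2^-1 ^+ n.
  rewrite RintegralZl//; last exact: du2.
  have := uC n n.+1 (leqnSn _); rewrite L2norm_sqr => H.
  rewrite (le_trans (ler_wpM2l _ H)) ?exprn_ge0//.
  have -> : 2^-1 = 2 * 4^-1 :> R by field.
  by rewrite exprMn mulrCA.
have [_ cW] := ae_summable iW (fun n x => mulr_ge0 (exprn_ge0 _ (ler0n _ _)) (sqr_ge0 _)) IW.
have cu : {ae mu, forall x, cvgn (fun n => ReC (u n x)) /\ cvgn (fun n => ImC (u n x))}.
  apply: filterS cW => x cWx.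
  have cg : cvgn (series (fun n => 2^-1 ^+ n + W n x)).
    rewrite seriesD; apply: is_cvgD => //.
    have := @is_cvg_geometric_series R 1 2^-1; rewrite /geometric /=.
    rewrite (_ : (fun n => 1 * _) = (fun n => 2^-1 ^+ n)); last by apply/funext => n; rewrite mul1r.
    by apply; rewrite ger0_norm// invf_lt1// ltr1n.
  have bound n : normcR (u n.+1 x - u n x) <= 2^-1 ^+ n + W n x.
    rewrite /W; set a := normcR _; set q := 2^-1 ^+ n.
    have -> : 2 ^+ n = q^-1 by rewrite /q exprVn invrK.
    have q0 : 0 < q by rewrite exprn_gt0// invr_gt0.
    have := sqr_ge0 (a / q - 1); have a0 : 0 <= a by exact: normcR_ge0.
    have -> : (a / q - 1) ^+ 2 = q^-1 * (q^-1 * a ^+ 2 + q - 2 * a).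
      by field; exact: lt0r_neq0.
    rewrite pmulr_rge0 ?invr_gt0//; lra.
  have tele (v : nat -> R) : (forall n, `|v n.+1 - v n| <= 2^-1 ^+ n + W n x) -> cvgn v.
    move=> vW.
    have -> : v = (fun n => v 0 + series (fun k => v k.+1 - v k) n).
      by apply/funext => n; rewrite /series/= telescope_sumr// addrC subrK.
    apply: is_cvgD; first exact: is_cvg_cst.
    apply: normed_cvg; apply: (series_le_cvg _ _ _ cg) => n //=.
    exact: le_trans (vW n).
  split; apply: tele => n.
  - by rewrite -ReB (le_trans (le_Re_normc _)).
  - by rewrite -ImB (le_trans (le_Im_normc _)).
have [|v1 mv1 cv1] := @ae_measurable_lim _ _ _ mu (fun n x => ReC (u n x)) (fun n => (mu_ n).1).
  by apply: filterS cu => x [].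
have [|v2 mv2 cv2] := @ae_measurable_lim _ _ _ mu (fun n x => ImC (u n x)) (fun n => (mu_ n).2).
  by apply: filterS cu => x [].
pose f x := Complex (v1 x) (v2 x).
have If n : (\int[mu]_x (normcR (u n x - f x) ^+ 2)%:E <= (C * 4^-1 ^+ n)%:E)%E.
  (* The index m + n stays above the fixed n, so the Cauchy bound holds for every m and not just
     eventually. *)
  apply: (@fatou_le _ _ _ mu (fun m x => normcR (u n x - u (m + n)%N x) ^+ 2)).
  - by move=> m; apply: measurable_funX; apply: measurable_normcR; exact: cmeasB.
  - by move=> m x; exact: sqr_ge0.
  - by apply: measurable_funX; apply: measurable_normcR; exact: cmeasB.
  - by move=> x; exact: sqr_ge0.
  - apply: filterS2 cv1 cv2 => x c1 c2.
    rewrite normc_sqr; under eq_fun do rewrite normc_sqr.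
    rewrite !ReB !ImB; under eq_fun do rewrite !ReB !ImB.
    apply: cvgD; rewrite expr2; under eq_fun do rewrite expr2.
    + by apply: cvgM; (apply: cvgB; [exact: cvg_cst|by rewrite (cvg_shiftn n (fun m => ReC (u m x)))]).
    + by apply: cvgM; (apply: cvgB; [exact: cvg_cst|by rewrite (cvg_shiftn n (fun m => ImC (u m x)))]).
  - move=> m; have := uC n (m + n)%N (leq_addl _ _).
    rewrite L2norm_distC L2norm_sqr /Rintegral -lee_fin fineK//.
    exact: (integrable_fin_num _ (du2 n (m + n)%N)).
have uf2 n : L2 (u n - f).
  apply/L2P; split; first exact: cmeasB.
  apply/integrableP; split.
    by apply/measurable_EFinP; apply: measurable_funX; apply: measurable_normcR; exact: cmeasB.
  apply: le_lt_trans (ltry (C * 4^-1 ^+ n)); apply: le_trans (If n).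
  rewrite le_eqVlt; apply/orP; left; apply/eqP; apply: eq_integral => x _ /=.
  by rewrite ger0_norm ?sqr_ge0.
exists f.
  by rewrite (_ : f = u 0 - (u 0 - f)); [exact: L2_sub|rewrite opprB addrC subrK].
move=> n; have [_ i_] := proj1 (L2P _) (uf2 n).
by rewrite L2norm_sqr -lee_fin /Rintegral fineK; [exact: If|exact: (integrable_fin_num _ i_)].
Qed.

End square_integrable.

(** * Translation invariance of Lebesgue measure *)

Section line_translation.
Context (R : realType) (a : R).

Definition line_shift (x : measurableTypeR R) : measurableTypeR R := x - a.

Lemma measurable_line_shift : measurable_fun [set: _] line_shift.
Proof. by apply: measurable_funB. Qed.

HB.instance Definition _ :=
  isMeasurableFun.Build _ _ _ _ line_shift measurable_line_shift.

(** Lebesgue measure is determined by its values on half-open intervals, and shifting such an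
    interval preserves its length. *)
Lemma lebesgue_measure_shift (A : set R) : measurable A ->
  lebesgue_measure (line_shift @^-1` A) = lebesgue_measure A.
Proof.
move=> mA; rewrite -[LHS]/(pushforward lebesgue_measure line_shift A).
apply/esym/lebesgue_measure_unique => //= _ [[u v]] _ <-.
rewrite /pushforward.
have -> : line_shift @^-1` `]u, v]%classic = `](u + a), (v + a)]%classic.
  by apply/seteqP; split => x /=; rewrite /line_shift !in_itv /= ltrBrDr lerBlDr.
by rewrite !lebesgue_measure_itv/= !lte_fin ltrD2r; case: ifP => // _;
  rewrite -!EFinB opprD addrACA subrr addr0.
Qed.

End line_translation.

Section space_translation.
Context (R : realType).

Definition tshift d (a : d.-tuple R) (x : Rd R d) : Rd R d :=
  [tuple (tnth x i : R) - tnth a i | i < d].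

Lemma measurable_tshift d (a : d.-tuple R) : measurable_fun [set: _] (tshift a).
Proof.
apply/measurable_fun_tnthP => i.
rewrite (_ : _ \o _ = fun x : Rd R d => (tnth x i : R) - tnth a i); last first.
  by apply/funext => x /=; rewrite tnth_mktuple.
by apply: measurable_funB => //; exact: measurable_tnth.
Qed.

HB.instance Definition _ d (a : d.-tuple R) :=
  isMeasurableFun.Build _ _ _ _ (tshift a) (measurable_tshift a).

Definition prod_shift d (a : d.+1.-tuple R) (z : measurableTypeR R * Rd R d) :
    measurableTypeR R * Rd R d :=
  (line_shift (thead a) z.1, tshift [tuple of behead a] z.2).

Lemma measurable_prod_shift d (a : d.+1.-tuple R) :
  measurable_fun [set: _] (prod_shift a).
Proof.
apply: measurable_fun_pair.
- exact: (measurableT_comp (measurable_line_shift _) measurable_fst).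
- exact: (measurableT_comp (measurable_tshift _) measurable_snd).
Qed.

HB.instance Definition _ d (a : d.+1.-tuple R) :=
  isMeasurableFun.Build _ _ _ _ (prod_shift a) (measurable_prod_shift a).

(** Induction on the dimension: the shift splits into a shift of the first coordinate and one of the
    others, and the product measure is determined by its values on rectangles. *)
Lemma lebesgueX_shift d (a : d.-tuple R) (A : set (Rd R d)) : measurable A ->
  lebesgueX R d (tshift a @^-1` A) = lebesgueX R d A.
Proof.
elim: d a A => [a A _|d IH a A mA].
  congr (lebesgueX R 0 _); apply/seteqP; split => x /=.
    by rewrite [x]tuple0 [tshift _ _]tuple0.
  by rewrite [x]tuple0 [tshift _ _]tuple0.
have mcA : measurable (@cons_point R d @^-1` A).
  by rewrite -[X in measurable X]setTI; exact: measurable_cons_point.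
rewrite -[LHS]/((lebesgue_measure \x lebesgueX R d)%E (@cons_point R d @^-1` (tshift a @^-1` A))).
rewrite -[RHS]/((lebesgue_measure \x lebesgueX R d)%E (@cons_point R d @^-1` A)).
have -> : @cons_point R d @^-1` (tshift a @^-1` A) =
    prod_shift a @^-1` (@cons_point R d @^-1` A).
  suff E : tshift a \o @cons_point R d = @cons_point R d \o prod_shift a.
    by rewrite -[LHS]/((tshift a \o @cons_point R d) @^-1` A) E.
  apply/funext => -[x t].
  apply: eq_from_tnth => i; rewrite tnth_mktuple.
  case: (unliftP ord0 i) => [j ->|->].
    by rewrite [in LHS](tuple_eta a) !tnthS tnth_mktuple.
  by rewrite [in LHS](tuple_eta a) !tnth0.
rewrite -[LHS]/(pushforward (lebesgue_measure \x lebesgueX R d)%E (prod_shift a)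
  (@cons_point R d @^-1` A)).
apply/esym/product_measure_unique => // B C mB mC.
rewrite /= /pushforward.
rewrite (_ : prod_shift a @^-1` (B `*` C) =
  (line_shift (thead a) @^-1` B) `*` (tshift [tuple of behead a] @^-1` C)); last first.
  by apply/seteqP; split => -[x t].
rewrite product_measure1E.
- by congr (_ * _)%E; [exact: lebesgue_measure_shift|exact: IH].
- by rewrite -[X in measurable X]setTI; exact: measurable_line_shift.
- by rewrite -[X in measurable X]setTI; exact: measurable_tshift.
Qed.

End space_translation.

(** * Integer translations as unitary operators on L^2(R^d) *)

Section translates.
Context (R : realType) (d : nat).
Local Notation mu := (lebesgueX R d).
Local Notation fct := (Rd R d -> R[i]).
Local Notation "<< f , g >>" := (L2dot f g).
Implicit Types (f g h : fct) (k l : d.-tuple int).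

Lemma integrable_shift (a : d.-tuple R) (u : Rd R d -> R) :
  mu.-integrable setT (fun x => (u x)%:E) ->
  mu.-integrable setT (fun x => (u (tshift a x))%:E) /\
  \int[mu]_x u (tshift a x) = \int[mu]_x u x.
Proof.
move=> iu.
have /measurable_EFinP mu_ := measurable_int _ iu.
have ma : measurable_fun setT (fun x => u (tshift a x)).
  exact: (measurableT_comp mu_ (measurable_tshift a)).
have ge0_shift (v : Rd R d -> R) : measurable_fun setT v -> (forall x, 0 <= v x) ->
    (\int[mu]_x (v (tshift a x))%:E = \int[mu]_x (v x)%:E)%E.
  move=> mv v0.
  have := @ge0_integral_pushforward _ _ _ _ R (tshift a) (measurable_tshift a) mu
    setT (EFin \o v) measurableT.
  rewrite preimage_setT => <-; last 2 first.
  - exact/measurable_EFinP.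
  - by move=> x _; rewrite lee_fin.
  apply: eq_measure_integral => A mA _.
  exact: (@lebesgueX_shift _ _ a A mA).
have ia : mu.-integrable setT (fun x => (u (tshift a x))%:E).
  apply/integrableP; split; first exact/measurable_EFinP.
  rewrite (_ : integral _ _ _ = \int[mu]_x (`|u (tshift a x)|)%:E)%E; last exact: eq_integral.
  rewrite (ge0_shift (fun x => `|u x|))//; last exact: measurableT_comp.
  by case/integrableP: iu.
split => //.
have := @integral_pushforward _ _ _ _ R (tshift a) (measurable_tshift a) mu
    setT (EFin \o u).
rewrite preimage_setT => H; congr fine; rewrite -H//; last exact/measurable_EFinP.
apply: eq_measure_integral => A mA _.
exact: (@lebesgueX_shift _ _ a A mA).
Qed.

Definition real_point k : d.-tuple R := [tuple (tnth k i)%:~R | i < d].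

Lemma translateE k f x : translate k f x = f (tshift (real_point k) x).
Proof.
by congr f; apply/eq_from_tnth => i; rewrite !tnth_mktuple.
Qed.

Lemma cmeas_translate k f : cmeas f -> cmeas (translate k f).
Proof.
move=> [f1 f2]; split; under eq_fun do rewrite translateE.
- exact: (measurableT_comp f1 (measurable_tshift _)).
- exact: (measurableT_comp f2 (measurable_tshift _)).
Qed.

Lemma cint_translate k f : cintegrable mu f -> cint mu (translate k f) = cint mu f.
Proof.
move=> [f1 f2]; apply: complexP => /=.
- rewrite -(integrable_shift (real_point k) f1).2.
  by apply: eq_Rintegral => x _; rewrite translateE.
- rewrite -(integrable_shift (real_point k) f2).2.
  by apply: eq_Rintegral => x _; rewrite translateE.
Qed.

Lemma L2_translate k f : L2 f -> L2 (translate k f).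
Proof.
move=> /L2P[mf i_f]; apply/L2P; split; first exact: cmeas_translate.
have [H _] := integrable_shift (real_point k) i_f.
by apply: eq_integrable H => // x _; rewrite translateE.
Qed.

Lemma L2dot_translate k f g : L2 f -> L2 g ->
  <<translate k f, translate k g>> = <<f, g>>.
Proof.
move=> f2 g2; rewrite !L2dotE -[RHS](cint_translate k)//.
exact: L2_mul_conj.
Qed.

Lemma translateD k f g : translate k (f + g) = translate k f + translate k g.
Proof. by []. Qed.

Lemma translateZ k c f : translate k (cscale c f) = cscale c (translate k f).
Proof. by []. Qed.

Lemma translateB k f g : translate k (f - g) = translate k f - translate k g.
Proof. by []. Qed.

Definition addk k l : d.-tuple int := [tuple tnth k i + tnth l i | i < d].
Definition oppk k : d.-tuple int := [tuple - tnth k i | i < d].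
Definition zerok : d.-tuple int := [tuple 0 | i < d].

Lemma translate_translate k l f : translate k (translate l f) = translate (addk k l) f.
Proof.
apply/funext => x; congr f; apply/eq_from_tnth => i.
by rewrite !tnth_mktuple rmorphD /= opprD addrA.
Qed.

Lemma translate0 f : translate zerok f = f.
Proof.
apply/funext => x; congr f; apply/eq_from_tnth => i.
by rewrite !tnth_mktuple subr0.
Qed.

Lemma addkN k : addk k (oppk k) = zerok.
Proof. by apply/eq_from_tnth => i; rewrite !tnth_mktuple subrr. Qed.
Lemma addNk k : addk (oppk k) k = zerok.
Proof. by apply/eq_from_tnth => i; rewrite !tnth_mktuple addNr. Qed.
Lemma addkA k l p : addk k (addk l p) = addk (addk k l) p.
Proof. by apply/eq_from_tnth => i; rewrite !tnth_mktuple addrA. Qed.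
Lemma addkC k l : addk k l = addk l k.
Proof. by apply/eq_from_tnth => i; rewrite !tnth_mktuple addrC. Qed.
Lemma add0k k : addk zerok k = k.
Proof. by apply/eq_from_tnth => i; rewrite !tnth_mktuple add0r. Qed.
Lemma oppkK k : oppk (oppk k) = k.
Proof. by apply/eq_from_tnth => i; rewrite !tnth_mktuple opprK. Qed.

Lemma L2dot_translateK k f g : L2 f -> L2 g ->
  <<translate k f, g>> = <<f, translate (oppk k) g>>.
Proof.
move=> f2 g2; rewrite -[RHS](L2dot_translate k)//; last exact: L2_translate.
by rewrite translate_translate addkN translate0.
Qed.

Lemma L2norm_translate k f : L2 f -> L2norm (translate k f) = L2norm f.
Proof.
move=> f2; apply/eqP; rewrite -(@eqrXn2 _ 2)// ?L2norm_ge0//; apply/eqP.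
apply: (@complexI R); rewrite -!L2dot_self L2dot_translate//.
Qed.

End translates.

(** * Riesz representation, orthogonal projections and closed shift-invariant spaces *)

Section hilbert.
Context (R : realType) (d : nat).
Local Notation mu := (lebesgueX R d).
Local Notation fct := (Rd R d -> R[i]).
Local Notation "<< f , g >>" := (L2dot f g).
Implicit Types (f g h p : fct) (V : set fct).

(** Closedness refers to the L^2 seminorm, so it includes stability under almost everywhere
    equality. *)
Definition closed_subspace V := [/\ V `<=` @L2 R d, V 0,
  forall f g, V f -> V g -> V (f + g),
  forall c f, V f -> V (cscale c f) &
  forall f, L2 f -> (forall e, 0 < e -> exists2 h, V h & L2norm (f - h) < e) -> V f].

Definition shift_invariant V := forall k f, V f -> V (translate k f).

Lemma closed_subspace_sub V f g : closed_subspace V -> V f -> V g -> V (f - g).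
Proof. by move=> [_ _ VD VZ _] Vf Vg; rewrite oppE_cscale; apply: VD => //; exact: VZ. Qed.

Lemma closed_subspace_sum V I (s : seq I) (F : I -> fct) : closed_subspace V ->
  (forall i, V (F i)) -> V (\sum_(i <- s) F i).
Proof.
move=> [_ V0 VD _ _] VF; elim: s => [|i s IH]; first by rewrite big_nil.
by rewrite big_cons; exact: VD.
Qed.

Lemma exp_half_small (K e : R) : 0 < e -> exists n : nat, K * 2^-1 ^+ n < e.
Proof.
move=> e0.
have : (fun n => K * 2^-1 ^+ n) @ \oo --> 0.
  by apply: cvg_geometric; rewrite ger0_norm// invf_lt1// ltr1n.
move/cvgrPdist_lt => /(_ e e0)[N _ HN]; exists N.
by have := HN N (leqnn _); rewrite sub0r normrN; exact: le_lt_trans (ler_norm _).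
Qed.

(** Since L is conjugate-homogeneous, the bound by C * (1 + |f|^2) already amounts to continuity,
    and it is the form that follows directly from estimates by sums of squares. The representative
    is the limit of a minimizing sequence for |f|^2 - 2 Re L f. *)
Lemma riesz V (L : fct -> R[i]) (C : R) : closed_subspace V ->
  (forall f g, V f -> V g -> L (f + g) = L f + L g) ->
  (forall c f, V f -> L (cscale c f) = conjc c * L f) ->
  (forall f, V f -> normcR (L f) <= C * (1 + L2norm f ^+ 2)) ->
  exists2 p, V p & forall g, V g -> << p, g >> = L g.
Proof.
move=> [V2 V0 VD VZ Vcl] LD LZ LC.
have C0 : 0 <= C.
  have := LC 0 V0; rewrite L2norm0 expr0n addr0 mulr1.
  by apply: le_trans; exact: normcR_ge0.
pose J f := L2norm f ^+ 2 - 2 * ReC (L f).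
have Lb s f : V f -> 0 < s -> normcR (L f) <= C * (s^-1 + s * L2norm f ^+ 2).
  move=> Vf s0; have := LC _ (VZ ((s%:C)%C) f Vf).
  rewrite LZ// L2norm_sqrZ; last exact: V2.
  rewrite normcRM normcR_conj normcR_real gtr0_norm// => H.
  rewrite -(ler_pM2l s0) (le_trans H)//.
  rewrite le_eqVlt; apply/orP; left; apply/eqP; field; exact: lt0r_neq0.
have JB f : V f -> - (2 * C * (2 * C + 1)) <= J f.
  (* For s = 1 / (2 C + 1) the term 2 C s |f|^2 is absorbed by |f|^2, which bounds J from below. *)
  move=> Vf; have s0 : 0 < (2 * C + 1)^-1 by rewrite invr_gt0; lra.
  have H1 := le_trans (Re_normcR_le _) (Lb _ _ Vf s0).
  rewrite /J; move: H1; rewrite invrK; set r := ReC _; set n2 := L2norm _ ^+ 2 => H1.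
  have n20 : 0 <= n2 by exact: sqr_ge0.
  have : 2 * C * ((2 * C + 1)^-1 * n2) <= n2.
    rewrite mulrA ler_piMl// ler_pdivrMr; lra.
  move: H1; rewrite mulrDr; lra.
pose S := [set J f | f in V].
have S0 : S !=set0 by exists (J 0), 0.
have Slb : has_lbound S by exists (- (2 * C * (2 * C + 1))) => _ [f Vf <-]; exact: JB.
set m := inf S.
have mJ f : V f -> m <= J f by move=> Vf; apply: ge_inf => //; exists f.
(* The extra factor 1/4 compensates the coefficients 2 in [par], so that the squared distances come
   out at most 4^-n. *)
have app n : {u | V u & J u < m + 4^-1 * 4^-1 ^+ n}.
  have e0 : 0 < 4^-1 * 4^-1 ^+ n :> R by rewrite mulr_gt0// ?exprn_gt0// invr_gt0.
  apply: cid2; have [_ [f Vf <-] fm] := @inf_adherent _ S _ e0 (conj S0 Slb).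
  by exists f.
pose u n := s2val (app n).
have Vu n : V (u n) by rewrite /u; case: (app n).
have Ju n : J (u n) < m + 4^-1 * 4^-1 ^+ n by rewrite /u; case: (app n).
have u2 n : L2 (u n) by exact: V2.
(* Parallelogram law: the midpoint of f and g lies in V, so J is at least m there. *)
have par f g : V f -> V g ->
    L2norm (f - g) ^+ 2 <= 2 * J f + 2 * J g - 4 * m.
  move=> Vf Vg.
  have := mJ _ (VZ ((2^-1%:C)%C) _ (VD _ _ Vf Vg)).
  rewrite /J LZ; last exact: VD.
  rewrite L2norm_sqrZ; last by apply: V2; exact: VD.
  rewrite LD// L2norm_sqrD; [|exact: V2|exact: V2].
  rewrite L2norm_sqrB; [|exact: V2|exact: V2].
  rewrite normcR_real gtr0_norm ?invr_gt0// conjc_real !ReImE mul0r subr0.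
  move: (ReC (L f)) (ReC (L g)) (ReC << f, g >>) => a b c.
  move: (L2norm f ^+ 2) (L2norm g ^+ 2) => x y H; lra.
have uc n k : (n <= k)%N -> L2norm (u k - u n) ^+ 2 <= 1 * 4^-1 ^+ n.
  move=> nk; apply: (le_trans (par _ _ (Vu _) (Vu _))).
  have : 4^-1 ^+ k <= 4^-1 ^+ n :> R.
    by apply: ler_wiXn2l => //; rewrite ?invr_ge0 ?invf_le1 ?ler1n.
  have := Ju n; have := Ju k; lra.
have [p p2 up] := L2_complete u2 uc.
have Nup n : L2norm (u n - p) <= 2^-1 ^+ n.
  rewrite -(@ler_pXn2r _ 2)// ?nnegrE ?L2norm_ge0 ?exprn_ge0 ?invr_ge0//.
  rewrite (le_trans (up n))// mul1r exprAC.
  by rewrite (_ : 2^-1 ^+ 2 = 4^-1)//; field.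
have Vp : V p.
  apply: Vcl => // e e0; have [n] := exp_half_small 1 e0; rewrite mul1r => H.
  by exists (u n) => //; rewrite L2norm_distC (le_lt_trans (Nup n)).
have key g : V g -> ReC << p, g >> = ReC (L g).
  move=> Vg; apply/eqP; rewrite -subr_eq0; apply/eqP.
  set D := _ - _; apply/eqP; apply/negP => /negP D0.
  set G := L2norm g ^+ 2; have G0 : 0 <= G by exact: sqr_ge0.
  (* Perturbing [u n] by t * g changes J by about t^2 G + 2 t D. This t makes that at most - D^2 /
     (G + 1), which contradicts the near minimality of [u n] for large n. The denominator G + 1
     stays positive when g has norm 0. *)
  pose t := - D / (G + 1).
  have t_ n : - (4^-1 * 4^-1 ^+ n) <= t ^+ 2 * G + 2 * t * (ReC << u n, g >> - ReC (L g)).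
    have := mJ _ (VD _ _ (Vu n) (VZ ((t%:C)%C) _ Vg)).
    rewrite /J LD ?LZ//; last exact: VZ.
    rewrite L2norm_sqrD; [|exact: V2|by apply: V2; exact: VZ].
    rewrite L2norm_sqrZ; last exact: V2.
    rewrite L2dotZr; [|exact: V2|exact: V2].
    rewrite conjc_real normcR_real real_normK ?num_real// -/G.
    rewrite !ReImE !mul0r !subr0.
    have := Ju n; rewrite /J.
    move: (ReC << u n, g >>) (ReC (L g)) (ReC (L (u n))) (L2norm (u n) ^+ 2) => a b c x.
    move: (t ^+ 2 * G) => y; move=> *; lra.
  have eta : 0 < D ^+ 2 / (G + 1).
    rewrite divr_gt0 ?ltr_wpDl// exprn_even_gt0//=.
  pose K := 2 * `|t| * L2norm g + 1.
  have [n Hn] := exp_half_small K eta.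
  have := t_ n; apply/negP; rewrite -ltNge.
  have H1 : `|ReC << u n, g >> - ReC << p, g >>| <= 2^-1 ^+ n * L2norm g.
    rewrite -ReB -L2dotBl//; last exact: V2.
    apply: le_trans (le_Re_normc _) _; apply: le_trans (normc_L2dot_le _ _) _.
    - exact: L2_sub.
    - exact: V2.
    - by rewrite ler_wpM2r// L2norm_ge0.
  have H2 : 4^-1 * 4^-1 ^+ n <= 2^-1 ^+ n :> R.
    have q0 : 0 <= 2^-1 ^+ n :> R by rewrite exprn_ge0// invr_ge0.
    have q1 : 2^-1 ^+ n <= 1 :> R by rewrite exprn_ile1// invf_le1// ler1n.
    have -> : 4^-1 ^+ n = 2^-1 ^+ n * 2^-1 ^+ n :> R.
      by rewrite -exprMn; congr (_ ^+ _); field.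
    have : 2^-1 ^+ n * 2^-1 ^+ n <= 2^-1 ^+ n :> R by rewrite ler_piMl.
    lra.
  have H3 : t * (ReC << u n, g >> - ReC << p, g >>) <= `|t| * (2^-1 ^+ n * L2norm g).
    by rewrite (le_trans (ler_norm _))// normrM ler_wpM2l.
  have H4 : t ^+ 2 * G + 2 * t * D <= - (D ^+ 2 / (G + 1)).
    rewrite /t -subr_ge0 (_ : _ - _ = D ^+ 2 / (G + 1) ^+ 2).
      by rewrite divr_ge0 ?sqr_ge0// exprn_ge0// addr_ge0.
    by field; rewrite gt_eqF// ltr_wpDl.
  have : t * (ReC << u n, g >> - ReC (L g)) =
    t * (ReC << u n, g >> - ReC << p, g >>) + t * D by rewrite /D; ring.
  move: Hn; rewrite /K mulrDl mul1r.
  have -> : 2 * `|t| * L2norm g * 2^-1 ^+ n = 2 * (`|t| * (2^-1 ^+ n * L2norm g)) by ring.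
  move: H1 H2 H3 H4; rewrite -!mulrA.
  move: (ReC << u n, g >>) (ReC << p, g >>) (ReC (L g)) => *; lra.
exists p => // g Vg; apply: complexP; first exact: key.
(* Replacing g by i g turns the equality of real parts into that of imaginary parts. *)
have := key _ (VZ 'i%C _ Vg).
by rewrite LZ// L2dotZr// ?ReImE /= ?mul0r ?mulN1r ?sub0r ?opprK ?mul0r ?oppr0 ?mul1r; [|exact: V2].
Qed.

Lemma orthogonal_projection_exists V f : closed_subspace V -> L2 f ->
  exists p, is_orthogonal_projection V f p.
Proof.
move=> clV f2; have [V2 V0 VD VZ _] := clV.
have [|||p Vp pP] := @riesz V (fun g => << f, g >>) (L2norm f ^+ 2 + 1) clV.
- by move=> g h Vg Vh; rewrite L2dotDr//; exact: V2.
- by move=> c g Vg; rewrite L2dotZr//; exact: V2.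
- move=> g Vg; apply: le_trans (normc_L2dot_le f2 (V2 _ Vg)) _.
  have := L2norm_ge0 f; have := L2norm_ge0 g.
  move: (L2norm f) (L2norm g) => a b *; nra.
- exists p; split => // v Vv; rewrite L2dotBl ?pP ?subrr//; exact: V2.
Qed.

Lemma orthogonal_projectionP V f : closed_subspace V -> L2 f ->
  is_orthogonal_projection V f (orthogonal_projection V f).
Proof.
move=> clV f2; exact: (@xgetPex _ 0 [set p | is_orthogonal_projection V f p]
  (orthogonal_projection_exists clV f2)).
Qed.

Lemma orthogonal_projection_le V f p q : closed_subspace V -> L2 f ->
  is_orthogonal_projection V f p -> V q -> L2norm (f - p) ^+ 2 <= L2norm (f - q) ^+ 2.
Proof.
move=> clV f2 [Vp fp] Vq; have [V2 _ _ _ _] := clV.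
have p2 := V2 _ Vp; have q2 := V2 _ Vq.
have -> : f - q = (f - p) + (p - q) by rewrite addrA subrK.
rewrite [leRHS]L2norm_sqrD; [|exact: L2_sub|exact: L2_sub].
rewrite fp; last exact: closed_subspace_sub.
by rewrite mulr0 addr0 lerDl sqr_ge0.
Qed.

(** The list of translations in a combination may contain repetitions. Counting them moves two
    combinations to a common duplicate-free list, over which they can be added. *)
Lemma sum_count_undup (T : eqType) (V : zmodType) (K1 K : seq T) (F : T -> V) :
  uniq K -> {subset K1 <= K} ->
  \sum_(k <- K1) F k = \sum_(k <- K) F k *+ count_mem k K1.
Proof.
move=> uK; elim: K1 => [|a K1 IH] sK.
  by rewrite big_nil big1// => k _; rewrite mulr0n.
rewrite big_cons IH; last by move=> k kK; apply: sK; rewrite inE kK orbT.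
under [RHS]eq_bigr do rewrite /= mulrnDr.
rewrite big_split /=; congr (_ + _).
rewrite (bigD1_seq a)//=; last by apply: sK; rewrite inE eqxx.
by rewrite eqxx mulr1n big1 ?addr0// => k /negbTE; rewrite eq_sym => ->.
Qed.

Section shift_invariant_space.
Context (s : nat) (phi : 'I_s -> fct).

Lemma span_translatesE (K : seq (d.-tuple int)) (c : 'I_s -> d.-tuple int -> R[i]) :
  (fun x => \sum_(i < s) \sum_(k <- K) c i k * translate k (phi i) x) =
  \sum_(i < s) \sum_(k <- K) cscale (c i k) (translate k (phi i)).
Proof.
apply/funext => x; rewrite fct_sumE; apply: eq_bigr => i _.
by rewrite fct_sumE.
Qed.

Lemma span_translatesD f g : span_translates phi f -> span_translates phi g ->
  span_translates phi (f + g).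
Proof.
move=> [K1 [c1 ->]] [K2 [c2 ->]].
pose K := undup (K1 ++ K2).
exists K, (fun i k => c1 i k *+ count_mem k K1 + c2 i k *+ count_mem k K2).
apply/funext => x.
transitivity (\sum_(i < s) (\sum_(k <- K1) c1 i k * translate k (phi i) x +
    \sum_(k <- K2) c2 i k * translate k (phi i) x)); first by rewrite big_split.
apply: eq_bigr => i _.
rewrite (@sum_count_undup _ _ K1 K)//; last 2 first.
- exact: undup_uniq.
- by move=> k; rewrite mem_undup mem_cat => ->.
rewrite (@sum_count_undup _ _ K2 K)//; last 2 first.
- exact: undup_uniq.
- by move=> k; rewrite mem_undup mem_cat orbC => ->.
rewrite -big_split /=; apply: eq_bigr => k _.
by rewrite mulrDl !mulrnAl.
Qed.

Lemma span_translatesZ c f : span_translates phi f -> span_translates phi (cscale c f).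
Proof.
move=> [K [c1 ->]]; exists K, (fun i k => c * c1 i k); apply/funext => x.
rewrite /cscale mulr_sumr; apply: eq_bigr => i _; rewrite mulr_sumr.
by apply: eq_bigr => k _; rewrite mulrA.
Qed.

Lemma span_translatesT k f : span_translates phi f -> span_translates phi (translate k f).
Proof.
move=> [K [c ->]]; exists (map (addk k) K), (fun i l => c i (addk (oppk k) l)).
apply/funext => x; rewrite /translate; apply: eq_bigr => i _; rewrite big_map.
apply: eq_bigr => l _; rewrite addkA addNk add0k; congr (_ * _).
by rewrite -[LHS]/(translate k (translate l (phi i)) x) translate_translate.
Qed.

Hypothesis phi2 : forall i, L2 (phi i).

Lemma span_translates_L2 f : span_translates phi f -> L2 f.
Proof.
move=> [K [c ->]]; rewrite span_translatesE; apply: L2_sum => i; apply: L2_sum => k.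
exact/L2_scale/L2_translate.
Qed.

Lemma span_translates_sis f : span_translates phi f -> sis phi f.
Proof.
move=> phif; split; first exact: span_translates_L2.
by move=> e e0; exists f => //; rewrite subrr L2norm0.
Qed.

Lemma closed_subspace_sis : closed_subspace (sis phi).
Proof.
split.
- by move=> f [].
- apply: span_translates_sis; exists [::], (fun _ _ => 0).
  by apply/funext => x; rewrite big1// => i _; rewrite big_nil.
- move=> f g [f2 fh] [g2 gh]; split; first exact: L2_add.
  move=> e e0; have e2 : 0 < e / 2 by rewrite divr_gt0.
  have [h hs hf] := fh _ e2; have [k ks kg] := gh _ e2.
  exists (h + k); first exact: span_translatesD.
  rewrite (_ : f + g - (h + k) = (f - h) + (g - k)); last by rewrite opprD addrACA.
  have := L2norm_triangle (L2_sub f2 (span_translates_L2 hs)) (L2_sub g2 (span_translates_L2 ks)).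
  lra.
- move=> c f [f2 fh]; split; first exact: L2_scale.
  move=> e e0; have c0 : 0 < normcR c + 1 by rewrite ltr_wpDl// normcR_ge0.
  have [h hs hf] := fh _ (divr_gt0 e0 c0).
  exists (cscale c h); first exact: span_translatesZ.
  have -> : cscale c f - cscale c h = cscale c (f - h).
    by apply/funext => x; rewrite /cscale [RHS]mulrBr.
  rewrite L2normZ; last by apply: L2_sub => //; exact: span_translates_L2.
  have := normcR_ge0 c; have := L2norm_ge0 (f - h).
  move: hf; rewrite ltr_pdivlMr// mulrDr mulr1 => H1 H2 H3.
  by rewrite (le_lt_trans _ H1)// mulrC lerDl.
- move=> f f2 fh; split => // e e0; have e2 : 0 < e / 2 by rewrite divr_gt0.
  have [h [h2 hh] hf] := fh _ e2; have [k ks kh] := hh _ e2.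
  exists k => //; have k2 := span_translates_L2 ks.
  have := L2norm_triangleB f2 h2 k2; lra.
Qed.

Lemma shift_invariant_sis : shift_invariant (sis phi).
Proof.
move=> k f [f2 fh]; split; first exact: L2_translate.
move=> e e0; have [h hs hf] := fh _ e0.
exists (translate k h); first exact: span_translatesT.
rewrite -translateB L2norm_translate//.
by apply: L2_sub => //; exact: span_translates_L2.
Qed.

(** This minimality yields the inclusion in S(F), and it embeds the space of some of the generators
    into the space of all of them. *)
Lemma sis_min V : closed_subspace V -> shift_invariant V -> (forall i, V (phi i)) ->
  sis phi `<=` V.
Proof.
move=> clV sV Vphi f [f2 fh]; have [_ _ _ VZ Vcl] := clV.
apply: Vcl => // e e0; have [h [K [c ->]] hf] := fh _ e0.
exists (fun x => \sum_(i < s) \sum_(k <- K) c i k * translate k (phi i) x) => //.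
rewrite span_translatesE; apply: closed_subspace_sum => // i.
by apply: closed_subspace_sum => // k; apply: VZ; exact: sV.
Qed.

End shift_invariant_space.
End hilbert.

(** * Uniqueness of Fourier coefficients *)

Section bernstein_limit.
Context (R : realType).
Implicit Types (t th : R).

Lemma bernoulli_ge (a : R) n : 0 <= a <= 1 -> 1 - n%:R * a <= (1 - a) ^+ n.
Proof.
move=> /andP[a0 a1]; elim: n => [|n IH]; first by rewrite mul0r subr0 expr0.
rewrite exprSr; have a1' : 0 <= 1 - a by rewrite subr_ge0.
apply: le_trans (ler_wpM2r a1' IH); rewrite -natr1.
have : 0 <= n%:R * a * a by rewrite !mulr_ge0.
lra.
Qed.

Lemma bernoulli_le (a : R) n : 0 <= a <= 1 -> (1 - a) ^+ n * (1 + n%:R * a) <= 1.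
Proof.
move=> /andP[a0 a1]; elim: n => [|n IH]; first by rewrite mul0r addr0 mulr1 expr0.
apply: le_trans IH; rewrite exprSr -mulrA ler_wpM2l ?exprn_ge0 ?subr_ge0//.
rewrite -natr1; have : 0 <= n%:R * a * a by rewrite !mulr_ge0.
have : 0 <= a * a by exact: mulr_ge0.
lra.
Qed.

Lemma cvg_natr_expr (r : R) : 0 <= r < 1 -> (fun n => n%:R * r ^+ n) @ \oo --> 0.
Proof.
move=> /andP[r0 r1].
(* In r^n = q^n * q^n one factor absorbs n and the other tends to 0. *)
pose q := Num.sqrt r.
have q0 : 0 <= q by exact: sqrtr_ge0.
have q1 : q < 1 by rewrite -[ltRHS]sqrtr1 ltr_sqrt.
have rq n : r ^+ n = q ^+ n * q ^+ n by rewrite -exprMn -expr2 sqr_sqrtr.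
have bd n : n%:R * q ^+ n <= (1 - q)^-1.
  rewrite -[leRHS]mul1r ler_pdivlMr ?subr_gt0//.
  have -> : n%:R * q ^+ n * (1 - q) = q ^+ n * (n%:R * (1 - q)) by ring.
  have := @bernoulli_le (1 - q) n; rewrite subr_ge0 ltW//= lerBlDr lerDl q0 => /(_ isT).
  rewrite subKr; apply: le_trans; rewrite ler_wpM2l ?exprn_ge0// lerDr//.
apply: (@squeeze_cvgr _ _ _ _ (fun=> 0) (fun n => (1 - q)^-1 * q ^+ n)).
- apply: nearW => n; rewrite mulr_ge0 ?exprn_ge0//= rq mulrA ler_wpM2r ?exprn_ge0//.
- exact: cvg_cst.
- by apply: cvg_geometric; rewrite ger0_norm.
Qed.

(* With N = n * th^-n one has N * t^n -> 0 for t < th and N * t^n -> +oo for t >= th,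
   so that (1 - t^n)^N tends to the indicator of [t < th]. *)
Definition steep_exponent th n := (n * (Num.truncn (th^-1 ^+ n)).+1)%N.

Lemma cvg_steep th t : 0 < th -> th < 1 -> 0 <= t <= 1 ->
  (fun n => (1 - t ^+ n) ^+ steep_exponent th n) @ \oo --> ((t < th)%R%:R : R).
Proof.
move=> th0 th1 /andP[t0 t1].
have c0 : 0 < th^-1 by rewrite invr_gt0.
have tn n : 0 <= t ^+ n <= 1 by rewrite exprn_ge0// exprn_ile1.
(* K1 and K2 place the exponent between n * th^-n and twice that number: rounding up costs at most a
   factor 2 because th^-n >= 1. *)
have K1 n : n%:R * th^-1 ^+ n <= (steep_exponent th n)%:R.
  rewrite natrM ler_wpM2l//; apply: ltW.
  by have := @truncn_itv R (th^-1 ^+ n) (exprn_ge0 _ (ltW c0)) => /andP[].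
have K2 n : (steep_exponent th n)%:R <= 2 * (n%:R * th^-1 ^+ n).
  rewrite natrM mulrCA ler_wpM2l// -natr1.
  have := @truncn_itv R (th^-1 ^+ n) (exprn_ge0 _ (ltW c0)) => /andP[H _].
  have : 1 <= th^-1 ^+ n by rewrite exprn_ege1// invf_ge1// ltW.
  lra.
case: ltP => tth.
- have ct1 : 0 <= th^-1 * t < 1.
    by rewrite mulr_ge0 ?(ltW c0)//= mulrC ltr_pdivrMr// mul1r.
  apply: (@squeeze_cvgr _ _ _ _ (fun n => 1 - 2 * (n%:R * (th^-1 * t) ^+ n)) (fun=> 1)).
  + apply: nearW => n; apply/andP; split; last first.
      by apply: exprn_ile1; [rewrite subr_ge0; case/andP: (tn n)|rewrite lerBlDr lerDl; case/andP: (tn n)].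
    apply: le_trans (bernoulli_ge _ (tn n)).
    rewrite lerD2l lerN2 exprMn !mulrA ler_wpM2r//; first by case/andP: (tn n).
    by rewrite -mulrA.
  + rewrite -[X in _ --> X]subr0 -[X in _ - X](mulr0 2).
    by apply: cvgB; [exact: cvg_cst|apply: cvgM; [exact: cvg_cst|exact: cvg_natr_expr]].
  + exact: cvg_cst.
(* For t >= th the exponent times t^n is at least n, so the Bernoulli bound makes the power at most
   1 / (n + 1). *)
- apply: (@squeeze_cvgr _ _ _ _ (fun=> 0) (fun n => n.+1%:R^-1)).
  + apply: nearW => n; apply/andP; split.
      by apply: exprn_ge0; rewrite subr_ge0; case/andP: (tn n).
    rewrite -[leRHS]mul1r ler_pdivlMr//.
    apply: le_trans (bernoulli_le (steep_exponent th n) (tn n)).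
    rewrite ler_wpM2l//; first by apply: exprn_ge0; rewrite subr_ge0; case/andP: (tn n).
    rewrite -natr1 addrC lerD2l.
    apply: (@le_trans _ _ (n%:R * th^-1 ^+ n * t ^+ n)); last first.
      by rewrite ler_wpM2r//; case/andP: (tn n).
    rewrite -mulrA -exprMn ler_peMr// exprn_ege1//.
    by rewrite mulrC ler_pdivlMr// mul1r.
  + exact: cvg_cst.
  + exact: cvg_harmonic.
Qed.

End bernstein_limit.

Section vanishing_coefficients.
Context d (T : measurableType d) (R : realType) (P : {finite_measure set T -> \bar R}).
Context (K : Type) (e : K -> T -> R[i]).
Hypothesis me : forall k, cmeas (e k).
Hypothesis ne : forall k x, normcR (e k x) = 1.
Implicit Types (h u : T -> R[i]) (B : set T).

Definition null_coefs h := cintegrable P h /\ forall k, cint P (fun x => h x * e k x) = 0.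

(* The bounded functions preserving the integrable functions with vanishing
   coefficients form an algebra containing the characters and closed under bounded
   pointwise limits; the sets whose indicator is a multiplier thus form a
   sigma-algebra, which replaces the Stone-Weierstrass theorem. *)
Definition multiplier u := [/\ cmeas u, exists C : R, forall x, normcR (u x) <= C &
  forall h, null_coefs h -> null_coefs (fun x => h x * u x)].

Definition coef_set B := measurable B /\ multiplier (fun x => ((\1_B x : R)%:C)%C).

Lemma cintegrable_coef h k : cintegrable P h -> cintegrable P (fun x => h x * e k x).
Proof.
move=> ih; under eq_fun do rewrite mulrC.
by apply: (@cintegrableMb _ _ _ _ _ _ 1) => // x; rewrite ne.
Qed.

Lemma multiplier_cst c : multiplier (fun=> c).
Proof.
split; first exact: cmeas_cst.
  by exists (normcR c).
move=> h [ih ch]; split.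
  by apply: cintegrable_eq (cintegrableZ c ih) => x; rewrite mulrC.
move=> k; rewrite (_ : cint _ _ = c * cint P (fun x => h x * e k x)); first by rewrite ch mulr0.
rewrite -cintZ; last exact: cintegrable_coef.
by apply: cint_eq => x; rewrite [h x * c]mulrC mulrA.
Qed.

Lemma multiplierD u v : multiplier u -> multiplier v -> multiplier (fun x => u x + v x).
Proof.
move=> [mu_ [C uC] Mu] [mv [D vD] Mv]; split; first exact: cmeasD.
  by exists (C + D) => x; apply: le_trans (normcR_triangle _ _) (lerD (uC x) (vD x)).
move=> h hG; have [iu cu] := Mu _ hG; have [iv cv] := Mv _ hG; split.
  by apply: cintegrable_eq (cintegrableD iu iv) => x; rewrite mulrDr.
move=> k; rewrite -[RHS]addr0 -{1}(cu k) -(cv k) -cintD; last 2 first.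
- exact: cintegrable_coef.
- exact: cintegrable_coef.
by apply: cint_eq => x; rewrite mulrDr mulrDl.
Qed.

Lemma multiplierM u v : multiplier u -> multiplier v -> multiplier (fun x => u x * v x).
Proof.
move=> [mu_ [C uC] Mu] [mv [D vD] Mv]; split; first exact: cmeasM.
  by exists (C * D) => x; rewrite normcRM ler_pM ?normcR_ge0.
move=> h hG; have [iv cv] := Mv _ (Mu _ hG); split.
  by apply: cintegrable_eq iv => x; rewrite mulrA.
by move=> k; rewrite -[RHS](cv k); apply: cint_eq => x; rewrite mulrA.
Qed.

Lemma multiplierX u n : multiplier u -> multiplier (fun x => u x ^+ n).
Proof.
move=> Mu; elim: n => [|n IH]; first exact: (multiplier_cst 1).
by under eq_fun do rewrite exprS; exact: multiplierM.
Qed.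

Lemma multiplier_ae u v : cmeas v -> (exists C : R, forall x, normcR (v x) <= C) ->
  {ae P, forall x, u x = v x} -> multiplier u -> multiplier v.
Proof.
move=> mv vC uv [mu_ [C uC] Mu]; split => // h [ih ch].
have [ihu chu] := Mu _ (conj ih ch).
have mh := cintegrable_cmeas ih.
have hv : {ae P, forall x, h x * v x = h x * u x}.
  by apply: filterS uv => x ->.
have ihv : cintegrable P (fun x => h x * v x).
  by apply: cintegrable_ae_eq hv => //; exact: cmeasM.
split => // k; rewrite -[RHS](chu k); apply: cint_ae_eq.
- exact/cintegrable_cmeas/cintegrable_coef.
- exact/cintegrable_cmeas/cintegrable_coef.
- by apply: filterS hv => x ->.
Qed.

(** Dominated convergence: the characters have modulus 1 and the [v n] are bounded by 1, so |h|
    dominates all the integrands and the vanishing coefficients pass to the limit. *)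
Lemma multiplier_lim (v : nat -> T -> R) (w : T -> R) :
  (forall n, multiplier (fun x => ((v n x)%:C)%C)) -> (forall n x, `|v n x| <= 1) ->
  (forall x, v^~ x @ \oo --> w x) -> multiplier (fun x => ((w x)%:C)%C).
Proof.
move=> Mv v1 vw.
have mv n : measurable_fun setT (v n) by case: (Mv n) => -[].
have mw : measurable_fun setT w by apply: (measurable_fun_cvg mv) => x _; exact: vw.
have w1 x : `|w x| <= 1.
  by apply: (cvgr_to_le (cvg_norm (vw x))); apply: nearW => n; exact: v1.
split; first exact: cmeas_real.
  by exists 1 => x; rewrite normcR_real.
move=> h hG; have [[ih1 ih2] ch] := hG; have mh := cintegrable_cmeas hG.1.
have ihw : cintegrable P (fun x => h x * ((w x)%:C)%C).
  under eq_fun do rewrite mulrC.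
  apply: (@cintegrableMb _ _ _ _ _ _ 1); [exact: cmeas_real| |exact: hG.1].
  by move=> x; rewrite normcR_real.
split => // k.
have MvG n : null_coefs (fun x => h x * ((v n x)%:C)%C) by case: (Mv n) => _ _; apply.
have ihk n := cintegrable_coef k (MvG n).1.
pose g x := normcR (h x).
have ig : P.-integrable setT (EFin \o g) by exact: cintegrable_normcR.
have step (p : R[i] -> R) (v' : nat -> T -> R) (w' : T -> R) :
    (forall n, measurable_fun setT (v' n)) -> measurable_fun setT w' ->
    (forall n x, `|v' n x| <= g x) -> (forall x, v'^~ x @ \oo --> w' x) ->
    (forall n, \int[P]_x v' n x = 0) -> \int[P]_x w' x = 0.
  move=> mv' mw' v'g v'w' Iv.
  have [] := @dominated_convergence _ _ _ P setT measurableT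
    (fun n x => (v' n x)%:E) (EFin \o w') (EFin \o g).
  - by move=> n; exact/measurable_EFinP.
  - exact/measurable_EFinP.
  - by apply: aeW => x _; apply: cvg_EFin; [exact: nearW|exact: v'w'].
  - exact: ig.
  - by apply: aeW => x n _; rewrite lee_fin.
  move=> iw' _; rewrite -(fineK (integrable_fin_num measurableT iw')) => /fine_cvgP[_ H].
  have : (fun=> 0 : R) @ \oo --> fine (\int[P]_x (EFin \o w') x)%E.
    by apply: cvg_trans H; apply: near_eq_cvg; apply: nearW => n /=; rewrite -[RHS](Iv n).
  by move=> Hc; have := cvg_lim (@Rhausdorff R) Hc; rewrite lim_cst// => Hz; exact: esym (Hz _).
have vb n x : normcR (h x * ((v n x)%:C)%C * e k x) <= g x.
  by rewrite !normcRM ne mulr1 normcR_real ler_piMr ?normcR_ge0.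
have cE : (fun x => h x * ((w x)%:C)%C * e k x) = (fun x => h x * e k x * ((w x)%:C)%C).
  by apply/funext => x; rewrite mulrAC.
have mwk := cintegrable_cmeas (cintegrable_coef k ihw).
have zero n : cint P (fun x => h x * ((v n x)%:C)%C * e k x) = 0.
  by have [_ ->] := MvG n.
apply: complexP => /=.
- apply: (step (fun z => ReC z) (fun n x => ReC (h x * ((v n x)%:C)%C * e k x))).
  + by move=> n; case: (cintegrable_cmeas (ihk n)).
  + by case: mwk.
  + by move=> n x; apply: le_trans (le_Re_normc _) (vb n x).
  + move=> x; rewrite [h x * _]mulrC -mulrA !ReImE mul0r subr0.
    under eq_fun do rewrite [h x * _]mulrC -mulrA !ReImE mul0r subr0.
    by apply: cvgM; [exact: vw|exact: cvg_cst].
  + by move=> n; have := congr1 (fun z : R[i] => ReC z) (zero n).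
- apply: (step (fun z => ImC z) (fun n x => ImC (h x * ((v n x)%:C)%C * e k x))).
  + by move=> n; case: (cintegrable_cmeas (ihk n)).
  + by case: mwk.
  + by move=> n x; apply: le_trans (le_Im_normc _) (vb n x).
  + move=> x; rewrite [h x * _]mulrC -mulrA !ReImE mul0r addr0.
    under eq_fun do rewrite [h x * _]mulrC -mulrA !ReImE mul0r addr0.
    by apply: cvgM; [exact: vw|exact: cvg_cst].
  + by move=> n; have := congr1 (fun z : R[i] => ImC z) (zero n).
Qed.

Lemma real_expr (a : R) n : ((a ^+ n)%:C)%C = ((a%:C)%C : R[i]) ^+ n.
Proof. exact: rmorphXn. Qed.

(** Each (1 - t^n)^N is a polynomial in the multiplier t, bounded by 1, and these polynomials
    converge pointwise to the indicator of the sublevel set. *)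
Lemma coef_set_sublevel (t : T -> R) th : (forall x, 0 <= t x <= 1) ->
  multiplier (fun x => ((t x)%:C)%C) -> 0 < th -> th < 1 -> coef_set [set x | t x < th].
Proof.
move=> t01 Mt th0 th1.
have mt : measurable_fun setT t by case: Mt => -[].
split.
  rewrite [X in measurable X](_ : _ = t @^-1` `]-oo, th[%classic); last first.
    by apply/seteqP; split => x /=; rewrite in_itv.
  by rewrite -[X in measurable X]setTI; apply: mt.
apply: (@multiplier_lim (fun n x => (1 - t x ^+ n) ^+ steep_exponent th n)).
- move=> n; under eq_fun do rewrite real_expr; apply: multiplierX.
  under eq_fun do rewrite rmorphB /= real_expr.
  apply: multiplierD; first exact: multiplier_cst.
  under eq_fun do rewrite -mulN1r.
  by apply: multiplierM; [exact: multiplier_cst|exact: multiplierX].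
- move=> n x; have /andP[t0 t1] := t01 x.
  have := exprn_ge0 n t0; have := exprn_ile1 n t0 t1 => ? ?.
  rewrite normrX exprn_ile1// ger0_norm ?subr_ge0// lerBlDr lerDl//.
- move=> x; rewrite indicE mem_setE /=.
  exact: cvg_steep th0 th1 (t01 x).
Qed.

Lemma coef_setC B : coef_set B -> coef_set (~` B).
Proof.
move=> [mB MB]; split; first exact: measurableC.
rewrite (_ : (fun x => _) = (fun x => 1 + (-1) * ((\1_B x : R)%:C)%C)).
  by apply: multiplierD; [exact: multiplier_cst|apply: multiplierM => //; exact: multiplier_cst].
apply/funext => x; rewrite mulN1r !indicE in_setC; case: (x \in B) => /=; rewrite ?subrr ?subr0//.
Qed.

Lemma coef_setI A B : coef_set A -> coef_set B -> coef_set (A `&` B).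
Proof.
move=> [mA MA] [mB MB]; split; first exact: measurableI.
rewrite (_ : (fun x => _) = (fun x => ((\1_A x : R)%:C)%C * ((\1_B x : R)%:C)%C)).
  exact: multiplierM.
by apply/funext => x; rewrite -rmorphM /= !indicE in_setI -natrM mulnb.
Qed.

Lemma coef_setU A B : coef_set A -> coef_set B -> coef_set (A `|` B).
Proof.
move=> cA cB; rewrite -[A `|` B]setCK setCU.
by apply: coef_setC; apply: coef_setI; exact: coef_setC.
Qed.

Lemma coef_set0 : coef_set set0.
Proof.
split => //; rewrite (_ : (fun x => _) = fun=> 0); first exact: multiplier_cst.
by apply/funext => x; rewrite indicE in_set0.
Qed.

(** Finite unions belong to the class by complements and intersections, and their indicators
    converge pointwise to that of the full union. *)
Lemma coef_set_bigcup (F : nat -> set T) : (forall n, coef_set (F n)) ->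
  coef_set (\bigcup_n F n).
Proof.
move=> cF.
have cG n : coef_set (\bigcup_(k < n) F k).
  elim: n => [|n IH].
    by rewrite [X in coef_set X](_ : _ = set0); [exact: coef_set0|apply/seteqP; split => x // [k /=]].
  rewrite [X in coef_set X](_ : _ = (\bigcup_(k < n) F k) `|` F n); first exact: coef_setU.
  apply/seteqP; split => x.
    move=> [k /=]; rewrite ltnS leq_eqVlt => /predU1P[->|kn] Fk; first by right.
    by left; exists k.
  by move=> [[k /= kn Fk]|Fn]; [exists k => //=; exact: ltnW|exists n => /=].
split; first by apply: bigcupT_measurable => n; case: (cF n).
apply: (@multiplier_lim (fun n x => \1_(\bigcup_(k < n) F k) x)).
- by move=> n; case: (cG n).
- by move=> n x; rewrite indicE; case: (_ \in _); rewrite ?normr1 ?normr0.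
move=> x; have [[k _ Fk]|nF] := pselect ((\bigcup_n F n) x).
- rewrite indicE mem_set; last by exists k.
  apply: cvg_near_cst; exists k.+1 => // n /= kn.
  by rewrite indicE mem_set//; exists k.
- rewrite indicE memNset//; apply: cvg_near_cst; apply: nearW => n.
  by rewrite indicE memNset// => -[k _ Fk]; apply: nF; exists k.
Qed.

Lemma sigma_algebra_coef_set : sigma_algebra setT coef_set.
Proof.
split; first exact: coef_set0.
- by move=> A cA; rewrite setTD; exact: coef_setC.
- exact: coef_set_bigcup.
Qed.

Lemma coef_set_ae A B : measurable B -> {ae P, forall x, A x <-> B x} ->
  coef_set A -> coef_set B.
Proof.
move=> mB AB [mA MA]; split => //; apply: multiplier_ae MA.
- by apply: cmeas_real; exact: measurable_indic.
- exists 1 => x; rewrite normcR_real indicE; case: (_ \in _); rewrite ?normr1 ?normr0//.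
- apply: filterS AB => x [AB BA]; rewrite !indicE; do 3 f_equal.
  by apply/idP/idP => /set_mem ?; apply/mem_set; [exact: AB|exact: BA].
Qed.

(** Testing h * 1_A against the constant character shows that h has integral 0 over every measurable
    set A. *)
Lemma null_coefs_eq0 h : (exists k0, forall x, e k0 x = 1) ->
  (forall A, measurable A -> coef_set A) -> null_coefs h -> {ae P, forall x, h x = 0}.
Proof.
move=> [k0 e1] cA hG; have [[ih1 ih2] _] := hG.
have zero A : measurable A -> cint P (fun x => h x * ((\1_A x : R)%:C)%C) = 0.
  move=> /cA[_ [_ _ /(_ _ hG)[_ /(_ k0)]]] => <-.
  by apply: cint_eq => x; rewrite e1 mulr1.
have H (u : T -> R) : P.-integrable setT (EFin \o u) ->
    (forall A, measurable A -> \int[P]_x (u x * \1_A x) = 0) ->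
    {ae P, forall x, u x = 0}.
  move=> iu Iu.
  have : ae_eq P setT (EFin \o u) (cst 0%E).
    apply: integral_ae_eq => // E _ mE; rewrite integral0.
    have /(integrable_fin_num mE) iE : P.-integrable E (EFin \o u).
      exact: (integrableS measurableT mE).
    rewrite -[LHS]fineK// -[RHS]/(0%:E); congr (_%:E).
    rewrite -[LHS]/(Rintegral P E u) Rintegral_mkcond -[RHS](Iu _ mE).
    by apply: eq_Rintegral => x _; rewrite /patch indicE; case: (x \in E); rewrite ?mulr1 ?mulr0.
  by apply: filterS => x H1; have [] := H1 I.
have h1 := H (fun x => ReC (h x)) ih1; have h2 := H (fun x => ImC (h x)) ih2.
apply: filterS2 (h1 _) (h2 _) => [x H1 H2|A mA|A mA]; first exact: complexP.
- have := congr1 (fun z : R[i] => ReC z) (zero _ mA) => /= <-.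
  by apply: eq_Rintegral => x _; rewrite !ReImE mulr0 subr0.
- have := congr1 (fun z : R[i] => ImC z) (zero _ mA) => /= <-.
  by apply: eq_Rintegral => x _; rewrite !ReImE mulr0 add0r.
Qed.

End vanishing_coefficients.

(** * Characters of the circle and their orthogonality *)

Section characters.
Context (R : realType).
Implicit Types (x : R) (k l : int).

(** This is exp(i pi k x). Its period 2 is the length of the interval from -1 to 1, which carries
    the uniform law below. *)
Definition circle_char k x : R[i] :=
  Complex (cos (k%:~R * (pi * x))) (sin (k%:~R * (pi * x))).

Lemma circle_charD k l x : circle_char (k + l) x = circle_char k x * circle_char l x.
Proof.
apply: complexP; rewrite !ReImE /= rmorphD /= mulrDl.
- by rewrite cosD.
- by rewrite sinD addrC.
Qed.

Lemma circle_char0 x : circle_char 0 x = 1.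
Proof. by rewrite /circle_char mul0r cos0 sin0. Qed.

Lemma circle_charN k x : circle_char (- k) x = conjc (circle_char k x).
Proof. by rewrite /circle_char rmorphN /= mulNr cosN sinN. Qed.

Lemma normc_circle_char k x : normcR (circle_char k x) = 1.
Proof. by rewrite /= cos2Dsin2 sqrtr1. Qed.

Lemma cmeas_circle_char k : cmeas (circle_char k : measurableTypeR R -> R[i]).
Proof.
have m1 : measurable_fun setT (fun x : measurableTypeR R => k%:~R * (pi * x) : R).
  by apply: measurable_funM => //; apply: measurable_funM.
split => /=.
- apply: (@measurableT_comp _ _ _ _ _ _ (@cos R)) m1.
  by apply: continuous_measurable_fun; exact: continuous_cos.
- apply: (@measurableT_comp _ _ _ _ _ _ (@sin R)) m1.
  by apply: continuous_measurable_fun; exact: continuous_sin.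
Qed.

Lemma sin_int_pi k : sin (k%:~R * pi) = 0 :> R.
Proof.
have nat n : sin (n%:R * pi) = 0 :> R.
  elim: n => [|n IH]; first by rewrite mul0r sin0.
  by rewrite -natr1 mulrDl mul1r sinDpi IH oppr0.
by case: k => n; [exact: nat|rewrite NegzE rmorphN /= mulNr sinN nat oppr0].
Qed.

Let N1lt1 : (-1 < 1 :> R). Proof. by rewrite (@lt_trans _ _ 0) ?ltrN10. Qed.

Definition circle_prob := uniform_prob N1lt1.
HB.instance Definition _ := Probability.on circle_prob.

Lemma Rintegral_circle_prob1 : \int[circle_prob]_x (1 : R) = 1.
Proof.
rewrite Rintegral_cst// mul1r.
by rewrite [X in fine X](_ : _ = 1%E)//; exact: (probability_setT circle_prob).
Qed.

Lemma circle_prob_itv : circle_prob (~` `]-1, 1[%classic) = 0%E.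
Proof.
have ae1 (a : R) : circle_prob [set a] = 0%E.
  have ma : measurable ([set a] : set (measurableTypeR R)) by exact: measurable_set1.
  apply: (measure0_null_setP circle_prob ma).1.
  apply: dominates_uniform_prob.
  by apply: (measure0_null_setP lebesgue_measure ma).2; exact: lebesgue_measure_set1.
have out : circle_prob (~` `[-1, 1]%classic) = 0%E.
  rewrite /circle_prob /uniform_prob integral0_eq// => x /=.
  by rewrite /uniform_pdf in_itv /= => /negP/negbTE ->.
have -> : ~` `]-1, 1[%classic = ~` `[-1, 1]%classic `|` [set (-1 : R)] `|` [set (1 : R)].
  apply/seteqP; split => x /=; rewrite !in_itv /=.
    move=> H; have [x1|x1] := eqVneq x 1; first by right.
    have [x2|x2] := eqVneq x (-1); first by left; right.
    left; left => /andP[h1 h2]; apply: H.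
    by rewrite !lt_neqAle h1 h2 x1 eq_sym x2.
  case; last by move=> ->; rewrite ltxx andbF.
  case; last by move=> ->; rewrite ltxx.
  by move=> H /andP[h1 h2]; apply: H; rewrite !ltW.
apply/eqP; rewrite eq_le measure_ge0 andbT.
apply: le_trans (measureU2 _ _ _) _ => //; first by apply: measurableU => //; apply: measurableC.
rewrite [X in (_ + X)%E](ae1 1) adde0.
apply: le_trans (measureU2 _ _ _) _ => //; first by apply: measurableC.
rewrite [X in (_ + X)%E](ae1 (-1)) adde0.
by rewrite le_eqVlt; apply/orP; left; apply/eqP; exact: out.
Qed.

Lemma Rintegral_circle_prob0 (f F : R -> R) : continuous f -> (forall x, `|f x| <= 1) ->
  (forall x, is_derive x 1 F (f x)) -> F 1 = F (-1) ->
  \int[circle_prob]_x f x = 0.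
Proof.
move=> cf f1 dF F11.
have mf : measurable_fun [set: measurableTypeR R] (f : measurableTypeR R -> R).
  exact: continuous_measurable_fun.
have i1 : circle_prob.-integrable setT (EFin \o (fun=> 1 : R)).
  exact: finite_measure_integrable_cst.
have i_f : circle_prob.-integrable setT (EFin \o f).
  by apply: (@integrable_dominated _ _ _ _ _ (fun=> 1 : R)) => //.
(* The formula for integrals under a uniform law is applied to a nonnegative function: 1 + f is one
   because |f| <= 1, and the constant contributes exactly 1. *)
have E : \int[circle_prob]_x (1 + f x) = 1.
  rewrite /Rintegral integral_uniform.
  - pose G x := x + F x.
    have dG x : is_derive x 1 G (1 + f x).
      by apply: is_deriveD.
    rewrite (@continuous_FTC2 _ (fun x => 1 + f x) G)//.
    + rewrite -EFinB /G F11 -EFinM /=.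
      by rewrite opprK; field.
    + by apply: continuous_subspaceT => x; apply: cvgD; [exact: cvg_cst|exact: cf].
    + split.
      * by move=> x _; case: (dG x).
      * apply: cvg_at_right_filter; apply: differentiable_continuous.
        by apply/derivable1_diffP; case: (dG (-1)).
      * apply: cvg_at_left_filter; apply: differentiable_continuous.
        by apply/derivable1_diffP; case: (dG 1).
    + by move=> x _; rewrite derive1E; case: (dG x).
  - by apply/measurable_EFinP; exact: measurable_funD.
  - by move=> x; rewrite lee_fin -lerBlDl sub0r; have := f1 x; rewrite ler_norml => /andP[].
move: E; rewrite RintegralD// Rintegral_circle_prob1.
by move/eqP; rewrite -subr_eq0 addrAC subrr add0r => /eqP.
Qed.

Lemma cint_circle_char k : cint circle_prob (circle_char k) = (k == 0)%:R.
Proof.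
have [->|k0] := eqVneq k 0.
  rewrite (_ : circle_char 0 = fun=> 1); last by apply/funext => x; exact: circle_char0.
  apply: complexP; rewrite /= ?Rintegral_circle_prob1//.
  by rewrite Rintegral_cst// mul0r.
pose w : R := k%:~R * pi.
have w0 : w != 0 by rewrite mulf_neq0 ?intr_eq0// gt_eqF// pi_gt0.
have dw x : is_derive x 1 (fun x : R => w * x) w.
  by apply: is_derive_eq; rewrite /GRing.scale /= mulr1.
have cw : continuous (fun x : R => w * x) by exact: mulrl_continuous.
apply: complexP => /=.
- under eq_Rintegral do rewrite mulrA -/w.
  apply: (@Rintegral_circle_prob0 _ (fun x => w^-1 * sin (w * x))).
  + by move=> x; apply: continuous_comp; [exact: cw|exact: continuous_cos].
  + by move=> x; exact: cos_max.
  + move=> x; apply: is_derive_eq.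
    by rewrite /GRing.scale /= mulrCA mulVf// mulr1.
  + by rewrite mulrN !mulr1 /w sinN sin_int_pi oppr0.
- under eq_Rintegral do rewrite mulrA -/w.
  apply: (@Rintegral_circle_prob0 _ (fun x => - (w^-1 * cos (w * x)))).
  + by move=> x; apply: continuous_comp; [exact: cw|exact: continuous_sin].
  + by move=> x; exact: sin_max.
  + move=> x; apply: is_derive_eq.
    by rewrite /GRing.scale /= mulNr mulrN opprK mulrCA mulVf// mulr1.
  + by rewrite mulrN !mulr1 cosN.
Qed.

End characters.

(** * Adding one circle factor to a finite measure *)

Section torus_step.
Context (R : realType) (d : nat) (P : {finite_measure set (Rd R d) -> \bar R}).

Definition torus_step :=
  pushforward (@circle_prob R \x P)%E (@cons_point R d).

Let torus_step0 : torus_step set0 = 0%E.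
Proof. exact: measure0. Qed.

Let torus_step_ge0 A : (0 <= torus_step A)%E.
Proof. exact: measure_ge0. Qed.

Let torus_step_sigma_additive : semi_sigma_additive torus_step.
Proof. exact: measure_semi_sigma_additive. Qed.

HB.instance Definition _ := isMeasure.Build _ _ _ torus_step
  torus_step0 torus_step_ge0 torus_step_sigma_additive.

Lemma circle_prob_prod_lty : ((@circle_prob R \x P)%E setT < +oo)%E.
Proof.
rewrite -setXTT product_measure1E//.
rewrite [X in (X * _)%E](_ : _ = 1%E); last exact: (probability_setT (@circle_prob R)).
by rewrite mul1e -ge0_fin_numE// fin_num_measure.
Qed.

Let torus_step_fin : fin_num_fun torus_step.
Proof.
move=> A mA; rewrite ge0_fin_numE//.
have mcA : measurable (@cons_point R d @^-1` A).
  by rewrite -[X in measurable X]setTI; exact: measurable_cons_point.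
by apply: le_lt_trans circle_prob_prod_lty; apply: (le_measure (@circle_prob R \x P)%E); rewrite ?inE//; exact: mcA.
Qed.

HB.instance Definition _ := Measure_isFinite.Build _ _ _ torus_step torus_step_fin.

Lemma integrable_bounded_prod (w : measurableTypeR R * Rd R d -> R) (C : R) :
  measurable_fun setT w -> (forall z, `|w z| <= C) ->
  (@circle_prob R \x P)%E.-integrable setT (EFin \o w).
Proof.
move=> mw wC; apply: measurable_bounded_integrable => //.
  exact: circle_prob_prod_lty.
exists C; split; first by rewrite num_real.
by move=> M CM z _; apply: le_trans (wC z) (ltW CM).
Qed.

Lemma Rintegral_prod_mul (u : R -> R) (v : Rd R d -> R) (C D : R) :
  measurable_fun [set: measurableTypeR R] (u : measurableTypeR R -> R) ->
  measurable_fun setT v -> (forall x, `|u x| <= C) -> (forall t, `|v t| <= D) ->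
  \int[(@circle_prob R \x P)%E]_z (u z.1 * v z.2) =
  \int[@circle_prob R]_x u x * \int[P]_t v t.
Proof.
move=> mu_ mv uC vD.
have iw : (@circle_prob R \x P)%E.-integrable setT
    (EFin \o (fun z : measurableTypeR R * Rd R d => u z.1 * v z.2)).
  apply: (@integrable_bounded_prod _ (C * D)).
    apply: measurable_funM.
    - exact: (measurableT_comp mu_ measurable_fst).
    - exact: (measurableT_comp mv measurable_snd).
  by move=> z; rewrite normrM ler_pM.
have iv : P.-integrable setT (EFin \o v).
  apply: measurable_bounded_integrable => //; first by rewrite -ge0_fin_numE// fin_num_measure.
  by exists D; split; [by rewrite num_real|move=> M DM z _; apply: le_trans (vD z) (ltW DM)].
have iu : (@circle_prob R).-integrable setT (EFin \o u).
  apply: measurable_bounded_integrable => //; first by rewrite -ge0_fin_numE// fin_num_measure.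
  by exists C; split; [by rewrite num_real|move=> M CM z _; apply: le_trans (uC z) (ltW CM)].
rewrite /Rintegral; have := @integral12_prod_meas1 _ _ _ _ R (@circle_prob R) P _ iw.
rewrite /comp => <-; rewrite /fubini_F /=.
have Jfin : (\int[P]_t (v t)%:E = (\int[P]_t v t)%:E)%E.
  by rewrite /Rintegral fineK//; exact: (integrable_fin_num measurableT iv).
transitivity (fine (\int[@circle_prob R]_x ((u x)%:E * (\int[P]_t v t)%:E))%E).
  congr fine; apply: eq_integral => x _.
  rewrite -Jfin -(integralZl measurableT iv); apply: eq_integral => t _.
  by rewrite EFinM.
by rewrite integralZr//= fineM// (integrable_fin_num measurableT iu).
Qed.

Lemma cint_torus_step (a : R -> R[i]) (b : Rd R d -> R[i]) (h : Rd R d.+1 -> R[i]) :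
  cmeas (a : measurableTypeR R -> R[i]) -> cmeas b -> cmeas h ->
  (forall x, normcR (a x) <= 1) -> (forall t, normcR (b t) <= 1) ->
  (forall x t, h (cons_point (x, t)) = a x * b t) ->
  cint torus_step h = cint (@circle_prob R) a * cint P b.
Proof.
move=> [ma1 ma2] [mb1 mb2] mh a1 b1 hab.
have bd (z : R[i]) : normcR z <= 1 -> `|ReC z| <= 1 /\ `|ImC z| <= 1.
  by move=> z1; split; apply: le_trans z1; [exact: le_Re_normc|exact: le_Im_normc].
have aR x := (bd _ (a1 x)).1; have aI x := (bd _ (a1 x)).2.
have bR x := (bd _ (b1 x)).1; have bI x := (bd _ (b1 x)).2.
have push (p : Rd R d.+1 -> R) : measurable_fun setT p ->
    (forall z, `|p (cons_point z)| <= 2) ->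
    \int[torus_step]_t p t = \int[(@circle_prob R \x P)%E]_z p (cons_point z).
  move=> mp p2; rewrite /Rintegral; congr fine.
  have := @integral_pushforward _ _ _ _ R (@cons_point R d) (@measurable_cons_point R d)
    (@circle_prob R \x P)%E setT (EFin \o p).
  rewrite preimage_setT => -> //; first exact/measurable_EFinP.
  apply: (@integrable_bounded_prod _ 2) => //.
  exact: (measurableT_comp mp (@measurable_cons_point R d)).
have [mh1 mh2] := mh.
have ip (u : R -> R) (v : Rd R d -> R) :
   measurable_fun [set: measurableTypeR R] (u : measurableTypeR R -> R) ->
   measurable_fun setT v -> (forall x, `|u x| <= 1) -> (forall x, `|v x| <= 1) ->
   (@circle_prob R \x P)%E.-integrable setT
     (EFin \o (fun z : measurableTypeR R * Rd R d => u z.1 * v z.2)).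
  move=> mu_ mv u1 v1; apply: (@integrable_bounded_prod _ 1).
    apply: measurable_funM.
    - exact: (measurableT_comp mu_ measurable_fst).
    - exact: (measurableT_comp mv measurable_snd).
  by move=> z; rewrite normrM -[leRHS]mulr1 ler_pM.
apply: complexP; rewrite ?(ReM, ImM) /=.
- rewrite push//; last first.
    move=> [x t]; rewrite hab ReM (le_trans (ler_normB _ _))// (_ : 2 = 1 + 1)//.
    by apply: lerD; rewrite normrM -[leRHS]mulr1 ler_pM.
  transitivity (\int[(@circle_prob R \x P)%E]_z
     (ReC (a z.1) * ReC (b z.2) - ImC (a z.1) * ImC (b z.2))).
    by apply: eq_Rintegral => -[x t] _; rewrite hab ReM.
  rewrite RintegralB//;
    [|exact: (ip (fun x => ReC (a x)) (fun t => ReC (b t)))|exact: (ip (fun x => ImC (a x)) (fun t => ImC (b t)))].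
  by rewrite (@Rintegral_prod_mul (fun x => ReC (a x)) (fun t => ReC (b t)) 1 1)//
    (@Rintegral_prod_mul (fun x => ImC (a x)) (fun t => ImC (b t)) 1 1).
- rewrite push//; last first.
    move=> [x t]; rewrite hab ImM (le_trans (ler_normD _ _))// (_ : 2 = 1 + 1)//.
    by apply: lerD; rewrite normrM -[leRHS]mulr1 ler_pM.
  transitivity (\int[(@circle_prob R \x P)%E]_z
     (ReC (a z.1) * ImC (b z.2) + ImC (a z.1) * ReC (b z.2))).
    by apply: eq_Rintegral => -[x t] _; rewrite hab ImM.
  rewrite RintegralD//;
    [|exact: (ip (fun x => ReC (a x)) (fun t => ImC (b t)))|exact: (ip (fun x => ImC (a x)) (fun t => ReC (b t)))].
  by rewrite (@Rintegral_prod_mul (fun x => ReC (a x)) (fun t => ImC (b t)) 1 1)//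
    (@Rintegral_prod_mul (fun x => ImC (a x)) (fun t => ReC (b t)) 1 1).
Qed.

End torus_step.

Section torus.
Context (R : realType).

Definition torus_char d (k : d.-tuple int) (t : Rd R d) : R[i] :=
  \prod_(j < d) circle_char (tnth k j) (tnth t j).

Lemma torus_charD d (k l : d.-tuple int) t :
  torus_char (addk k l) t = torus_char k t * torus_char l t.
Proof.
by rewrite -big_split /=; apply: eq_bigr => j _; rewrite tnth_mktuple circle_charD.
Qed.

Lemma torus_char0 d t : torus_char (zerok d) t = 1.
Proof. by rewrite /torus_char big1// => j _; rewrite tnth_mktuple circle_char0. Qed.

Lemma torus_charN d (k : d.-tuple int) t : torus_char (oppk k) t = conjc (torus_char k t).
Proof.
rewrite /torus_char; have -> : conjc (\prod_(j < d) circle_char (tnth k j) (tnth t j)) =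
  \prod_(j < d) conjc (circle_char (tnth k j) (tnth t j)) by exact: rmorph_prod.
by apply: eq_bigr => j _; rewrite tnth_mktuple circle_charN.
Qed.

Lemma normc_torus_char d (k : d.-tuple int) t : normcR (torus_char k t) = 1.
Proof.
rewrite /torus_char; apply: (big_ind (fun z : R[i] => normcR z = 1)).
- exact: Normc.normc1.
- by move=> z w z1 w1; rewrite normcRM z1 w1 mulr1.
- by move=> j _; exact: normc_circle_char.
Qed.

Lemma cmeas_torus_char d (k : d.-tuple int) : cmeas (torus_char k).
Proof.
apply: cmeas_prod => j; have [m1 m2] := cmeas_circle_char R (tnth k j).
split; [exact: (measurableT_comp m1 (measurable_tnth j))|exact: (measurableT_comp m2 (measurable_tnth j))].
Qed.

Definition open_cube d := [set t : Rd R d | forall j, -1 < (tnth t j : R) < 1].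

(** Orthogonality of the characters and concentration on the open cube are the two properties
    retained of the torus measure. On the open cube each coordinate is determined by its cosine and
    sine, so functions of the characters separate points. *)
Lemma torus_exists d : exists P : {finite_measure set (Rd R d) -> \bar R},
  (forall k, cint P (torus_char k) = (k == zerok d)%:R) /\ {ae P, forall t, open_cube t}.
Proof.
elim: d => [|d [P [Pk Pcube]]].
  exists (\d_([tuple] : Rd R 0)); split; last by apply: aeW => t -[].
  move=> k; rewrite (_ : torus_char k = fun=> 1); last first.
    by apply/funext => t; rewrite /torus_char big_ord0.
  have -> : k == zerok 0 by apply/eqP; rewrite [k]tuple0 [zerok 0]tuple0.
  apply: complexP; rewrite /= Rintegral_cst// ?mul0r// mul1r.
  by rewrite [X in fine X](_ : _ = 1%E)//; exact: diracT.
exists (torus_step P); split.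
  move=> k; rewrite (@cint_torus_step _ _ _ (circle_char (thead k))
     (torus_char ([tuple of behead k] : d.-tuple int))).
  - rewrite cint_circle_char Pk -natrM mulnb; congr (_%:R).
    congr nat_of_bool; apply/andP/eqP => [[/eqP k0 /eqP kb]|->].
      apply: eq_from_tnth => j; rewrite [k]tuple_eta tnth_mktuple.
      case: (unliftP ord0 j) => [i ->|->]; last by rewrite tnth0.
      by rewrite tnthS; have := congr1 (fun q : d.-tuple int => tnth q i) kb; rewrite tnth_mktuple.
    split; first by rewrite /thead tnth_mktuple.
    by apply/eqP; apply: eq_from_tnth => j; rewrite tnth_behead !tnth_mktuple.
  - exact: cmeas_circle_char.
  - exact: cmeas_torus_char.
  - exact: cmeas_torus_char.
  - by move=> x; rewrite normc_circle_char.
  - by move=> t; rewrite normc_torus_char.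
  - move=> x t; rewrite /torus_char big_ord_recl; congr (_ * _).
    by apply: eq_bigr => j _; rewrite [in LHS](tuple_eta k) !tnthS.
have [N [mN PN cN]] := Pcube.
pose I : set (measurableTypeR R) := `]-1, 1[%classic.
pose A := [set t : Rd R d.+1 | (~ I (thead t)) \/ N [tuple of behead t]].
have mA1 : measurable [set t : Rd R d.+1 | ~ I (thead t)].
  have mI : measurable (~` I) by apply: measurableC; exact: measurable_itv.
  have H := @measurable_tnth _ (measurableTypeR R) d.+1 ord0 measurableT _ mI.
  by rewrite setTI in H; exact: H.
have mA2 : measurable [set t : Rd R d.+1 | N [tuple of behead t]].
  have : measurable_fun setT (fun x : Rd R d.+1 => [tuple of behead x] : Rd R d).
    exact: measurable_behead.
  by move=> /(_ measurableT _ mN); rewrite setTI.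
exists A; split.
- exact: measurableU.
- apply/eqP; rewrite eq_le measure_ge0 andbT.
  apply: le_trans (measureU2 _ mA1 mA2) _.
  rewrite [X in (X + _)%E](_ : _ = 0%E) ?add0e.
    rewrite le_eqVlt; apply/orP; left; apply/eqP.
    rewrite /= /torus_step /pushforward.
    rewrite (_ : _ @^-1` _ = setT `*` N); last first.
      have bhK x (t : Rd R d) : [tuple of behead (cons_point (x, t))] = t :> d.-tuple _.
        exact/val_inj.
      by apply/seteqP; split=> -[x t] /=; rewrite bhK//; case.
    by rewrite product_measure1E// [X in (_ * X)%E](_ : _ = 0%E) ?mule0//; exact: PN.
  rewrite /= /torus_step /pushforward.
  rewrite (_ : _ @^-1` _ = (~` I) `*` setT); last first.
    by apply/seteqP; split => -[x t] /=; rewrite theadE; [move=> H; split|case].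
  rewrite product_measure1E//; last by apply: measurableC; exact: measurable_itv.
  by rewrite [X in (X * _)%E](circle_prob_itv R) mul0e.
- move=> t /= nc; rewrite /A /=; apply: contrapT => /not_orP[/contrapT It nN]; apply: nc.
  have ct : open_cube [tuple of behead t] by apply: contrapT => /cN.
  move=> j; case: (unliftP ord0 j) => [i ->|->].
    by have := ct i; rewrite tnth_behead (_ : inord _ = lift ord0 i)//; apply/val_inj; rewrite /= inordK// ltnS ltn_ord.
  by move: It; rewrite /I /= in_itv.
Qed.

End torus.

(** * Half-spaces recovered from the characters *)

Section torus_uniqueness.
Context (R : realType) (d : nat) (P : {finite_measure set (Rd R d) -> \bar R}).
Hypothesis Pcube : {ae P, forall t, open_cube t}.
Local Notation tc := (@torus_char R d).
Local Notation multiplier := (multiplier P tc).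
Local Notation coef_set := (coef_set P tc).
Let mtc := @cmeas_torus_char R d.
Let ntc := @normc_torus_char R d.

Let csC := @coef_setC _ _ _ P _ tc mtc ntc.
Let cs0 := @coef_set0 _ _ _ P _ tc mtc ntc.
Let csae := @coef_set_ae _ _ _ P _ tc mtc ntc.

Lemma multiplier_torus_char l : multiplier (tc l).
Proof.
split; [exact: cmeas_torus_char|by exists 1 => x; rewrite normc_torus_char|].
move=> h [ih ch]; split.
  under eq_fun do rewrite mulrC.
  by apply: (@cintegrableMb _ _ _ _ _ _ 1) => // x; rewrite normc_torus_char.
move=> k; rewrite -[RHS](ch (addk l k)); apply: cint_eq => t.
by rewrite torus_charD mulrA.
Qed.

Definition unit_freq (j : 'I_d) : d.-tuple int := [tuple ((i == j)%:R : int) | i < d].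

Lemma torus_char_unit j t : tc (unit_freq j) t = circle_char 1 (tnth t j).
Proof.
rewrite /torus_char (bigD1 j)//= tnth_mktuple eqxx big1 ?mulr1//.
by move=> i /negbTE ij; rewrite tnth_mktuple ij circle_char0.
Qed.

(** The affine change brings the cosine into [0, 1], as the sublevel criterion requires. The signs a
    = 1 and a = -1 give sublevel and superlevel sets respectively. *)
Lemma multiplier_affine_cos j (a : R) : multiplier (fun t => (((1 + a * cos (pi * tnth t j)) / 2)%:C)%C).
Proof.
rewrite (_ : (fun t => _) = (fun t => (2^-1)%:C%C + (a / 4)%:C%C * (tc (unit_freq j) t +
  tc (oppk (unit_freq j)) t))).
  apply: multiplierD => //; first exact: multiplier_cst.
  apply: multiplierM => //; first exact: multiplier_cst.
  by apply: multiplierD => //; exact: multiplier_torus_char.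
apply/funext => t; rewrite torus_charN torus_char_unit.
by apply: complexP; rewrite !ReImE /= mul1r; field.
Qed.

Lemma multiplier_affine_sin j (a : R) : multiplier (fun t => (((1 + a * sin (pi * tnth t j)) / 2)%:C)%C).
Proof.
rewrite (_ : (fun t => _) = (fun t => (2^-1)%:C%C + (Complex 0 (- (a / 4))) * (tc (unit_freq j) t +
  (-1) * tc (oppk (unit_freq j)) t))).
  apply: multiplierD => //; first exact: multiplier_cst.
  apply: multiplierM => //; first exact: multiplier_cst.
  apply: multiplierD => //; first exact: multiplier_torus_char.
  by apply: multiplierM => //; [exact: multiplier_cst|exact: multiplier_torus_char].
apply/funext => t; rewrite torus_charN torus_char_unit.
apply: complexP; rewrite !ReImE /= mul1r; change (Algebra.hasZero.zero _) with (0 : R); by field.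
Qed.

Lemma affine01 (a u : R) : `|a| = 1 -> `|u| <= 1 -> 0 <= (1 + a * u) / 2 <= 1.
Proof.
move=> a1 u1; have : `|a * u| <= 1 by rewrite normrM a1 mul1r.
by rewrite ler_norml => /andP[h1 h2]; apply/andP; split; lra.
Qed.

Lemma coef_set_cos_lt j (c : R) : -1 < c -> c < 1 -> coef_set [set t | cos (pi * tnth t j) < c].
Proof.
move=> c0 c1.
rewrite (_ : [set t | _] = [set t | (1 + 1 * cos (pi * tnth t j)) / 2 < (1 + c) / 2]); last first.
  by apply/seteqP; split => t /=; lra.
apply: coef_set_sublevel => //; [|exact: multiplier_affine_cos|lra|lra].
by move=> t; apply: affine01; rewrite ?normr1// cos_max.
Qed.

Lemma coef_set_cos_gt j (c : R) : -1 < c -> c < 1 -> coef_set [set t | c < cos (pi * tnth t j)].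
Proof.
move=> c0 c1.
rewrite (_ : [set t | _] = [set t | (1 + (-1) * cos (pi * tnth t j)) / 2 < (1 - c) / 2]); last first.
  by apply/seteqP; split => t /=; lra.
apply: coef_set_sublevel => //; [|exact: multiplier_affine_cos|lra|lra].
by move=> t; apply: affine01; rewrite ?normrN1// cos_max.
Qed.

Lemma coef_set_sin_lt0 j : coef_set [set t | sin (pi * tnth t j) < 0].
Proof.
rewrite (_ : [set t | _] = [set t | (1 + 1 * sin (pi * tnth t j)) / 2 < 2^-1]); last first.
  by apply/seteqP; split => t /=; lra.
apply: coef_set_sublevel => //; [|exact: multiplier_affine_sin|lra].
by move=> t; apply: affine01; rewrite ?normr1// sin_max.
Qed.

Lemma measurable_half j (x : R) : measurable [set t : Rd R d | (tnth t j : R) < x].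
Proof.
have := @measurable_tnth _ (measurableTypeR R) d j measurableT `]-oo, x[%classic
  (measurable_itv _); rewrite setTI.
by congr (measurable _); apply/seteqP; split => t; rewrite /= in_itv.
Qed.

Lemma sin_lt0_half (x : R) : -1 < x < 1 -> (sin (pi * x) < 0) = (x < 0).
Proof.
move=> /andP[x0 x1]; have pi0 := pi_gt0 R.
case: (ltP x 0) => x00.
  rewrite -[pi * x]opprK sinN oppr_lt0; apply: sin_gt0_pi; apply/andP; split; nra.
by apply/negbTE; rewrite -leNgt; apply: sin_ge0_pi; apply/andP; split; nra.
Qed.

(** The sign of the sine tells on which side of 0 the coordinate lies, and on each side the cosine
    is strictly monotone. *)
Lemma coef_set_half j (x : R) : coef_set [set t | (tnth t j : R) < x].
Proof.
have pi0 := pi_gt0 R.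
have [xl|xl] := leP x (-1).
  apply: (@csae set0); first exact: measurable_half.
    apply: filterS Pcube => t /(_ j)/andP[tj _]; split => //=.
    by rewrite ltNge (le_trans xl (ltW tj)).
  exact: cs0.
have [xr|xr] := leP 1 x.
  apply: (@csae setT); first exact: measurable_half.
    apply: filterS Pcube => t /(_ j)/andP[_ tj]; split => //= _.
    exact: lt_le_trans xr.
  by rewrite -setC0; apply: csC; exact: cs0.
(* The point 0 is treated apart since the level cos(pi x) would be 1 there, outside the open range
   of admissible levels. *)
have [->|x0] := eqVneq x 0.
  apply: csae (coef_set_sin_lt0 j); first exact: measurable_half.
  by apply: filterS Pcube => t /(_ j) tj /=; rewrite sin_lt0_half.
have pi_itv (y : R) : 0 <= y <= 1 -> pi * y \in `[0, pi].
  by move=> /andP[y0 y1]; rewrite in_itv /=; apply/andP; split; nra.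
have lt_cos (y z : R) : 0 <= y <= 1 -> 0 <= z <= 1 -> (cos (pi * y) < cos (pi * z)) = (z < y).
  by move=> y01 z01; rewrite ltr_cos ?pi_itv// ltr_pM2l.
have cb : -1 < cos (pi * x) < 1.
  have -> : cos (pi * x) = cos (pi * `|x|) by rewrite -[in RHS](gtr0_norm pi0) -normrM cos_norm.
  have n0 : 0 < `|x| by rewrite normr_gt0.
  have n1 : `|x| < 1 by rewrite ltr_norml xl.
  have x01 : 0 <= `|x| <= 1 by rewrite !ltW.
  apply/andP; split.
    have <- : cos (pi * 1) = -1 :> R by rewrite mulr1 cospi.
    by rewrite lt_cos// lexx ler01.
  have E : cos (pi * 0) = 1 :> R by rewrite mulr0 cos0.
  by rewrite -[ltRHS]E lt_cos// lexx ler01.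
have /andP[cb0 cb1] := cb.
(* For x < 0 the half-space is an intersection: y < 0 and cos(pi y) < cos(pi x), the cosine being
   increasing on the negative side. *)
case: (ltP x 0) => x00.
  apply: csae (coef_setI (coef_set_sin_lt0 j) (coef_set_cos_lt j cb0 cb1)).
    exact: measurable_half.
  apply: filterS Pcube => t /(_ j) /[dup] tj /andP[t0 t1] /=; rewrite sin_lt0_half//.
  move: (tnth t j : R) t0 t1 {tj} => y y0 y1.
  have E : y < 0 -> (cos (pi * y) < cos (pi * x)) = (y < x).
    have En z : cos (pi * z) = cos (pi * - z) :> R by rewrite mulrN cosN.
    move=> yn; rewrite (En y) (En x) lt_cos; first by rewrite ltrN2.
      by apply/andP; split; lra.
    by apply/andP; split; lra.
  split; first by move=> [yn]; rewrite E.
  by move=> yx; have yn := lt_trans yx x00; split => //; rewrite E.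
(* For x > 0 it is a union: y < 0 or cos(pi x) < cos(pi y). The union appears as the complement of
   an intersection of complements. *)
have C1 : coef_set (~` ([set t | ~ (sin (pi * tnth t j) < 0)] `&`
    [set t | ~ (cos (pi * x) < cos (pi * tnth t j))])).
  apply: csC; apply: coef_setI; apply: csC; first exact: coef_set_sin_lt0.
  exact: coef_set_cos_gt.
apply: csae C1; first exact: measurable_half.
apply: filterS Pcube => t /(_ j) /[dup] tj /andP[t0 t1] /=; rewrite sin_lt0_half//.
move: (tnth t j : R) t0 t1 {tj} => y y0 y1.
have E : 0 <= y -> (cos (pi * x) < cos (pi * y)) = (y < x).
  by move=> yp; rewrite lt_cos//; apply/andP; split; lra.
split.
  move=> H; rewrite ltNge; apply/negP => xy; apply: H.
  have y00 : 0 <= y := le_trans x00 xy.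
  by split; [apply/negP; rewrite -leNgt|rewrite E//; apply/negP; rewrite -leNgt].
move=> yx [/negP]; rewrite -leNgt => y00; rewrite E//.
Qed.

(** The product sigma-algebra is generated by coordinate preimages of Borel sets, and the Borel sets
    by open left half-lines, so half-spaces suffice. *)
Lemma coef_set_measurable A : measurable A -> coef_set A.
Proof.
apply: smallest_sub; first exact: (sigma_algebra_coef_set P mtc ntc).
rewrite -bigcup_seq => B [j _ [Y mY <-]]; rewrite setTI.
move: Y mY; rewrite -[X in forall Y, X Y -> _]/((@ocitv R).-sigma.-measurable).
rewrite RGenInftyO.measurableE; apply: smallest_sub.
  split.
  - by rewrite /= preimage_set0.
  - by move=> Y cY; rewrite /= setTD preimage_setC; exact: csC.
  - by move=> F cF; rewrite /= preimage_bigcup; exact: coef_set_bigcup.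
move=> Y [x ->] /=.
exact: coef_set_half j x.
Qed.

Lemma torus_uniqueness h : cintegrable P h ->
  (forall k, cint P (fun t => h t * tc k t) = 0) -> {ae P, forall t, h t = 0}.
Proof.
move=> ih ch; apply: (@null_coefs_eq0 _ _ _ P _ tc h) => //.
- by exists (zerok d) => t; exact: torus_char0.
- exact: coef_set_measurable.
Qed.

End torus_uniqueness.

(** * Brackets *)

Section fejer.
Context (R : realType) (d : nat).

Lemma sum_support_le (T : eqType) (s1 s2 : seq T) (g : T -> R) : uniq s1 -> uniq s2 ->
  (forall k, 0 <= g k) -> (forall k, g k != 0 -> k \in s2) ->
  \sum_(k <- s1) g k <= \sum_(k <- s2) g k.
Proof.
move=> u1 u2 g0 gs.
rewrite [leRHS](bigID (mem s1)) /= -[leLHS]addr0; apply: lerD; last exact: sumr_ge0.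
rewrite [leLHS](bigID (mem s2)) /= [X in _ + X]big1 ?addr0; last first.
  by move=> k; apply: contraNeq => /gs.
rewrite -[leLHS]big_filter -[leRHS]big_filter le_eqVlt; apply/orP; left; apply/eqP; apply: perm_big.
by apply: uniq_perm; rewrite ?filter_uniq// => k; rewrite !mem_filter andbC.
Qed.

Lemma sum_support_eq (T : eqType) (V : zmodType) (s1 s2 : seq T) (g : T -> V) :
  uniq s1 -> uniq s2 ->
  (forall k, g k != 0 -> k \in s1) -> (forall k, g k != 0 -> k \in s2) ->
  \sum_(k <- s1) g k = \sum_(k <- s2) g k.
Proof.
move=> u1 u2 g1 g2.
have E (s : seq T) : \sum_(k <- s) g k = \sum_(k <- [seq x <- s | g x != 0]) g k.
  rewrite big_filter [LHS](bigID (fun k => g k != 0)) /= [X in _ + X]big1 ?addr0//.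
  by move=> k /negPn/eqP.
rewrite E [RHS]E; apply: perm_big; apply: uniq_perm; rewrite ?filter_uniq// => k.
by rewrite !mem_filter; case: (boolP (g k != 0)) => //= gk; rewrite g1// g2.
Qed.

Definition box_point n (a : {ffun 'I_d -> 'I_n}) : d.-tuple int :=
  [tuple (a i : nat)%:Z | i < d].

Definition diffs n (p : d.-tuple int) :=
  [seq addk (box_point a) (oppk p) | a : {ffun 'I_d -> 'I_n}].

Lemma diffs_uniq n p : uniq (diffs n p).
Proof.
rewrite map_inj_uniq ?enum_uniq// => a b /(congr1 (fun k => addk k p)).
rewrite -!addkA addNk !(addkC _ (zerok d)) !add0k => ab; apply/ffunP => i; apply/val_inj.
have := congr1 (fun k => tnth k i) ab; rewrite !tnth_mktuple => -[]; exact.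
Qed.

Lemma mem_diffs n p k : (forall i, (0 <= tnth k i + tnth p i < n%:Z)%R) -> k \in diffs n p.
Proof.
move=> H.
have H' i : {j : 'I_n | (j : nat)%:Z = tnth k i + tnth p i}.
  have /andP[h0 h1] := H i.
  have lt : (`|(tnth k i + tnth p i)%R| < n)%N by rewrite -ltz_nat gez0_abs.
  by exists (Ordinal lt); rewrite /= gez0_abs.
apply/mapP; exists [ffun i => sval (H' i)]; first by rewrite mem_enum.
apply: eq_from_tnth => i; rewrite !tnth_mktuple ffunE; case: (H' i) => j /= ->.
by rewrite addrK.
Qed.

Variables (gam : d.-tuple int -> R[i]) (M : nat).
Hypothesis gamM : forall k, gam k != 0 -> forall i, (- (M%:Z) <= tnth k i <= M%:Z)%R.
Hypothesis gam_pd : forall n, 0 <= \sum_(a : {ffun 'I_d -> 'I_n})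
  \sum_(b : {ffun 'I_d -> 'I_n}) gam (addk (box_point b) (oppk (box_point a))).

(** A box of side 2 M + 1 shifted by M, that is, the frequencies in [-M, M]^d, which contain the
    support of [gam]. *)
Definition freq_box : seq (d.-tuple int) := diffs (M.*2.+1) [tuple M%:Z | i < d].

Lemma freq_box_uniq : uniq freq_box. Proof. exact: diffs_uniq. Qed.

Lemma mem_freq_box k : gam k != 0 -> k \in freq_box.
Proof.
move=> gk; apply: mem_diffs => i; rewrite tnth_mktuple.
have /andP[h0 h1] := gamM gk i.
have H (z : int) : - M%:Z <= z -> z <= M%:Z -> 0 <= z + M%:Z < (M.*2.+1)%:Z.
  by move=> z0 z1; apply/andP; split; lia.
exact: H.
Qed.

(** Coordinates whose window of radius M stays inside [0, n). The row sum at a point with such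
    coordinates sees the whole support of [gam]. *)
Let inner n : pred 'I_n := [pred x : 'I_n | (M <= x)%N && (x < n - M)%N].
Arguments inner : clear implicits.

Let C := \sum_(k <- freq_box) normcR (gam k).
Let S := \sum_(k <- freq_box) gam k.

Let rowsum n (a : {ffun 'I_d -> 'I_n}) :=
  \sum_(b : {ffun 'I_d -> 'I_n}) gam (addk (box_point b) (oppk (box_point a))).

Let rowsumE n a : @rowsum n a = \sum_(k <- diffs n (box_point a)) gam k.
Proof. by rewrite /diffs big_map big_enum. Qed.

Let rowsum_inner n a : a \in ffun_on (inner n) -> @rowsum n a = S.
Proof.
move=> /ffun_onP ai; rewrite rowsumE; apply: sum_support_eq.
- exact: diffs_uniq.
- exact: freq_box_uniq.
- move=> k gk; apply: mem_diffs => i; rewrite tnth_mktuple.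
  have /andP[h0 h1] := gamM gk i; have /andP[i0 i1] := ai i.
  have H (z : int) (m : nat) : (M <= m)%N -> (m < n - M)%N -> - M%:Z <= z -> z <= M%:Z ->
      0 <= z + m%:Z < n%:Z.
    by move=> m0 m1 z0 z1; apply/andP; split; lia.
  exact: H.
- exact: mem_freq_box.
Qed.

Let rowsum_bound n a : normcR (@rowsum n a) <= C.
Proof.
rewrite rowsumE; apply: (@le_trans _ _ (\sum_(k <- diffs n (box_point a)) normcR (gam k))).
  apply: (big_ind2 (fun (x : R[i]) (y : R) => normcR x <= y)).
  - by rewrite Normc.normc0.
  - by move=> x1 x2 y1 y2 h1 h2; apply: le_trans (normcR_triangle _ _) (lerD h1 h2).
  - by [].
apply: sum_support_le.
- exact: diffs_uniq.
- exact: freq_box_uniq.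
- by move=> k; exact: normcR_ge0.
- move=> k nk; apply: mem_freq_box; apply: contra_neq nk => ->; exact: Normc.normc0.
Qed.

Let card_inner L : #|inner (L + M.*2)%N| = L.
Proof.
rewrite -[RHS]card_ord.
have lt (j : 'I_L) : (j + M < L + M.*2)%N.
  by case: j => j /= jL; lia.
pose f (j : 'I_L) := Ordinal (lt j).
have finj : injective f by move=> i j /(congr1 val) /= /addIn ij; exact/val_inj.
rewrite -(fintype.card_image finj); apply: eq_card => x; apply/idP/fintype.imageP => [|[j _ ->]].
  rewrite inE => /andP[h0 h1].
  have xL : (x - M < L)%N by move: h0 h1; case: x => y /= _; lia.
  by exists (Ordinal xL) => //; apply/val_inj; rewrite /= subnK.
by rewrite inE /=; case: j => j /= jL; apply/andP; split; lia.
Qed.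

(** Here q is the double sum over the cube of side L + 2 M, nonnegative by hypothesis. Each of its
    L^d inner rows sums to S, and every other row is bounded by C. *)
Let dist_bound L : exists2 q : R[i], 0 <= q &
  normcR (q - (L ^ d)%:R * S) <= ((L + M.*2) ^ d - L ^ d)%:R * C.
Proof.
set n := (L + M.*2)%N.
exists (\sum_(a : {ffun 'I_d -> 'I_n}) rowsum a); first exact: gam_pd.
have cin : #|ffun_on (inner n) : pred {ffun 'I_d -> 'I_n}| = (L ^ d)%N.
  by rewrite card_ffun_on card_inner card_ord.
rewrite (bigID (mem (ffun_on (inner n)))) /=.
under eq_bigr => a ain do rewrite rowsum_inner//.
rewrite sumr_const cin mulr_natl addrAC subrr add0r.
apply: (@le_trans _ _ (\sum_(a | a \notin ffun_on (inner n)) C)).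
  apply: (big_ind2 (fun (x : R[i]) (y : R) => normcR x <= y)).
  - by rewrite Normc.normc0.
  - by move=> x1 x2 y1 y2 h1 h2; apply: le_trans (normcR_triangle _ _) (lerD h1 h2).
  - by move=> a _; exact: rowsum_bound.
rewrite sumr_const -[leLHS]mulr_natl le_eqVlt; apply/orP; left; apply/eqP.
congr (_%:R * _); apply/esym/eqP; rewrite -(eqn_add2l (L ^ d)%N); apply/eqP.
have Ln : (L ^ d <= n ^ d)%N.
  by rewrite /n; elim: (d) => // e IH; rewrite !expnS leq_mul ?leq_addr.
rewrite subnKC//; transitivity #|{ffun 'I_d -> 'I_n}|; first by rewrite card_ffun !card_ord.
by rewrite -(cardC (ffun_on (inner n))) -cin; congr (_ + _)%N; apply: eq_card => a.
Qed.

(** After division by L^d, the sum S lies within [r j * C] of a nonnegative real number, where [r j]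
    is the ratio of the boundary of the cube to its inner part and tends to 0. *)
Lemma fejer_ge0 : 0 <= S.
Proof.
have C0 : 0 <= C by apply: sumr_ge0 => k _; exact: normcR_ge0.
pose r (j : nat) : R := (1 + 2 * M%:R / j.+1%:R) ^+ d - 1.
have rc : (fun j => r j * C) @ \oo --> 0.
  rewrite -[X in _ --> X](mul0r C); apply: cvgM; last exact: cvg_cst.
  rewrite /r -[X in _ --> X](subrr 1) -[X in _ --> X - _](expr1n _ d).
  apply: cvgB; last exact: cvg_cst.
  have H : (fun j : nat => 1 + 2 * M%:R / j.+1%:R : R) @ \oo --> (1 : R).
    rewrite -[X in _ --> X]addr0 -[X in _ --> _ + X](mulr0 (2 * M%:R)).
    by apply: cvgD; [exact: cvg_cst|apply: cvgM; [exact: cvg_cst|exact: cvg_harmonic]].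
  by apply: (cvg_comp _ (fun x : R => x ^+ d) H); exact: exprn_continuous.
have key j : exists2 q : R, 0 <= q & normcR ((q%:C)%C - S) <= r j * C.
  have [q q0] := dist_bound j.+1; set L := (j.+1 ^ d)%N.
  have L0 : 0 < L%:R :> R by rewrite ltr0n expn_gt0.
  have qE : q = ((ReC q)%:C)%C by apply: complexP => //=; move: q0; rewrite lecE => /andP[/eqP].
  move=> H; exists (ReC q / L%:R).
    by rewrite divr_ge0//; move: q0; rewrite lecE => /andP[].
  have E : ((ReC q / L%:R)%:C)%C - S = ((L%:R^-1)%:C)%C * (q - L%:R * S).
    rewrite mulrBr mulrA {2}qE -rmorphM /= [_^-1 * _]mulrC.
    have -> : ((L%:R^-1)%:C)%C * L%:R = 1 :> R[i].
      have -> : L%:R = ((L%:R)%:C)%C :> R[i] by rewrite rmorph_nat.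
      by rewrite -rmorphM /= mulVf ?gt_eqF// rmorph1.
    by rewrite mul1r.
  rewrite E normcRM normcR_real gtr0_norm ?invr_gt0//.
  rewrite -(ler_pM2l L0) mulrA divff ?gt_eqF// mul1r (le_trans H)// mulrA ler_wpM2r//.
  rewrite natrB; last by rewrite /L; elim: (d) => // e IH; rewrite !expnS leq_mul ?leq_addr.
  rewrite /r mulrBr mulr1 /L !natrX -exprMn lerD2r.
  rewrite (_ : (_ + _)%:R = j.+1%:R * (1 + 2 * M%:R / j.+1%:R))//.
  by rewrite natrD -mul2n natrM; field.
have ReS : 0 <= ReC S.
  rewrite -oppr_le0; apply: (cvgr_to_ge rc); apply: nearW => j.
  have [q q0 H] := key j; apply: le_trans H.
  apply: le_trans (Re_normcR_le _); rewrite !ReImE; lra.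
have ImS : ImC S = 0.
  apply/eqP; rewrite -normr_le0; apply: (cvgr_to_ge rc); apply: nearW => j.
  have [q q0 H] := key j; apply: le_trans H.
  by apply: le_trans (le_Im_normc _); rewrite !ReImE sub0r normrN.
by rewrite lecE /= ImS eqxx ReS.
Qed.

End fejer.

(** * Positive brackets for bounded support, and their L^1 stability *)

Section bracket_existence.
Context (R : realType) (d : nat) (P : {finite_measure set (Rd R d) -> \bar R}).
Local Notation mu := (lebesgueX R d).
Local Notation fct := (Rd R d -> R[i]).
Local Notation "<< f , g >>" := (L2dot f g).
Local Notation tc := (@torus_char R d).
Hypothesis Pk : forall k, cint P (tc k) = (k == zerok d)%:R.
Hypothesis Pu : forall h, cintegrable P h ->
  (forall k, cint P (fun t => h t * tc k t) = 0) -> {ae P, forall t, h t = 0}.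
Implicit Types (f g h : fct) (b : Rd R d -> R).

Lemma cintegrable_torus_char k : cintegrable P (tc k).
Proof.
apply: (@cintegrable_dominated _ _ _ _ _ (fun=> 1)).
- exact: cmeas_torus_char.
- exact: finite_measure_integrable_cst.
- by move=> t; rewrite normc_torus_char.
Qed.

Lemma cintegrable_mul_char h k : cintegrable P h -> cintegrable P (fun t => h t * tc k t).
Proof.
move=> ih; under eq_fun do rewrite mulrC.
apply: (@cintegrableMb _ _ _ _ _ _ 1) => //; first exact: cmeas_torus_char.
by move=> x; rewrite normc_torus_char.
Qed.

(* For f of bounded support only finitely many <T_k f, f> are nonzero, and their
   trigonometric sum is nonnegative by Fejer averaging. *)
Definition pos_bracket f b := [/\ P.-integrable setT (EFin \o b), forall t, 0 <= b t &
  forall k, cint P (fun t => ((b t)%:C)%C * tc k t) = << translate k f, f >>].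

Definition bounded_support f := exists N : nat, forall x : Rd R d,
  (exists i, N%:R < `|tnth x i : R|) -> f x = 0.

Lemma L2dot_disjoint f g : (forall x, f x * conjc (g x) = 0) -> << f, g >> = 0.
Proof. by move=> /funext fg; rewrite L2dotE fg cint0. Qed.

Lemma pos_bracket_bounded f : L2 f -> bounded_support f -> exists b, pos_bracket f b.
Proof.
(* If some |k_i| > 2 N, then f, supported in the cube of radius N, and its translate by k have
   disjoint supports. *)
move=> f2 [N fN]; pose M := N.*2.
(* The sign makes the integral of (sum_k c_k e_k) * e_l equal to c_(-l), which is the coefficient
   required at l. *)
pose c k := << translate (oppk k) f, f >>.
have cM k : c k != 0 -> forall i, (- (M%:Z) <= tnth k i <= M%:Z)%R.
  move=> /eqP ck i; rewrite -ler_norml leNgt; apply/negP => ki; apply: ck.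
  apply: L2dot_disjoint => x; have [xi|xi] := ltP N%:R `|tnth x i : R|.
    by rewrite [f x]fN ?conjc0 ?mulr0//; exists i.
  rewrite translateE fN ?mul0r//; exists i; rewrite !tnth_mktuple rmorphN /= opprK.
  have ki' : M%:R < `|(tnth k i)%:~R : R|.
    by rewrite -intr_norm -[M%:R]/((M%:Z)%:~R) ltr_int.
  have := ler_normB ((tnth x i : R) + (tnth k i)%:~R) (tnth x i : R).
  rewrite addrAC subrr add0r; move: ki' xi; rewrite /M -addnn natrD.
  move: (`|_ : R|) (`|_ : R|) (`|_ : R|) => u v w *; lra.
pose gam t k := c k * tc k t.
have gamM t k : gam t k != 0 -> forall i, (- (M%:Z) <= tnth k i <= M%:Z)%R.
  by move=> gk; apply: cM; apply: contra_neq gk => ck; rewrite /gam ck mul0r.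
pose K := @freq_box d M.
pose S t := \sum_(k <- K) gam t k.
have S0 t : 0 <= S t.
  apply: fejer_ge0; first exact: gamM.
  (* The double sum of Fejer averaging is the squared norm of this combination of translates, with
     conjugate characters at t as coefficients. *)
  move=> n; pose g := \sum_(a : {ffun 'I_d -> 'I_n})
    cscale (conjc (tc (box_point a) t)) (translate (box_point a) f).
  have T2 (a : {ffun 'I_d -> 'I_n}) : L2 (translate (box_point a) f) by exact: L2_translate.
  have g2 : L2 g by apply: L2_sum => a; exact: L2_scale.
  rewrite (_ : \sum_a _ = << g, g >>); first by rewrite L2dot_self lecE /= eqxx sqr_ge0.
  rewrite {1}/g L2dot_suml//; last by move=> a; exact: L2_scale.
  apply: eq_bigr => a _; rewrite /g L2dot_sumr; [|by move=> b'; exact: L2_scale|exact: L2_scale].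
  apply: eq_bigr => b' _; rewrite L2dotZl//; last exact: L2_scale.
  rewrite L2dotZr// conjcK /gam torus_charD torus_charN mulrA mulrC; congr (_ * _).
  rewrite mulrC; congr (_ * _).
  rewrite [RHS](_ : _ = << translate (oppk (box_point b')) (translate (box_point a) f), f >>).
    rewrite translate_translate; congr (<< translate _ f, f >>).
    by apply: eq_from_tnth => i; rewrite !tnth_mktuple opprD opprK.
  by rewrite [RHS]L2dot_translateK// oppkK.
have icS k : cintegrable P (fun t => gam t k).
  by apply: cintegrableZ; exact: cintegrable_torus_char.
have iS : cintegrable P S by exact: cintegrable_sum.
exists (fun t => ReC (S t)); split.
- by case: iS.
- by move=> t; have := S0 t; rewrite lecE => /andP[].
move=> l; have -> : cint P (fun t => ((ReC (S t))%:C)%C * tc l t) =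
    cint P (fun t => \sum_(k <- K) c k * tc (addk k l) t).
  apply: cint_eq => t.
  have -> : ((ReC (S t))%:C)%C = S t.
    by apply: complexP => //=; have := S0 t; rewrite lecE => /andP[/eqP ->].
  by rewrite mulr_suml; apply: eq_bigr => k _; rewrite /gam torus_charD mulrA.
rewrite cint_sum; last by move=> k; apply: cintegrableZ; exact: cintegrable_torus_char.
under eq_bigr => k _.
  rewrite cintZ; last exact: cintegrable_torus_char.
  rewrite Pk (_ : (addk k l == zerok d) = (k == oppk l)); last first.
    apply/eqP/eqP => [kl|->]; last exact: addNk.
    by rewrite -[k]add0k addkC -(addkN l) addkA kl add0k.
  over.
have -> : << translate l f, f >> = c (oppk l) by rewrite /c oppkK.
have [lK|lK] := boolP (oppk l \in K).
  rewrite (bigD1_seq (oppk l))//=; last exact: freq_box_uniq.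
  by rewrite eqxx mulr1 big1 ?addr0// => k /negbTE ->; rewrite mulr0.
rewrite big1_seq.
  have [//|cl] := eqVneq (c (oppk l)) 0.
  by move/negP: lK; case; exact: (mem_freq_box cM).
by move=> k /andP[_ kK]; case: eqP => [kl|]; [move: lK; rewrite -kl kK|rewrite mulr0].
Qed.

Lemma pos_bracket_mass f b : pos_bracket f b -> \int[P]_t b t = L2norm f ^+ 2.
Proof.
move=> [ib b0 /(_ (zerok d))]; rewrite translate0 L2dot_self => /(congr1 (fun z : R[i] => ReC z)) /= <-.
by apply: eq_Rintegral => t _; rewrite torus_char0 mulr1.
Qed.

Lemma cint_real_char_sub (u v : Rd R d -> R) k : P.-integrable setT (EFin \o u) ->
  P.-integrable setT (EFin \o v) ->
  cint P (fun t => ((u t + v t)%:C)%C * tc k t) =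
  cint P (fun t => ((u t)%:C)%C * tc k t) + cint P (fun t => ((v t)%:C)%C * tc k t).
Proof.
move=> iu iv; rewrite -cintD; [|exact: (cintegrable_mul_char _ (cintegrable_real iu))|
  exact: (cintegrable_mul_char _ (cintegrable_real iv))].
by apply: cint_eq => t; rewrite rmorphD /= mulrDl.
Qed.

Lemma cint_real_charZ (u : Rd R d -> R) (a : R) k : P.-integrable setT (EFin \o u) ->
  cint P (fun t => ((a * u t)%:C)%C * tc k t) = (a%:C)%C * cint P (fun t => ((u t)%:C)%C * tc k t).
Proof.
move=> iu; rewrite -cintZ; last exact: (cintegrable_mul_char _ (cintegrable_real iu)).
by apply: cint_eq => t; rewrite rmorphM /= mulrA.
Qed.

Lemma integrableZ_real (u : Rd R d -> R) (a : R) : P.-integrable setT (EFin \o u) ->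
  P.-integrable setT (EFin \o (fun t => a * u t)).
Proof. by move=> iu; have := integrableZl measurableT a iu; apply: eq_integrable. Qed.

Lemma integrableD_real (u v : Rd R d -> R) : P.-integrable setT (EFin \o u) ->
  P.-integrable setT (EFin \o v) -> P.-integrable setT (EFin \o (fun t => u t + v t)).
Proof. by move=> iu iv; have := integrableD measurableT iu iv; apply: eq_integrable. Qed.

(** Both sides represent 2 Re [f, h]: the mixed terms of s f + sg h / s carry the factor sg only,
    the powers of s cancelling. The Fourier coefficients agree, so uniqueness applies. *)
Lemma pos_bracket_polar f h (s : R) (sg : R) b bh bp b1 : L2 f -> L2 h -> 0 < s -> sg ^+ 2 = 1 ->
  pos_bracket f b -> pos_bracket h bh -> pos_bracket (f + h) bp ->
  pos_bracket (cscale (s%:C)%C f + cscale ((sg * s^-1)%:C)%C h) b1 ->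
  {ae P, forall t, bp t - b t - bh t = sg * (b1 t - s ^+ 2 * b t - (s^-1) ^+ 2 * bh t)}.
Proof.
move=> f2 h2 s0 sg2 [ib bp0 cb] [ibh bh0 cbh] [ibp bpp0 cbp] [ib1 b10 cb1].
have s1 : s^-1 * s = 1 by rewrite mulVf// gt_eqF.
have T2 k g : L2 g -> L2 (translate k g) by exact: L2_translate.
have sc a g : L2 g -> L2 (cscale a g) by exact: L2_scale.
have ad g g' : L2 g -> L2 g' -> L2 (g + g') by exact: L2_add.
have eq0 (u : Rd R d -> R) : P.-integrable setT (EFin \o u) ->
    (forall k, cint P (fun t => ((u t)%:C)%C * tc k t) = 0) -> {ae P, forall t, u t = 0}.
  move=> iu cu; have := Pu (cintegrable_real iu) cu.
  by apply: filterS => t /(congr1 (fun z : R[i] => ReC z)).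
have H1 : {ae P, forall t, bp t + (-1) * b t + (-1) * bh t +
    (- sg * b1 t + (sg * s ^+ 2 * b t + sg * (s^-1) ^+ 2 * bh t)) = 0}.
  have i0 := integrableD_real ibp (integrableZ_real (-1) ib).
  have i1 := integrableD_real i0 (integrableZ_real (-1) ibh).
  have i2 := integrableD_real (integrableZ_real (sg * s ^+ 2) ib) (integrableZ_real (sg * s^-1 ^+ 2) ibh).
  have i3 := integrableD_real (integrableZ_real (- sg) ib1) i2.
  apply: eq0; first exact: integrableD_real.
  move=> k.
  rewrite cint_real_char_sub// cint_real_char_sub//; last exact: integrableZ_real.
  rewrite cint_real_char_sub//; last exact: integrableZ_real.
  rewrite cint_real_char_sub//; last exact: integrableZ_real.
  rewrite cint_real_char_sub; [|exact: integrableZ_real|exact: integrableZ_real].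
  rewrite !cint_real_charZ// cb cbh cbp cb1 !translateD !translateZ.
  rewrite !L2dotDl; [|by auto..]; rewrite !L2dotDr; [|by auto..].
  rewrite !L2dotZl; [|by auto..]; rewrite !L2dotZr; [|by auto..].
  rewrite !conjc_real !rmorphM /= !rmorphN /= rmorph1.
  have sc1 : (s^-1%:C)%C * (s%:C)%C = 1 :> R[i] by rewrite -rmorphM /= s1.
  have sg1 : (sg%:C)%C * (sg%:C)%C = 1 :> R[i] by rewrite -rmorphM /= -expr2 sg2.
  move: sc1 sg1; move: (s^-1%:C)%C (s%:C)%C (sg%:C)%C => u v q uv qq.
  move: << translate k f, f >> << translate k f, h >> << translate k h, f >> << translate k h, h >> => x y z w.
  have E1 : q * (v * (q * u)) = 1 by transitivity ((q * q) * (u * v)); [ring|rewrite qq uv mulr1].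
  transitivity ((y + z) - (y + z) * (q * (v * (q * u))) + (q * (u ^+ 2) * w) * (1 - q * q)).
    by ring.
  by rewrite E1 qq; ring.
by apply: filterS H1 => t H; apply/eqP; rewrite -subr_eq0; apply/eqP; rewrite -[RHS]H; ring.
Qed.

(** Nonnegativity of the brackets of s f + h / s and s f - h / s bounds 2 Re [f, h] from below and
    from above by s^2 [f, f] + s^-2 [h, h]. This Cauchy-Schwarz substitute needs only positive
    brackets. *)
Lemma pos_bracket_incr_ae f h (s : R) b bh bp b1 b2 : L2 f -> L2 h -> 0 < s ->
  pos_bracket f b -> pos_bracket h bh -> pos_bracket (f + h) bp ->
  pos_bracket (cscale (s%:C)%C f + cscale ((1 * s^-1)%:C)%C h) b1 ->
  pos_bracket (cscale (s%:C)%C f + cscale ((-1 * s^-1)%:C)%C h) b2 ->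
  {ae P, forall t, `|bp t - b t| <= bh t + (s ^+ 2 * b t + (s^-1) ^+ 2 * bh t)}.
Proof.
move=> f2 h2 s0 Hb Hbh Hbp Hb1 Hb2.
have sq1 : (1 : R) ^+ 2 = 1 by rewrite expr1n.
have sqN1 : (-1 : R) ^+ 2 = 1 by rewrite sqrrN expr1n.
have E1 := pos_bracket_polar f2 h2 s0 sq1 Hb Hbh Hbp Hb1.
have E2 := pos_bracket_polar f2 h2 s0 sqN1 Hb Hbh Hbp Hb2.
apply: filterS2 E1 E2 => t.
have [_ /(_ t) p1 _] := Hb1; have [_ /(_ t) p2 _] := Hb2.
have [_ /(_ t) p3 _] := Hb; have [_ /(_ t) p4 _] := Hbh.
move: (s ^+ 2 * b t) (s^-1 ^+ 2 * bh t) => x y e1 e2.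
by rewrite ler_norml; apply/andP; split; lra.
Qed.

Lemma bounded_supportD f g : bounded_support f -> bounded_support g -> bounded_support (f + g).
Proof.
move=> [N fN] [M gM]; exists (maxn N M) => x [i xi].
have fx : f x = 0 by apply: fN; exists i; apply: le_lt_trans xi; rewrite ler_nat leq_maxl.
have gx : g x = 0 by apply: gM; exists i; apply: le_lt_trans xi; rewrite ler_nat leq_maxr.
by rewrite -[LHS]/(f x + g x) fx gx addr0.
Qed.

Lemma bounded_supportZ c f : bounded_support f -> bounded_support (cscale c f).
Proof. by move=> [N fN]; exists N => x xi; rewrite /cscale fN// mulr0. Qed.

Definition cube_set (n : nat) := [set x : Rd R d | forall i, `|tnth x i : R| <= n%:R].

Lemma measurable_cube_set n : measurable (cube_set n).
Proof.
rewrite (_ : cube_set n = \bigcap_(i in [set: 'I_d]) [set x : Rd R d | `|tnth x i : R| <= n%:R]).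
  apply: fin_bigcap_measurable => // i _.
  have := @measurable_tnth _ (measurableTypeR R) d i measurableT `[- n%:R, n%:R]%classic
    (measurable_itv _); rewrite setTI.
  by congr (measurable _); apply/seteqP; split => x /=; rewrite in_itv /= ler_norml.
by apply/seteqP; split => x H i; [move=> _|]; exact: H.
Qed.

Definition truncate (n : nat) f : fct := fun x => ((\1_(cube_set n) x : R)%:C)%C * f x.

Lemma L2_truncate n f : L2 f -> L2 (truncate n f).
Proof.
move=> f2; apply: (@L2_dominated _ _ _ f 1) => //.
  apply: cmeasM; last exact: L2_cmeas.
  by apply: cmeas_real; apply: measurable_indic; exact: measurable_cube_set.
move=> x; rewrite normcRM normcR_real ler_wpM2r ?normcR_ge0// indicE.
by case: (_ \in _); rewrite ?normr1 ?normr0.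
Qed.

Lemma bounded_support_truncate n f : bounded_support (truncate n f).
Proof.
exists n => x [i xi]; rewrite /truncate indicE memNset ?mul0r//.
by move=> /(_ i); rewrite leNgt xi.
Qed.

Lemma truncate_dense f (e : R) : L2 f -> 0 < e ->
  exists g, [/\ L2 g, bounded_support g & L2norm (f - g) < e].
Proof.
move=> f2 e0.
have [mf i_f] := proj1 (L2P _) f2.
have ft n : L2 (f - truncate n f) by apply: L2_sub => //; exact: L2_truncate.
have [] := @dominated_convergence _ _ _ mu setT measurableT
  (fun n x => (normcR ((f - truncate n f) x) ^+ 2)%:E) (cst 0%E) (fun x => (normcR (f x) ^+ 2)%:E).
- by move=> n; have [_ /measurable_int] := proj1 (L2P _) (ft n).
- exact: measurable_cst.
- apply: aeW => x _; apply: cvg_near_cst.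
  pose N := \max_(i < d) (Num.truncn `|tnth x i : R|).+1.
  exists N => // n /= Nn; rewrite -[(f - _) x]/(f x - truncate n f x) /truncate indicE mem_set.
    by rewrite rmorph1 mul1r subrr Normc.normc0 expr0n.
  move=> i; apply/ltW; apply: (lt_le_trans (@truncnS_gt _ _)); rewrite ler_nat.
  by apply: leq_trans Nn; exact: (@leq_bigmax _ (fun i => (Num.truncn `|tnth x i : R|).+1)).
- exact: i_f.
- apply: aeW => x n _; rewrite lee_fin ger0_norm ?sqr_ge0// ler_sqr ?nnegrE ?normcR_ge0//.
  rewrite -[(f - _) x]/(f x - truncate n f x) /truncate indicE.
  case: (_ \in _); first by rewrite rmorph1 mul1r subrr Normc.normc0 normcR_ge0.
  by rewrite rmorph0 mul0r subr0.
move=> _ _; rewrite integral0 => /fine_cvgP[_].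
move=> /cvgrPdist_lt /(_ (e ^+ 2) (exprn_gt0 _ e0)) [n _ /(_ n (leqnn _))].
rewrite sub0r normrN => H; exists (truncate n f); split.
- exact: L2_truncate.
- exact: bounded_support_truncate.
rewrite -(@ltr_pXn2r _ 2)// ?nnegrE ?L2norm_ge0 ?(ltW e0)// L2norm_sqr.
by apply: le_lt_trans H; rewrite /Rintegral /= ler_norm.
Qed.

(** The parameter s is left free so as to balance the small term in g - f against the one in f. *)
Lemma pos_bracket_L1_dist f g b c (s : R) : L2 f -> L2 g -> bounded_support f -> bounded_support g ->
  0 < s -> pos_bracket f b -> pos_bracket g c ->
  \int[P]_t `|c t - b t| <= L2norm (g - f) ^+ 2 + s ^+ 2 * L2norm f ^+ 2
     + s^-1 ^+ 2 * L2norm (g - f) ^+ 2.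
Proof.
move=> f2 g2 fb gb s0 Hb Hc; pose h := g - f.
have h2 : L2 h by exact: L2_sub.
have hb : bounded_support h.
  by apply: bounded_supportD => //; rewrite oppE_cscale; exact: bounded_supportZ.
have [bh Hbh] := pos_bracket_bounded h2 hb.
have fh : f + h = g by rewrite addrC subrK.
rewrite -fh in Hc.
have [b1 Hb1] : exists b1, pos_bracket (cscale (s%:C)%C f + cscale ((1 * s^-1)%:C)%C h) b1.
  apply: pos_bracket_bounded; first by apply: L2_add; exact: L2_scale.
  by apply: bounded_supportD; exact: bounded_supportZ.
have [b2 Hb2] : exists b1, pos_bracket (cscale (s%:C)%C f + cscale ((-1 * s^-1)%:C)%C h) b1.
  apply: pos_bracket_bounded; first by apply: L2_add; exact: L2_scale.
  by apply: bounded_supportD; exact: bounded_supportZ.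
have := pos_bracket_incr_ae f2 h2 s0 Hb Hbh Hc Hb1 Hb2.
rewrite -(pos_bracket_mass Hb) -(pos_bracket_mass Hbh).
have [ib _ _] := Hb; have [ibh _ _] := Hbh; have [ic _ _] := Hc.
have i1 := integrableZ_real (s ^+ 2) ib; have i2 := integrableZ_real (s^-1 ^+ 2) ibh.
have i12 := integrableD_real i1 i2.
have i3 : P.-integrable setT (EFin \o (fun t => `|c t - b t|)).
  have := integrable_norm (integrableB measurableT ic ib); exact: eq_integrable.
move=> /(ae_le_Rintegral i3 (integrableD_real ibh i12)) H; apply: (le_trans H).
by rewrite RintegralD// RintegralD// !RintegralZl// addrA.
Qed.

End bracket_existence.

(** * Limits of complex sequences and rational approximation *)

Section complex_limits.
Context (R : realType).
Implicit Types (u v : nat -> R[i]) (z w : R[i]).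

Definition ccvg u z := (fun n => ReC (u n)) @ \oo --> ReC z /\
  (fun n => ImC (u n)) @ \oo --> ImC z.

Lemma ccvg_cst z : ccvg (fun=> z) z. Proof. by split; exact: cvg_cst. Qed.

Lemma ccvgD u v z w : ccvg u z -> ccvg v w -> ccvg (fun n => u n + v n) (z + w).
Proof.
move=> [u1 u2] [v1 v2]; split; rewrite !ReImE; under eq_fun do rewrite !ReImE.
- exact: cvgD.
- exact: cvgD.
Qed.

Lemma ccvgM u v z w : ccvg u z -> ccvg v w -> ccvg (fun n => u n * v n) (z * w).
Proof.
move=> [u1 u2] [v1 v2]; split; rewrite !ReImE; under eq_fun do rewrite !ReImE.
- by apply: cvgB; exact: cvgM.
- by apply: cvgD; exact: cvgM.
Qed.

Lemma ccvg_conj u z : ccvg u z -> ccvg (fun n => conjc (u n)) (conjc z).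
Proof.
move=> [u1 u2]; split; rewrite !ReImE; under eq_fun do rewrite !ReImE.
- exact: u1.
- exact: cvgN u2.
Qed.

Lemma ccvg_sum I (s : seq I) (F : I -> nat -> R[i]) (L : I -> R[i]) :
  (forall i, ccvg (F i) (L i)) -> ccvg (fun n => \sum_(i <- s) F i n) (\sum_(i <- s) L i).
Proof.
move=> FL; elim: s => [|i s IH].
  by rewrite big_nil; under eq_fun do rewrite big_nil; exact: ccvg_cst.
by rewrite big_cons; under eq_fun do rewrite big_cons; exact: ccvgD.
Qed.

Lemma ccvg_prod I (s : seq I) (F : I -> nat -> R[i]) (L : I -> R[i]) :
  (forall i, ccvg (F i) (L i)) -> ccvg (fun n => \prod_(i <- s) F i n) (\prod_(i <- s) L i).
Proof.
move=> FL; elim: s => [|i s IH].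
  by rewrite big_nil; under eq_fun do rewrite big_nil; exact: ccvg_cst.
by rewrite big_cons; under eq_fun do rewrite big_cons; exact: ccvgM.
Qed.

Lemma ccvg_unique u z w : ccvg u z -> ccvg u w -> z = w.
Proof.
move=> [z1 z2] [w1 w2]; apply: complexP.
- by rewrite -(cvg_lim (@Rhausdorff R) z1) -(cvg_lim (@Rhausdorff R) w1).
- by rewrite -(cvg_lim (@Rhausdorff R) z2) -(cvg_lim (@Rhausdorff R) w2).
Qed.

Lemma ccvg_ge0 u z : (forall n, 0 <= u n) -> ccvg u z -> 0 <= z.
Proof.
move=> u0 [z1 z2]; rewrite lecE; apply/andP; split.
  apply/eqP => /=; rewrite -(cvg_lim (@Rhausdorff R) z2) (_ : (fun n => ImC (u n)) = fun=> 0).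
    by rewrite lim_cst.
  by apply/funext => n; have := u0 n; rewrite lecE => /andP[/eqP].
apply: (cvgr_to_ge z1); apply: nearW => n; have := u0 n.
by rewrite lecE => /andP[].
Qed.

Lemma eq_of_ccvg0 u z : (forall n, normcR z <= ReC (u n)) -> ccvg u 0 -> z = 0.
Proof.
move=> zu [u0 _]; apply: Normc.eq0_normc; apply/eqP; rewrite eq_le normcR_ge0 andbT.
by apply: (cvgr_to_ge u0); apply: nearW.
Qed.

Definition rational_approx (n : nat) (x : R) : rat :=
  (Num.floor (x * n.+1%:R))%:~R / n.+1%:R.

Lemma cvg_rational_approx x : (fun n => ratr (rational_approx n x)) @ \oo --> x.
Proof.
have E n : ratr (rational_approx n x) = (Num.floor (x * n.+1%:R))%:~R / n.+1%:R :> R.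
  by rewrite /rational_approx rmorphM fmorphV /= ratr_int ratr_nat.
under eq_fun do rewrite E.
apply: (@squeeze_cvgr _ _ _ _ (fun n => x - n.+1%:R^-1) (fun=> x)).
- apply: nearW => n; have n0 : 0 < n.+1%:R :> R by [].
  rewrite ler_pdivlMr// ler_pdivrMr// mulrBl mulVf ?gt_eqF//.
  have := floor_itv (x * n.+1%:R); rewrite rmorphD /= => /andP[h1 h2].
  by rewrite h1 andbT lerBlDr ltW.
- rewrite -[X in _ --> X]subr0; apply: cvgB; first exact: cvg_cst.
  exact: cvg_harmonic.
- exact: cvg_cst.
Qed.

End complex_limits.

Lemma ae_forall_countable (T : countType) d (X : measurableType d) (R : realType)
  (m : {measure set X -> \bar R}) (Q : T -> X -> Prop) :
  (forall a, {ae m, forall x, Q a x}) -> {ae m, forall x, forall a, Q a x}.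
Proof.
move=> H; have : {ae m, forall x, forall n, if unpickle n is Some a then Q a x else True}.
  by apply: ae_foralln => n; case: (unpickle n) => [a|]; [exact: H|exact: aeW].
by apply: filterS => x Hx a; have := Hx (pickle a); rewrite pickleK.
Qed.

Section brackets.
Context (R : realType) (d : nat) (P : {finite_measure set (Rd R d) -> \bar R}).
Local Notation mu := (lebesgueX R d).
Local Notation fct := (Rd R d -> R[i]).
Local Notation "<< f , g >>" := (L2dot f g).
Local Notation tc := (@torus_char R d).
Hypothesis Pk : forall k, cint P (tc k) = (k == zerok d)%:R.
Hypothesis Pu : forall h, cintegrable P h ->
  (forall k, cint P (fun t => h t * tc k t) = 0) -> {ae P, forall t, h t = 0}.
Implicit Types (f g h : fct) (b : Rd R d -> R).

Lemma pos_bracket_exists f : L2 f -> exists b, pos_bracket P f b.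
Proof.
move=> f2.
have q0 n : 0 < 4^-1 ^+ n :> R by rewrite exprn_gt0// invr_gt0.
have [g gP] := choice (fun n => truncate_dense f2 (q0 n)).
have g2 n : L2 (g n) by case: (gP n).
have gb n : bounded_support (g n) by case: (gP n).
have fg n : L2norm (f - g n) <= 4^-1 ^+ n by apply/ltW; case: (gP n).
have [b bP] := choice (fun n => pos_bracket_bounded Pk (g2 n) (gb n)).
have ib n : P.-integrable setT (EFin \o b n) by case: (bP n).
have b0 n t : 0 <= b n t by case: (bP n).
have q1 n : 4^-1 ^+ n <= 1 :> R by rewrite exprn_ile1 ?invr_ge0// invf_le1 ?ler1n.
have q24 n : 4^-1 ^+ n <= 2^-1 ^+ n :> R.
  by rewrite lerXn2r ?nnegrE ?invr_ge0// lef_pV2 ?posrE// ler_nat.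
have gn n : L2norm (g n) <= L2norm f + 1.
  rewrite (_ : g n = f - (f - g n)); last by rewrite opprB addrC subrK.
  apply: le_trans (L2norm_triangle _ _) _; [by []|by apply/L2_opp/L2_sub|].
  by rewrite lerD2l L2normN (le_trans (fg n)).
have gg n : L2norm (g n.+1 - g n) <= 2 * 4^-1 ^+ n.
  apply: le_trans (L2norm_triangleB (g2 n.+1) f2 (g2 n)) _.
  rewrite L2norm_distC mulr_natl mulr2n; apply: lerD; last exact: fg.
  by apply: le_trans (fg n.+1) _; rewrite exprS ler_piMl ?(ltW (q0 n))// invf_le1 ?ler1n.
have Hb n : \int[P]_t `|b n.+1 t - b n t| <= (8 + (L2norm f + 1) ^+ 2) * 2^-1 ^+ n.
  (* With s = 2^-n, both s^2 |g_n|^2 and s^-2 |g_(n+1) - g_n|^2 <= 4^n * 4 * 16^-n are of order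
     4^-n. This is why the truncations are chosen at distance 4^-n from f. *)
  have s0 : 0 < 2^-1 ^+ n :> R by rewrite exprn_gt0// invr_gt0.
  apply: le_trans (pos_bracket_L1_dist Pk Pu (g2 n) (g2 n.+1) (gb n) (gb n.+1) s0 (bP n) (bP n.+1)) _.
  have E4 : (2^-1 ^+ n) ^+ 2 = 4^-1 ^+ n :> R.
    by rewrite exprAC; congr (_ ^+ _); field.
  have H1 : L2norm (g n.+1 - g n) ^+ 2 <= 4 * (4^-1 ^+ n * 4^-1 ^+ n).
    rewrite (_ : 4 * _ = (2 * 4^-1 ^+ n) ^+ 2); last by ring.
    by rewrite ler_sqr ?nnegrE ?L2norm_ge0// mulr_ge0// ltW.
  have H2 : L2norm (g n) ^+ 2 <= (L2norm f + 1) ^+ 2.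
    by rewrite ler_sqr ?nnegrE ?L2norm_ge0// addr_ge0 ?L2norm_ge0.
  have -> : ((2^-1 ^+ n)^-1) ^+ 2 = (4^-1 ^+ n)^-1 :> R by rewrite exprVn E4.
  rewrite E4; move: H1 H2 (q24 n) (q1 n) (q0 n) (sqr_ge0 (L2norm f + 1)).
  move: (4^-1 ^+ n) (2^-1 ^+ n) (L2norm (g n.+1 - g n) ^+ 2) (L2norm (g n) ^+ 2) ((L2norm f + 1) ^+ 2)
    => q p x y z Hx Hy qp q1' q0' z0.
  have X1 : q^-1 * x <= 4 * q.
    by rewrite mulrC ler_pdivrMr// -mulrA.
  nra.
have [v [iv bv L1v]] := L1_fast_cvg ib Hb.
have iav : P.-integrable setT (EFin \o (fun t => `|v t|)).
  by have := integrable_norm iv; apply: eq_integrable.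
(* The limit v is nonnegative only almost everywhere, while [pos_bracket] asks for it everywhere.
   Since every [b n] is nonnegative, the absolute value does not increase the distance to it. *)
exists (fun t => `|v t|); split => // k.
apply/eqP; rewrite -subr_eq0; apply/eqP.
apply: (@eq_of_ccvg0 _ (fun n => ((2 * \int[P]_t `|b n t - v t| +
   (4^-1 ^+ n) * (2 * L2norm f + 1))%:C)%C)); last first.
  split; rewrite /=; last exact: cvg_cst.
  rewrite -[X in _ --> X]addr0; apply: cvgD.
    by rewrite -[X in _ --> X](mulr0 2); apply: cvgM => //; exact: cvg_cst.
  rewrite -[X in _ --> X](mul0r (2 * L2norm f + 1)); apply: cvgM; last exact: cvg_cst.
  have := @cvg_geometric R 1 4^-1; rewrite /geometric /=.
  under eq_fun do rewrite mul1r.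
  by apply; rewrite ger0_norm ?invr_ge0// invf_lt1// ltr1n.
move=> n; rewrite Re_real.
have [_ _ bk] := bP n.
have -> : cint P (fun t => (`|v t|%:C)%C * tc k t) - << translate k f, f >> =
   (cint P (fun t => (`|v t|%:C)%C * tc k t) - cint P (fun t => ((b n t)%:C)%C * tc k t)) +
   (<< translate k (g n), g n >> - << translate k f, f >>) by rewrite bk addrA subrK.
apply: le_trans (normcR_triangle _ _) _; apply: lerD.
  have i1 := cintegrable_mul_char k (cintegrable_real iav).
  have i2 := cintegrable_mul_char k (cintegrable_real (ib n)).
  rewrite -cintB//; apply: normcR_cint_le.
  - exact: cintegrableB.
  - have := integrable_norm (integrableB measurableT (ib n) iv); exact: eq_integrable.
  - apply: aeW => t; rewrite -mulrBl normcRM normc_torus_char mulr1.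
    have -> : (`|v t|%:C)%C - ((b n t)%:C)%C = ((`|v t| - b n t)%:C)%C :> R[i] by rewrite rmorphB.
    rewrite normcR_real.
    by rewrite -[b n t in leLHS]ger0_norm// (le_trans (ler_dist_dist _ _))// distrC.
have fgs : L2 (g n - f) by exact: L2_sub.
have -> : << translate k (g n), g n >> - << translate k f, f >> =
  << translate k (g n - f), g n >> + << translate k f, g n - f >>.
  have Tf := L2_translate k f2; have Tg := L2_translate k (g2 n).
  by rewrite translateB L2dotBl// L2dotBr// addrA subrK.
apply: le_trans (normcR_triangle _ _) _.
have N1 := normc_L2dot_le (L2_translate k fgs) (g2 n).
have N2 := normc_L2dot_le (L2_translate k f2) fgs.
rewrite !L2norm_translate// in N1 N2.
move: N1 N2 (fg n) (gn n); rewrite (L2norm_distC f).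
have := L2norm_ge0 (g n - f); have := L2norm_ge0 f; have := L2norm_ge0 (g n).
move: (normcR _) (normcR _) (L2norm (g n - f)) (L2norm f) (L2norm (g n)) (4^-1 ^+ n) => *; nra.
Qed.

End brackets.

(** * Sesquilinearity, positivity and continuity of the bracket *)

Section bracket_theory.
Context (R : realType) (d : nat) (P : {finite_measure set (Rd R d) -> \bar R}).
Local Notation mu := (lebesgueX R d).
Local Notation fct := (Rd R d -> R[i]).
Local Notation "<< f , g >>" := (L2dot f g).
Local Notation tc := (@torus_char R d).
Hypothesis Pk : forall k, cint P (tc k) = (k == zerok d)%:R.
Hypothesis Pu : forall h, cintegrable P h ->
  (forall k, cint P (fun t => h t * tc k t) = 0) -> {ae P, forall t, h t = 0}.
Implicit Types (f g h : fct) (B : Rd R d -> R[i]).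

(** Coefficients are taken against [tc k] and not its conjugate, so that translating f by k
    multiplies the bracket by [tc k]. *)
Definition is_bracket f g B := cintegrable P B /\
  forall k, cint P (fun t => B t * tc k t) = << translate k f, g >>.

(** Polarization from the positive brackets of f + g, f - g, f + i g and f - i g. *)
Lemma bracket_exists f g : L2 f -> L2 g -> exists B, is_bracket f g B.
Proof.
move=> f2 g2; have ig2 : L2 (cscale 'i%C g) by exact: L2_scale.
have [b1 [ib1 _ cb1]] := pos_bracket_exists Pk Pu (L2_add f2 g2).
have [b2 [ib2 _ cb2]] := pos_bracket_exists Pk Pu (L2_sub f2 g2).
have [b3 [ib3 _ cb3]] := pos_bracket_exists Pk Pu (L2_add f2 ig2).
have [b4 [ib4 _ cb4]] := pos_bracket_exists Pk Pu (L2_sub f2 ig2).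
have i1 := cintegrable_real ib1; have i2 := cintegrable_real ib2.
have i3 := cintegrable_real ib3; have i4 := cintegrable_real ib4.
have j1 := cintegrableB i1 i2; have j2 := cintegrableZ 'i%C (cintegrableB i3 i4).
have j3 := cintegrableZ (4^-1) (cintegrableD j1 j2).
exists (fun t => 4^-1 * ((((b1 t)%:C)%C - ((b2 t)%:C)%C) + 'i%C * (((b3 t)%:C)%C - ((b4 t)%:C)%C))).
split => // k.
have T2 h : L2 h -> L2 (translate k h) by exact: L2_translate.
rewrite (_ : cint _ _ = 4^-1 * ((<< translate k (f + g), f + g >> - << translate k (f - g), f - g >>) +
  'i%C * (<< translate k (f + cscale 'i%C g), f + cscale 'i%C g >> -
          << translate k (f - cscale 'i%C g), f - cscale 'i%C g >>))); last first.
  have m (h : Rd R d -> R[i]) : cintegrable P h -> cintegrable P (fun t => h t * tc k t).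
    exact: cintegrable_mul_char.
  rewrite -cb1 -cb2 -cb3 -cb4 -!cintB; [|exact: m|exact: m|exact: m|exact: m].
  rewrite -cintZ; last by apply: cintegrableB; exact: m.
  rewrite -cintD; last 2 first.
  - by apply: cintegrableB; exact: m.
  - by apply: cintegrableZ; apply: cintegrableB; exact: m.
  rewrite -cintZ; last first.
    apply: cintegrableD; first by apply: cintegrableB; exact: m.
    by apply: cintegrableZ; apply: cintegrableB; exact: m.
  by apply: cint_eq => t; ring.
have Tf := T2 _ f2; have Tg := T2 _ g2; have Tig := T2 _ ig2.
have fg2 := L2_add f2 g2; have fg2' := L2_sub f2 g2.
have fig2 := L2_add f2 ig2; have fig2' := L2_sub f2 ig2.
rewrite !translateB !translateD.
have ng2 := L2_opp g2; have nig2 := L2_opp ig2.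
have nTg := L2_opp Tg; have nTig := L2_opp Tig.
rewrite !L2dotDl// !L2dotDr// !L2dotNl// !L2dotNr//.
rewrite !translateZ !L2dotZl// !L2dotZr//.
have -> : conjc 'i%C = - 'i%C :> R[i] by apply: complexP; rewrite /= ?oppr0.
have ii : 'i%C * 'i%C = -1 :> R[i] by rewrite -expr2 sqr_i.
move: << translate k f, f >> << translate k f, g >> << translate k g, f >> << translate k g, g >> => x y z w.
transitivity (4^-1 * ((2 * y + 2 * z) - ('i%C * 'i%C) * (2 * y - 2 * z)) : R[i]); first by ring.
by rewrite ii; field.
Qed.

Definition bracket f g : fct := xget 0 [set B | is_bracket f g B].

Lemma bracketP f g : L2 f -> L2 g -> is_bracket f g (bracket f g).
Proof.
by move=> f2 g2; exact: (@xgetPex _ 0 [set B | is_bracket f g B] (bracket_exists f2 g2)).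
Qed.

Lemma is_bracket_unique f g B B' : is_bracket f g B -> is_bracket f g B' ->
  {ae P, forall t, B t = B' t}.
Proof.
move=> [iB cB] [iB' cB'].
have := Pu (cintegrableB iB iB').
move=> H; apply: (@filterS _ _ _ _ _ _ (H _)) => [t /eqP|k]; first by rewrite subr_eq0 => /eqP.
 rewrite -[RHS](subrr << translate k f, g >>) -{1}cB -cB' -cintB; last 2 first.
- exact: cintegrable_mul_char.
- exact: cintegrable_mul_char.
by apply: cint_eq => t; rewrite mulrBl.
Qed.

Lemma bracket_unique f g B : L2 f -> L2 g -> is_bracket f g B ->
  {ae P, forall t, bracket f g t = B t}.
Proof. by move=> f2 g2; apply: is_bracket_unique; exact: bracketP. Qed.

Lemma cintegrable_bracket f g : L2 f -> L2 g -> cintegrable P (bracket f g).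
Proof. by move=> f2 g2; case: (bracketP f2 g2). Qed.

Lemma cmeas_bracket f g : L2 f -> L2 g -> cmeas (bracket f g).
Proof. by move=> f2 g2; apply: cintegrable_cmeas; exact: cintegrable_bracket. Qed.

Lemma cint_bracket f g : L2 f -> L2 g -> cint P (bracket f g) = << f, g >>.
Proof.
move=> f2 g2; have [_ /(_ (zerok d))] := bracketP f2 g2; rewrite translate0 => <-.
by apply: cint_eq => t; rewrite torus_char0 mulr1.
Qed.

Lemma bracketDl f g h : L2 f -> L2 g -> L2 h ->
  {ae P, forall t, bracket (f + g) h t = bracket f h t + bracket g h t}.
Proof.
move=> f2 g2 h2; apply: bracket_unique => //; first exact: L2_add.
have [i1 c1] := bracketP f2 h2; have [i2 c2] := bracketP g2 h2.
split; first exact: cintegrableD.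
move=> k; rewrite translateD L2dotDl//; [|exact: L2_translate|exact: L2_translate].
rewrite -c1 -c2 -cintD; [|exact: cintegrable_mul_char|exact: cintegrable_mul_char].
by apply: cint_eq => t; rewrite mulrDl.
Qed.

Lemma bracketZl c f h : L2 f -> L2 h ->
  {ae P, forall t, bracket (cscale c f) h t = c * bracket f h t}.
Proof.
move=> f2 h2; apply: bracket_unique => //; first exact: L2_scale.
have [i1 c1] := bracketP f2 h2; split; first exact: cintegrableZ.
move=> k; rewrite translateZ L2dotZl//; last exact: L2_translate.
rewrite -c1 -cintZ; last exact: cintegrable_mul_char.
by apply: cint_eq => t; rewrite mulrA.
Qed.

Lemma bracket_conj f g : L2 f -> L2 g ->
  {ae P, forall t, bracket g f t = conjc (bracket f g t)}.
Proof.
move=> f2 g2; apply: bracket_unique => //.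
have [i1 c1] := bracketP f2 g2; split; first exact: cintegrable_conj.
move=> k; rewrite L2dot_translateK// L2dot_conj//; last exact: L2_translate.
rewrite -c1 -cint_conj; last exact: cintegrable_mul_char.
by apply: cint_eq => t; rewrite conjcM torus_charN conjcK.
Qed.

Lemma bracket_translate k f g : L2 f -> L2 g ->
  {ae P, forall t, bracket (translate k f) g t = tc k t * bracket f g t}.
Proof.
move=> f2 g2; apply: bracket_unique => //; first exact: L2_translate.
have [i1 c1] := bracketP f2 g2; split.
  by under eq_fun do rewrite mulrC; exact: cintegrable_mul_char.
move=> l; rewrite translate_translate -c1; apply: cint_eq => t.
by rewrite torus_charD; ring.
Qed.

Lemma bracket_ge0 f : L2 f -> {ae P, forall t, 0 <= bracket f f t}.
Proof.
move=> f2; have [b [ib b0 cb]] := pos_bracket_exists Pk Pu f2.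
have : {ae P, forall t, bracket f f t = ((b t)%:C)%C}.
  by apply: bracket_unique => //; split => //; exact: cintegrable_real.
by apply: filterS => t ->; rewrite ler0c.
Qed.

Lemma bracket_eq0 f g : L2 f -> L2 g -> (forall k, << translate k f, g >> = 0) ->
  {ae P, forall t, bracket f g t = 0}.
Proof.
move=> f2 g2 fg; apply: bracket_unique => //; split; first exact: cintegrable0.
by move=> k; rewrite fg -[RHS](cint0 P); apply: cint_eq => t; rewrite mul0r.
Qed.

Lemma bracketDr f g h : L2 f -> L2 g -> L2 h ->
  {ae P, forall t, bracket h (f + g) t = bracket h f t + bracket h g t}.
Proof.
move=> f2 g2 h2; apply: bracket_unique => //; first exact: L2_add.
have [i1 c1] := bracketP h2 f2; have [i2 c2] := bracketP h2 g2.
split; first exact: cintegrableD.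
move=> k; rewrite L2dotDr//; last exact: L2_translate.
rewrite -c1 -c2 -cintD; [|exact: cintegrable_mul_char|exact: cintegrable_mul_char].
by apply: cint_eq => t; rewrite mulrDl.
Qed.

Lemma bracketZr c f h : L2 f -> L2 h ->
  {ae P, forall t, bracket h (cscale c f) t = conjc c * bracket h f t}.
Proof.
move=> f2 h2; apply: bracket_unique => //; first exact: L2_scale.
have [i1 c1] := bracketP h2 f2; split; first exact: cintegrableZ.
move=> k; rewrite L2dotZr//; last exact: L2_translate.
rewrite -c1 -cintZ; last exact: cintegrable_mul_char.
by apply: cint_eq => t; rewrite mulrA.
Qed.

Lemma bracket_suml I (s : seq I) (F : I -> fct) h : (forall i, L2 (F i)) -> L2 h ->
  {ae P, forall t, bracket (\sum_(i <- s) F i) h t = \sum_(i <- s) bracket (F i) h t}.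
Proof.
move=> F2 h2; elim: s => [|i s IH].
  rewrite big_nil; apply: filterS (@bracket_eq0 0 h _ _ _) => [t ->| | |] //.
  - by rewrite big_nil.
  - exact: L2_0.
  - move=> k; rewrite (_ : translate k 0 = 0) ?L2dot0l//.
rewrite big_cons; apply: filterS2 IH (bracketDl (F2 i) (L2_sum s F2) h2) => t E ->.
by rewrite big_cons E.
Qed.

Lemma bracket_sumr I (s : seq I) (F : I -> fct) h : (forall i, L2 (F i)) -> L2 h ->
  {ae P, forall t, bracket h (\sum_(i <- s) F i) t = \sum_(i <- s) bracket h (F i) t}.
Proof.
move=> F2 h2; elim: s => [|i s IH].
  rewrite big_nil; apply: filterS (@bracket_eq0 h 0 _ _ _) => [t ->| | |] //.
  - by rewrite big_nil.
  - exact: L2_0.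
  - by move=> k; rewrite L2dot0r.
rewrite big_cons; apply: filterS2 IH (bracketDr (F2 i) (L2_sum s F2) h2) => t E ->.
by rewrite big_cons E.
Qed.

(** The double sum is the bracket of sum_i u_i F_i with itself. The exceptional null set depends on
    u. *)
Lemma gram_psd_fixed m (F : 'I_m -> fct) (u : 'I_m -> R[i]) : (forall i, L2 (F i)) ->
  {ae P, forall t, 0 <= \sum_(i < m) \sum_(j < m) u i * conjc (u j) * bracket (F i) (F j) t}.
Proof.
move=> F2; have sF i : L2 (cscale (u i) (F i)) by exact: L2_scale.
have S2 : L2 (\sum_(i < m) cscale (u i) (F i)) by exact: L2_sum.
have H1 := bracket_suml (index_enum 'I_m) sF S2.
have H2 : {ae P, forall t, forall i : 'I_m, bracket (cscale (u i) (F i)) (\sum_(i < m) cscale (u i) (F i)) t =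
    \sum_(j < m) u i * conjc (u j) * bracket (F i) (F j) t}.
  apply: ae_forall_countable => i.
  have E1 := bracketZl (u i) (F2 i) S2.
  have E2 := bracket_sumr (index_enum 'I_m) sF (F2 i).
  have E3 : {ae P, forall t, forall j : 'I_m, bracket (F i) (cscale (u j) (F j)) t =
      conjc (u j) * bracket (F i) (F j) t}.
    by apply: ae_forall_countable => j; exact: bracketZr.
  apply: filterS2 E1 (filterI E2 E3) => t -> [-> e3].
  by rewrite mulr_sumr; apply: eq_bigr => j _; rewrite e3 mulrA.
apply: filterS2 (bracket_ge0 S2) (filterI H1 H2) => t + [e1 e2].
by rewrite e1; under eq_bigr do rewrite e2.
Qed.

Definition psd_gram m (G : 'I_m -> 'I_m -> R[i]) :=
  forall u : 'I_m -> R[i], 0 <= \sum_(i < m) \sum_(j < m) u i * conjc (u j) * G i j.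

(** Vectors with rational real and imaginary parts are countably many, which gives one null set for
    all of them. At a fixed t the form is continuous in u, so density covers every vector. *)
Lemma gram_psd m (F : 'I_m -> fct) : (forall i, L2 (F i)) ->
  {ae P, forall t, psd_gram (fun i j => bracket (F i) (F j) t)}.
Proof.
move=> F2.
have : {ae P, forall t, forall q : {ffun 'I_m -> rat * rat},
    0 <= \sum_(i < m) \sum_(j < m) Complex (ratr (q i).1) (ratr (q i).2) *
      conjc (Complex (ratr (q j).1) (ratr (q j).2)) * bracket (F i) (F j) t}.
  by apply: ae_forall_countable => q; exact: gram_psd_fixed.
apply: filterS => t H u.
pose q n : {ffun 'I_m -> rat * rat} :=
  [ffun i => (rational_approx n (ReC (u i)), rational_approx n (ImC (u i)))].
apply: (ccvg_ge0 (fun n => H (q n))).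
apply: ccvg_sum => i; apply: ccvg_sum => j; apply: ccvgM; last exact: ccvg_cst.
have uc l : ccvg (fun n => Complex (ratr (q n l).1) (ratr (q n l).2)) (u l).
  by split => /=; under eq_fun do rewrite ffunE; exact: cvg_rational_approx.
by apply: ccvgM => //; exact: ccvg_conj.
Qed.

Lemma bracket_amgm f g : L2 f -> L2 g ->
  {ae P, forall t, 2 * normcR (bracket f g t) <= ReC (bracket f f t) + ReC (bracket g g t)}.
Proof.
move=> f2 g2; pose F (i : 'I_2) := if i == ord0 then f else g.
have F2 i : L2 (F i) by rewrite /F; case: ifP.
apply: filterS2 (filterI (gram_psd F2) (bracket_conj f2 g2))
  (filterI (bracket_ge0 f2) (bracket_ge0 g2)) => t [psd cj] [f0 g0].
set z := bracket f g t; have [z0|z0] := eqVneq (normcR z) 0.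
  rewrite z0 mulr0; move: f0 g0; rewrite !lecE => /andP[_ p1] /andP[_ p2].
  exact: addr_ge0.
have zp : 0 < normcR z by rewrite lt_neqAle eq_sym z0 normcR_ge0.
(* Testing the Gram matrix of f and g at (1, -c), with c the phase of z, turns the two mixed terms
   into -|z| each. *)
pose c := ((normcR z)^-1%:C)%C * z.
have := psd (fun i => if i == ord0 then 1 else - c).
have l0 : (lift ord0 ord0 == ord0 :> 'I_2) = false by [].
rewrite !big_ord_recl !big_ord0 /F !eqxx !l0 !addr0 !mul1r.
rewrite cj -/z conjc1 !mul1r !mulr1 conjcN.
have cz : conjc c * z = ((normcR z)%:C)%C.
  rewrite /c conjcM conjc_real -mulrA [conjc z * z]mulrC mulc_conj -rmorphM /=.
  by rewrite expr2 mulrA mulVf ?gt_eqF// mul1r.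
have cc : c * conjc c = 1.
  rewrite {1}/c -mulrA [z * conjc c]mulrC cz.
  by rewrite -rmorphM /= mulVf ?gt_eqF// rmorph1.
rewrite mulrNN cc mul1r mulNr cz.
have -> : - c * conjc z = - ((normcR z)%:C)%C.
  by rewrite mulNr; congr (- _); rewrite -[c]conjcK -conjcM cz conjc_real.
rewrite lecE => /andP[_]; rewrite !ReImE /= => H.
rewrite -subr_ge0; apply: le_trans H _.
rewrite le_eqVlt; apply/orP; left; apply/eqP; ring.
Qed.

Lemma Rint_bracket_self f : L2 f -> \int[P]_t ReC (bracket f f t) = L2norm f ^+ 2.
Proof.
move=> f2; have := cint_bracket f2 f2; rewrite L2dot_self.
by move=> /(congr1 (fun z : R[i] => ReC z)).
Qed.

(** Integrate the previous inequality for |g| f and |f| g, where |.| is the L^2 norm: both squares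
    then have the same integral and the constant is sharp. *)
Lemma bracket_L1_le f g : L2 f -> L2 g ->
  \int[P]_t normcR (bracket f g t) <= L2norm f * L2norm g.
Proof.
move=> f2 g2; have ifg := cintegrable_normcR (cintegrable_bracket f2 g2).
(* The rescaling degenerates when one of the norms is 0. There all the Fourier coefficients of the
   bracket vanish by Cauchy-Schwarz. *)
have zero : L2norm f * L2norm g = 0 -> \int[P]_t normcR (bracket f g t) <= 0.
  move=> fg0; rewrite (@eq_ae_Rintegral _ _ _ P _ (fun=> 0)).
  - by rewrite Rintegral_cst// mul0r.
  - by have /measurable_EFinP := measurable_int _ ifg.
  - exact: measurable_cst.
  - apply: filterS (bracket_eq0 f2 g2 _) => [t ->|k]; first exact: Normc.normc0.
    apply: Normc.eq0_normc; apply/eqP; rewrite eq_le normcR_ge0 andbT.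
    apply: le_trans (normc_L2dot_le (L2_translate k f2) g2) _.
    by rewrite L2norm_translate// fg0.
have := L2norm_ge0 f; rewrite le_eqVlt => /predU1P[f0|f0].
  by rewrite -f0 mul0r; apply: zero; rewrite -f0 mul0r.
have := L2norm_ge0 g; rewrite le_eqVlt => /predU1P[g0|g0].
  by rewrite -g0 mulr0; apply: zero; rewrite -g0 mulr0.
pose a := L2norm f; pose b := L2norm g.
have fa2 := L2_scale ((b%:C)%C) f2; have gb2 := L2_scale ((a%:C)%C) g2.
have E : {ae P, forall t, bracket (cscale (b%:C)%C f) (cscale (a%:C)%C g) t =
    ((b * a)%:C)%C * bracket f g t}.
  apply: filterS2 (bracketZl ((b%:C)%C) f2 gb2) (bracketZr ((a%:C)%C) g2 f2) => t -> ->.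
  by rewrite conjc_real mulrA -rmorphM.
have i1 := (cintegrable_bracket fa2 fa2).1; have i2 := (cintegrable_bracket gb2 gb2).1.
have i12 : P.-integrable setT (EFin \o (fun t => ReC (bracket (cscale (b%:C)%C f) (cscale (b%:C)%C f) t) +
    ReC (bracket (cscale (a%:C)%C g) (cscale (a%:C)%C g) t))).
  by have := integrableD measurableT i1 i2; apply: eq_integrable.
have ab0 : 0 < b * a by exact: mulr_gt0.
have H : {ae P, forall t, 2 * (b * a) * normcR (bracket f g t) <=
    ReC (bracket (cscale (b%:C)%C f) (cscale (b%:C)%C f) t) +
    ReC (bracket (cscale (a%:C)%C g) (cscale (a%:C)%C g) t)}.
  apply: filterS2 (bracket_amgm fa2 gb2) E => t + E1; rewrite E1.
  by rewrite normcRM normcR_real gtr0_norm// mulrA.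
have i3 : P.-integrable setT (EFin \o (fun t => 2 * (b * a) * normcR (bracket f g t))).
  by have := integrableZl measurableT (2 * (b * a)) ifg; apply: eq_integrable.
have := ae_le_Rintegral i3 i12 H.
rewrite [X in X <= _](RintegralZl _ measurableT ifg) [X in _ <= X](RintegralD measurableT i1 i2).
rewrite (Rint_bracket_self fa2) (Rint_bracket_self gb2) (L2norm_sqrZ _ f2) (L2norm_sqrZ _ g2) !normcR_real.
rewrite !gtr0_norm// -/a -/b => H2.
have : 2 * (b * a) * (\int[P]_t normcR (bracket f g t)) <= 2 * (b * a) * (a * b).
  by apply: le_trans H2 _; rewrite le_eqVlt; apply/orP; left; apply/eqP; ring.
by rewrite ler_pM2l// mulr_gt0.
Qed.

(** The error splits as [x_n - f, y_n] + [f, y_n - g], whose L^1 norm is of order 2^-n. The rate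
    gives almost sure convergence without passing to a subsequence. *)
Lemma bracket_cvg_ae (x y : nat -> fct) f g : (forall n, L2 (x n)) -> (forall n, L2 (y n)) ->
  L2 f -> L2 g -> (forall n, L2norm (x n - f) <= 2^-1 ^+ n) ->
  (forall n, L2norm (y n - g) <= 2^-1 ^+ n) ->
  {ae P, forall t, ccvg (fun n => bracket (x n) (y n) t) (bracket f g t)}.
Proof.
move=> x2 y2 f2 g2 xf yg.
pose D n t := normcR (bracket (x n) (y n) t - bracket f g t).
have iD n : P.-integrable setT (EFin \o D n).
  apply: cintegrable_normcR; apply: cintegrableB; exact: cintegrable_bracket.
have xf2 n : L2 (x n - f) by exact: L2_sub.
have yg2 n : L2 (y n - g) by exact: L2_sub.
have q1 n : 2^-1 ^+ n <= 1 :> R by rewrite exprn_ile1 ?invr_ge0// invf_le1 ?ler1n.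
have yn n : L2norm (y n) <= L2norm g + 1.
  rewrite (_ : y n = g + (y n - g)); last by rewrite addrC subrK.
  by apply: le_trans (L2norm_triangle g2 (yg2 n)) _; rewrite lerD2l (le_trans (yg n)).
have ID n : \int[P]_t `|D n t| <= (L2norm g + 1 + L2norm f) * 2^-1 ^+ n.
  have i1 := cintegrable_normcR (cintegrable_bracket (xf2 n) (y2 n)).
  have i2 := cintegrable_normcR (cintegrable_bracket f2 (yg2 n)).
  apply: (@le_trans _ _ (\int[P]_t (normcR (bracket (x n - f) (y n) t) +
    normcR (bracket f (y n - g) t)))).
    apply: ae_le_Rintegral.
    - by have := integrable_norm (iD n).
    - by have := integrableD measurableT i1 i2; apply: eq_integrable.
    have E1 := bracketDl (xf2 n) f2 (y2 n).
    have E2 := bracketDr (yg2 n) g2 f2.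
    apply: filterS2 E1 E2 => t; rewrite !subrK /D => -> ->.
    rewrite ger0_norm ?normcR_ge0//.
    by rewrite addrA addrK normcR_triangle.
  rewrite RintegralD// mulrDl; apply: lerD.
    apply: le_trans (bracket_L1_le (xf2 n) (y2 n)) _.
    by rewrite mulrC ler_pM ?L2norm_ge0.
  apply: le_trans (bracket_L1_le f2 (yg2 n)) _.
  by rewrite ler_wpM2l ?L2norm_ge0.
apply: filterS (ae_cvg0_of_fast iD ID) => t Dt.
have sq (u : nat -> R) l : (forall n, `|u n - l| <= D n t) -> u @ \oo --> l.
  move=> uD; apply/cvgrPdist_lt => e e0; move/cvgrPdist_lt : Dt => /(_ e e0).
  apply: filterS => n; rewrite sub0r normrN distrC; apply: le_lt_trans.
  exact: le_trans (uD n) (ler_norm _).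
split; apply: sq => n.
- by rewrite -ReB le_Re_normc.
- by rewrite -ImB le_Im_normc.
Qed.

(** Here h is the Riesz representative in W of the functional sending g to the integral of a [f, g].
    Applied to the translates of g, which stay in W, the representation gives every Fourier
    coefficient of [h, g]. *)
Lemma bracket_multiplier (a : fct) (K : R) W f : cmeas a -> (forall t, normcR (a t) <= K) ->
  closed_subspace W -> shift_invariant W -> W f ->
  exists2 h, W h & forall g, L2 g -> {ae P, forall t, bracket h g t = a t * bracket f g t}.
Proof.
move=> ma aK clW sW Wf; have [W2 W0 WD WZ _] := clW; have f2 := W2 _ Wf.
have ic g : L2 g -> cintegrable P (fun t => a t * bracket f g t).
  by move=> g2; apply: (cintegrableMb ma aK); exact: cintegrable_bracket.
have K0 : 0 <= K by apply: le_trans (aK point); exact: normcR_ge0.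
pose L g := cint P (fun t => a t * bracket f g t).
have [|||h Wh hL] := @riesz _ _ W L (2 * K * (L2norm f ^+ 2 + 1)) clW.
- move=> g g' Wg Wg'; have g2 := W2 _ Wg; have g2' := W2 _ Wg'.
  rewrite /L -cintD; [|exact: ic|exact: ic]; apply: cint_ae_eq.
  + by apply: cintegrable_cmeas; apply: ic; exact: L2_add.
  + by apply: cintegrable_cmeas; apply: cintegrableD; exact: ic.
  + by apply: filterS (bracketDr g2 g2' f2) => t ->; rewrite mulrDr.
- move=> c g Wg; have g2 := W2 _ Wg.
  rewrite /L -cintZ; last exact: ic; apply: cint_ae_eq.
  + by apply: cintegrable_cmeas; apply: ic; exact: L2_scale.
  + by apply: cintegrable_cmeas; apply: cintegrableZ; exact: ic.
  + by apply: filterS (bracketZr c g2 f2) => t ->; rewrite mulrCA.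
- move=> g Wg; have g2 := W2 _ Wg.
  have ifg := cintegrable_normcR (cintegrable_bracket f2 g2).
  have iK : P.-integrable setT (EFin \o (fun t => K * normcR (bracket f g t))).
    by have := integrableZl measurableT K ifg; apply: eq_integrable.
  apply: (le_trans (normcR_cint_le (ic _ g2) iK _)).
    by apply: aeW => t; rewrite normcRM ler_wpM2r ?normcR_ge0.
  rewrite RintegralZl// -!mulrA ler_wpM2l// ler_wpM2l//.
  apply: le_trans (bracket_L1_le f2 g2) _.
  by move: (L2norm_ge0 f) (L2norm_ge0 g); move: (L2norm f) (L2norm g) => x y *; nra.
exists h => // g g2; have h2 := W2 _ Wh.
apply: bracket_unique => //; split; first exact: ic.
(* The representation only concerns elements of W. A general g is replaced by its projection q,
   which has the same inner products with W and the same bracket with f. *)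
move=> k; have [Wq gq] := orthogonal_projectionP clW g2; set q := orthogonal_projection W g in Wq gq.
have q2 := W2 _ Wq.
have perp w : W w -> << w, g >> = << w, q >>.
  move=> Ww; have w2 := W2 _ Ww; apply/eqP; rewrite -subr_eq0 -L2dotBr//.
  by rewrite L2dot_conj// ?gq// ?conjc0//; exact: L2_sub.
rewrite perp; last exact: sW.
rewrite L2dot_translateK// hL; last exact: sW.
have qk2 := L2_translate (oppk k) q2.
rewrite /L; apply: cint_ae_eq.
- by apply: cintegrable_cmeas; apply: cintegrable_mul_char; exact: ic.
- by apply: cintegrable_cmeas; exact: ic.
have E1 : {ae P, forall t, bracket f g t = bracket f q t}.
  apply: bracket_unique => //; have [i1 c1] := bracketP f2 q2; split => // l.
  by rewrite c1 perp//; exact: sW.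
have E2 := bracket_conj qk2 f2.
have E3 := bracket_translate (oppk k) q2 f2.
have E4 := bracket_conj q2 f2.
apply: filterS2 (filterI E1 E2) (filterI E3 E4) => t [-> ->] [-> ->].
by rewrite conjcM torus_charN conjcK; ring.
Qed.

End bracket_theory.

Local Open Scope sesquilinear_scope.

(** * Deflation of positive semidefinite matrices *)

Section deflation.
Context (C : numClosedFieldType).

Definition mform m (M : 'M[C]_m) (u w : 'rV[C]_m) : C := (u *m M *m w ^t*) 0 0.

Definition psdmx m (M : 'M[C]_m) := M ^t* = M /\ forall u, 0 <= mform M u u.

Lemma ctrmx_mul m n p (A : 'M[C]_(m, n)) (B : 'M[C]_(n, p)) :
  (A *m B) ^t* = B ^t* *m A ^t*.
Proof. by rewrite trmx_mul map_mxM. Qed.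

Lemma ctrmxD m n (A B : 'M[C]_(m, n)) : (A + B) ^t* = A ^t* + B ^t*.
Proof. by apply/matrixP => i j; rewrite !mxE rmorphD. Qed.

Lemma ctrmxB m n (A B : 'M[C]_(m, n)) : (A - B) ^t* = A ^t* - B ^t*.
Proof. by apply/matrixP => i j; rewrite !mxE rmorphB. Qed.

Lemma ctrmxZ m n c (A : 'M[C]_(m, n)) : (c *: A) ^t* = c^* *: A ^t*.
Proof. by apply/matrixP => i j; rewrite !mxE rmorphM. Qed.

Lemma mformBl m (M N : 'M[C]_m) u w : mform (M - N) u w = mform M u w - mform N u w.
Proof. by rewrite /mform mulmxBr mulmxBl !mxE. Qed.

Lemma mform_conj m (M : 'M[C]_m) u w : M ^t* = M -> mform M w u = (mform M u w)^*.
Proof.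
move=> hM; rewrite /mform -[in LHS]hM.
have -> : w *m M ^t* *m u ^t* = (u *m M *m w ^t*) ^t*.
  by rewrite !ctrmx_mul trmxCK mulmxA.
by rewrite !mxE.
Qed.

Lemma mformDl m (M : 'M[C]_m) u u' w : mform M (u + u') w = mform M u w + mform M u' w.
Proof. by rewrite /mform !mulmxDl !mxE. Qed.

Lemma mformZl m (M : 'M[C]_m) c u w : mform M (c *: u) w = c * mform M u w.
Proof. by rewrite /mform -!scalemxAl !mxE. Qed.

Lemma mformDr m (M : 'M[C]_m) u u' w : mform M w (u + u') = mform M w u + mform M w u'.
Proof. by rewrite /mform ctrmxD mulmxDr !mxE. Qed.

Lemma mformZr m (M : 'M[C]_m) c u w : mform M w (c *: u) = c^* * mform M w u.
Proof. by rewrite /mform ctrmxZ -scalemxAr !mxE. Qed.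

Lemma mform_shift m (M : 'M[C]_m) u w c : M ^t* = M ->
  mform M (u - c *: w) (u - c *: w) =
  mform M u u - c * (mform M u w)^* - c^* * mform M u w + `|c| ^+ 2 * mform M w w.
Proof.
move=> hM; rewrite -scaleNr !mformDl !mformDr !mformZl !mformZr.
rewrite (mform_conj u w hM) rmorphN normCK; ring.
Qed.

(** Nonnegativity at u minus its M-orthogonal projection on w. *)
Lemma psd_cauchy m (M : 'M[C]_m) u w : psdmx M -> 0 < mform M w w ->
  `|mform M u w| ^+ 2 / mform M w w <= mform M u u.
Proof.
move=> [hM pM] w0; set b := mform M u w; set c := mform M w w in w0 *.
have c0 : c != 0 by rewrite gt_eqF.
have cr : c^* = c by apply: CrealP; exact: gtr0_real.
have := pM (u - (b / c) *: w); rewrite mform_shift// -/b -/c.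
rewrite normrM exprMn normfV (gtr0_norm w0) rmorphM /= fmorphV /= cr normCK.
set X := mform M u u.
have -> : X - b / c * b^* - b^* / c * b + b * b^* * c^-1 ^+ 2 * c = X - b * b^* / c.
  by field.
by rewrite subr_ge0.
Qed.

Lemma psd_isotropic m (M : 'M[C]_m) u w : psdmx M -> mform M w w = 0 -> mform M u w = 0.
Proof.
move=> [hM pM] w0; set b := mform M u w; apply/eqP; rewrite -normr_eq0.
apply/negPn/negP => b0; have bp : 0 < `|b| ^+ 2 by rewrite exprn_gt0// lt_neqAle eq_sym b0 normr_ge0.
set X := mform M u u; have X0 : 0 <= X by exact: pM.
(* Since w is isotropic there is no quadratic term, and at u - s b w the form equals X - 2 (X + 1),
   which is negative. *)
pose s := (X + 1) / `|b| ^+ 2.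
have sr : s^* = s.
  by apply: CrealP; apply: ger0_real; rewrite divr_ge0 ?addr_ge0 ?ler01 ?(ltW bp).
have := pM (u - (s * b) *: w); rewrite mform_shift// -/b -/X w0 mulr0 addr0.
rewrite rmorphM /= sr.
have sb : s * (b * b^*) = X + 1 by rewrite -normCK /s divfK// gt_eqF.
have -> : X - s * b * b^* - s * b^* * b = - (X + 1 + 1).
  by transitivity (X - 2 * (s * (b * b^*))); [ring|rewrite sb; ring].
rewrite oppr_ge0 => /(lt_le_trans _); move=> /(_ 0); rewrite ltxx.
by move=> H; suff: false by []; apply: H; rewrite -addrA ltr_wpDl// addr_gt0// ltr01.
Qed.

Lemma mform_delta m (M : 'M[C]_m) w j : mform M w (delta_mx 0 j) = (w *m M) 0 j.
Proof.
rewrite /mform; move: (w *m M) => r; rewrite mxE (bigD1 j)//= !mxE !eqxx conjC1 mulr1.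
rewrite big1 ?addr0// => i /negbTE ij.
by rewrite !mxE ij andbF conjC0 mulr0.
Qed.

Lemma psd_neq0 m (M : 'M[C]_m) w : psdmx M -> w *m M != 0 -> 0 < mform M w w.
Proof.
move=> pM wM; rewrite lt_neqAle eq_sym pM.2 andbT; apply: contra_neq wM => w0.
apply/rowP => j; have := psd_isotropic (delta_mx 0 j) pM w0.
rewrite (mform_conj w _ pM.1) => /eqP; rewrite conjC_eq0 => /eqP.
by rewrite mform_delta => ->; rewrite mxE.
Qed.

Lemma rank1_form m (r u : 'rV[C]_m) : (u *m (r ^t* *m r) *m u ^t*) 0 0 = `|(u *m r ^t*) 0 0| ^+ 2.
Proof.
rewrite mulmxA -mulmxA mxE big_ord1; have -> : r *m u ^t* = (u *m r ^t*) ^t*.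
  by rewrite ctrmx_mul trmxCK.
by rewrite !mxE normCK.
Qed.

(** The generalized Schur complement of M along w: the part of the form that w explains is
    subtracted, leaving w in the kernel. *)
Definition schur_step m (M : 'M[C]_m) w :=
  M - (mform M w w)^-1 *: ((w *m M) ^t* *m (w *m M)).

Lemma mxtraceB m (A B : 'M[C]_m) : \tr (A - B) = \tr A - \tr B.
Proof. exact: raddfB. Qed.

Section schur.
Context (m : nat) (M : 'M[C]_m) (w : 'rV[C]_m).
Hypotheses (pM : psdmx M) (wM : w *m M != 0).
Let c := mform M w w.
Let c0 : 0 < c. Proof. exact: psd_neq0. Qed.
Let hM : M ^t* = M. Proof. by case: pM. Qed.
Let cr : c^* = c. Proof. by apply: CrealP; exact: gtr0_real. Qed.

Lemma schur_form u : mform (schur_step M w) u u = mform M u u - `|mform M u w| ^+ 2 / c.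
Proof.
rewrite /schur_step mformBl; congr (_ - _).
rewrite /mform -scalemxAr -scalemxAl mxE rank1_form mulrC; congr (`|_ 0 0| ^+ 2 / _).
by rewrite ctrmx_mul hM mulmxA.
Qed.

Lemma schur_psd : psdmx (schur_step M w).
Proof.
split; last first.
  by move=> u; rewrite schur_form subr_ge0; exact: psd_cauchy.
rewrite /schur_step ctrmxB ctrmxZ; move: (w *m M) => r; rewrite ctrmx_mul trmxCK hM.
congr (_ - _ *: _).
by apply: CrealP; rewrite realV; exact: gtr0_real.
Qed.

Lemma schur_le u : mform (schur_step M w) u u <= mform M u u.
Proof.
by rewrite schur_form lerBlDr lerDl divr_ge0 ?exprn_ge0// ltW.
Qed.

Lemma schur_kill_self : w *m schur_step M w = 0.
Proof.
rewrite /schur_step mulmxBr -scalemxAr (mulmxA w).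
have -> : w *m (w *m M) ^t* = (mform M w w)%:M.
  by rewrite ctrmx_mul hM mulmxA [LHS]mx11_scalar.
rewrite mul_scalar_mx scalerA.
by rewrite mulVf ?scale1r ?subrr// gt_eqF.
Qed.

Lemma schur_kill n (v : 'M[C]_(n, m)) : v *m M = 0 -> v *m schur_step M w = 0.
Proof.
move=> vM; rewrite /schur_step mulmxBr vM -scalemxAr (mulmxA v) ctrmx_mul hM (mulmxA v) vM.
by rewrite !mul0mx scaler0 subrr.
Qed.

(** The new kernel contains the kernel of M together with w, which was not in it. *)
Lemma schur_rank : (\rank (schur_step M w) < \rank M)%N.
Proof.
have kk : (kermx M <= kermx (schur_step M w))%MS.
  by apply/sub_kermxP; apply: schur_kill; exact: mulmx_ker.
have wk : (w <= kermx (schur_step M w))%MS by apply/sub_kermxP; exact: schur_kill_self.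
have lt : (\rank (kermx M) < \rank (kermx (schur_step M w)))%N.
  rewrite ltn_neqAle (mxrankS kk) andbT.
  apply: contra wM => /eqP req; have /mxrank_leqif_eq[_ eqk] := kk.
  move: (eqk); rewrite req eqxx => /esym/andP[_ kk'].
  by have /sub_kermxP -> := submx_trans wk kk'.
move: lt; rewrite !mxrank_ker; have := rank_leq_row M; have := rank_leq_row (schur_step M w).
lia.
Qed.

(** With r = w M the trace lost is |r|^2 / M(w, w). Since M(r, w) = |r|^2, Cauchy-Schwarz for M
    gives |r|^4 / M(w, w) <= M(r, r) <= lam |r|^2. *)
Lemma schur_trace lam : (forall u, mform M u u <= lam * (u *m u ^t*) 0 0) ->
  \tr M - lam <= \tr (schur_step M w).
Proof.
move=> Mlam; rewrite /schur_step mxtraceB lerD2l lerN2 mxtraceZ mxtrace_mulC.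
rewrite [\tr _]trace_mx11; set r := w *m M; set n := (r *m r ^t*) 0 0.
have n0 : 0 < n.
  rewrite lt_neqAle eq_sym; have n0 : 0 <= n.
    by rewrite /n mxE sumr_ge0// => i _; rewrite !mxE -normCK exprn_ge0.
  rewrite n0 andbT; apply: contra_neq wM => nz; apply/rowP => j; rewrite [RHS]mxE.
  have := nz; rewrite /n mxE => /eqP; rewrite psumr_eq0 => [/allP /(_ j)|i _]; last first.
    by rewrite !mxE -normCK exprn_ge0.
  by rewrite mem_index_enum => /(_ isT); rewrite /= !mxE mulf_eq0 conjC_eq0 orbb => /eqP; rewrite -/r.
have Er : mform M r w = n by rewrite /mform /n /r ctrmx_mul hM !mulmxA.
have := psd_cauchy r pM c0; rewrite Er (gtr0_norm n0) => /le_trans /(_ (Mlam r)).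
rewrite -/n expr2 -mulrA [lam * n]mulrC ler_pM2l// mulrC; exact.
Qed.

End schur.

(* If G = 0 the vector v is unconstrained, except for lam *: v = 0. *)
Definition top_eigen m (G : 'M[C]_m) (v : 'rV[C]_m) (lam : C) :=
  [/\ G = 0 \/ v *m v ^t* = 1%:M, v *m G = lam *: v,
      forall u, mform G u u <= lam * (u *m u ^t*) 0 0 & 0 <= lam].

Definition deflation m (G G1 : 'M[C]_m) :=
  exists v lam, top_eigen G v lam /\ G1 = G - lam *: (v ^t* *m v).

Fixpoint deflations m n (G H : 'M[C]_m) :=
  if n is n'.+1 then exists2 G1, deflation G G1 & deflations n' G1 H else G = H.

Lemma psdmx0 m : psdmx (0 : 'M[C]_m).
Proof.
split; first by apply/matrixP => i j; rewrite !mxE conjC0.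
by move=> u; rewrite /mform mulmx0 mul0mx mxE.
Qed.

Lemma psd_trace_ge0 m (M : 'M[C]_m) : psdmx M -> 0 <= \tr M.
Proof.
move=> [_ pM]; apply: sumr_ge0 => i _; have := pM (delta_mx 0 i).
by rewrite mform_delta -rowE mxE.
Qed.

Lemma psdmx_eq0 m (M : 'M[C]_m) : psdmx M -> (forall u, mform M u u <= 0) -> M = 0.
Proof.
move=> pM M0; apply/row_matrixP => i; rewrite rowE [RHS]rowE mulmx0.
apply/eqP/negPn/negP => /(psd_neq0 pM) /lt_le_trans /(_ (M0 _)).
by rewrite ltxx.
Qed.

Lemma mulmx_neq0_row m (M : 'M[C]_m) : M != 0 -> exists w : 'rV_m, w *m M != 0.
Proof.
move=> M0; apply: contrapT => H; move/negP: M0; apply; apply/eqP/row_matrixP => i.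
rewrite rowE [RHS]rowE mulmx0; apply/eqP/negPn/negP => D; apply: H; eexists; exact: D.
Qed.

Section deflation_step.
Context (m : nat) (G : 'M[C]_m) (v : 'rV[C]_m) (lam : C).
Hypotheses (pG : psdmx G) (v1 : v *m v ^t* = 1%:M) (vG : v *m G = lam *: v)
  (Glam : forall u, mform G u u <= lam * (u *m u ^t*) 0 0) (lam0 : 0 <= lam).

Let G1 := G - lam *: (v ^t* *m v).
Let coef (u : 'rV[C]_m) := (u *m v ^t*) 0 0.
Let lamr : lam^* = lam. Proof. by apply: CrealP; exact: ger0_real. Qed.

(** The deflated form is G evaluated on the component of u orthogonal to v, the mixed terms
    vanishing because v is an eigenvector. *)
Lemma deflation_form u : mform G1 u u = mform G (u - coef u *: v) (u - coef u *: v).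
Proof.
have Gvu : mform G v u = lam * (coef u)^*.
  rewrite /mform vG -scalemxAl mxE /coef; congr (_ * _).
  have -> : v *m u ^t* = (u *m v ^t*) ^t* by rewrite ctrmx_mul trmxCK.
  by rewrite !mxE.
have Guv : mform G u v = lam * coef u.
  by rewrite (mform_conj v u pG.1) Gvu rmorphM /= lamr conjCK.
have Gvv : mform G v v = lam.
  by rewrite /mform vG -scalemxAl v1 !mxE eqxx mulr1.
rewrite (mform_shift _ _ _ pG.1) Guv Gvv rmorphM /= lamr mformBl.
rewrite {2}/mform -scalemxAr -scalemxAl mxE rank1_form -/(coef u) normCK; ring.
Qed.

Lemma deflation_psd : psdmx G1.
Proof.
split; last by move=> u; rewrite deflation_form; exact: pG.2.
by rewrite /G1 ctrmxB ctrmxZ ctrmx_mul trmxCK pG.1 lamr.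
Qed.

Lemma deflation_trace : \tr G1 = \tr G - lam.
Proof.
by rewrite /G1 mxtraceB mxtraceZ mxtrace_mulC v1 mxtrace1 mulr1.
Qed.

(** Once v is in the kernel of M', the value of M' at u depends only on the component of u
    orthogonal to v, where M' <= M <= G and G agrees with G1. *)
Lemma deflation_competitor n (M : 'M[C]_m) : psdmx M ->
  (forall u, mform M u u <= mform G u u) -> (\rank M <= n.+1)%N ->
  exists M', [/\ psdmx M', forall u, mform M' u u <= mform G1 u u, (\rank M' <= n)%N &
    \tr M - lam <= \tr M'].
Proof.
move=> pM MG rM; have [M0|M0] := eqVneq M 0.
  exists 0; rewrite mxrank0 M0 mxtrace0 sub0r oppr_le0; split => //.
  - exact: psdmx0.
  - by move=> u; rewrite {1}/mform mulmx0 mul0mx mxE; apply: deflation_psd.2.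
(* Take w = v when v M is nonzero. Otherwise v is already killed by M, stays killed, and any w with
   w M nonzero lowers the rank. *)
have [w [wM vw]] : exists w, w *m M != 0 /\ v *m schur_step M w = 0.
  have [vM|vM] := eqVneq (v *m M) 0.
    by have [w wM] := mulmx_neq0_row M0; exists w; split => //; exact: schur_kill.
  by exists v; split => //; exact: schur_kill_self.
have pS := schur_psd pM wM.
exists (schur_step M w); split => //.
- move=> u; rewrite deflation_form; apply: le_trans (MG _).
  apply: le_trans (schur_le pM wM _); rewrite (mform_shift _ _ _ pS.1).
  have z y : mform (schur_step M w) v y = 0 by rewrite /mform vw !mul0mx mxE.
  by rewrite (mform_conj v u pS.1) !z conjC0 !mulr0 addr0 !subr0 conjC0 mulr0 subr0.
- by have := schur_rank pM wM; lia.
- by apply: (schur_trace pM wM) => u; exact: le_trans (MG u) (Glam u).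
Qed.

End deflation_step.

(* Eckart-Young: at each step the competitor M is replaced by a Schur complement
   which is killed by v, has smaller rank and loses at most lam in trace. *)
Lemma deflations_trace m n (G M H : 'M[C]_m) : psdmx G -> psdmx M ->
  (forall u, mform M u u <= mform G u u) -> (\rank M <= n)%N ->
  deflations n G H -> \tr H <= \tr G - \tr M.
Proof.
elim: n G M => [|n IH] G M pG pM MG.
  by rewrite leqn0 mxrank_eq0 => /eqP -> <-; rewrite mxtrace0 subr0.
move=> rM [G1 [v [lam [[[G0|v1] vG Glam lam0] G1E]]] GH].
  (* For G = 0 the vector v may fail to be a unit vector, but then M = 0, and lam v = 0 makes the
     deflation trivial. *)
  have M0 : M = 0.
    by apply: psdmx_eq0 => // u; rewrite (le_trans (MG u))// G0 /mform mulmx0 mul0mx mxE.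
  have G10 : G1 = 0.
    rewrite G1E G0 scalemxAr; move: vG; rewrite G0 mulmx0 => <-.
    by rewrite mulmx0 subr0.
  have p0 := psdmx0 m; move: GH; rewrite G0 M0 G10; apply: IH => //.
  by rewrite mxrank0.
have [M' [pM' MG' rM' tM']] := deflation_competitor pG v1 vG Glam lam0 pM MG rM.
rewrite -G1E in MG'; have := IH _ _ _ pM' MG' rM' GH => IH'.
have pG1 : psdmx G1 by rewrite G1E; exact: deflation_psd.
apply: le_trans (IH' pG1) _; rewrite G1E deflation_trace//.
by rewrite -addrA lerD2l -opprD lerN2 -lerBlDl.
Qed.

End deflation.

(** * Lower semicontinuity of the rank *)

Section matrix_limits.
Context (R : realType).

Lemma mxrank_ge_id (F : fieldType) s m (M : 'M[F]_m) : (s <= \rank M)%N ->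
  exists X Y, X *m M *m Y = 1%:M :> 'M[F]_s.
Proof.
move=> sM; exists (pid_mx s *m invmx (col_ebase M)), (invmx (row_ebase M) *m pid_mx s).
rewrite -{2}(mulmx_ebase M) !mulmxA mulmxKV ?col_ebase_unit//.
rewrite mulmxK ?row_ebase_unit// !mul_pid_mx.
have := rank_leq_row M => rm.
rewrite (_ : minn _ _ = s); first exact: pid_mx_1.
by lia.
Qed.

Definition mxcvg m n (Mk : nat -> 'M[R[i]]_(m, n)) (M : 'M[R[i]]_(m, n)) :=
  forall i j, ccvg (fun k => Mk k i j) (M i j).

Lemma mxcvg_cst m n (M : 'M[R[i]]_(m, n)) : mxcvg (fun=> M) M.
Proof. by move=> i j; exact: ccvg_cst. Qed.

Lemma mxcvgM m n p (Ak : nat -> 'M[R[i]]_(m, n)) A (Bk : nat -> 'M[R[i]]_(n, p)) B :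
  mxcvg Ak A -> mxcvg Bk B -> mxcvg (fun k => Ak k *m Bk k) (A *m B).
Proof.
move=> cA cB i j; rewrite mxE; under eq_fun do rewrite mxE.
by apply: (@ccvg_sum R _ _ (fun l k => Ak k i l * Bk k l j)) => l; exact: ccvgM.
Qed.

Lemma mxcvg_det m (Ak : nat -> 'M[R[i]]_m) A : mxcvg Ak A ->
  ccvg (fun k => \det (Ak k)) (\det A).
Proof.
move=> cA; apply: (@ccvg_sum R _ _ (fun (s : {perm 'I_m}) k => (-1) ^+ s * \prod_i Ak k i (s i))) => s.
apply: ccvgM; first exact: ccvg_cst.
by apply: (@ccvg_prod R _ _ (fun i k => Ak k i (s i))) => i.
Qed.

(** If M had rank above s, some X M Y would be the identity of size s + 1. The determinants of X Mk
    Y are all 0, yet they would tend to 1. *)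
Lemma mxrank_lim s m (Mk : nat -> 'M[R[i]]_m) M : mxcvg Mk M ->
  (forall k, (\rank (Mk k) <= s)%N) -> (\rank M <= s)%N.
Proof.
move=> cM rM; rewrite leqNgt; apply/negP => /mxrank_ge_id[X [Y XMY]].
have := mxcvg_det (mxcvgM (mxcvgM (mxcvg_cst X) cM) (mxcvg_cst Y)).
rewrite XMY det1 (_ : (fun k => _) = fun=> 0).
  by move=> /ccvg_unique /(_ (ccvg_cst 0)) /eqP; rewrite oner_eq0.
apply/funext => k; apply/eqP/negPn; rewrite -unitfE -unitmxE.
apply/negP => /mxrank_unit r1.
have : (\rank (X *m Mk k *m Y) <= s)%N.
  by apply: leq_trans (rM k); rewrite (leq_trans (mxrankM_maxl _ _))// mxrankM_maxr.
by rewrite r1 ltnn.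
Qed.

End matrix_limits.

(** * Measurable top eigenvectors *)

Section power_iteration.
Context (R : realType).

(** The iteration starts at G, so this is the power of exponent k + 1. *)
Definition mpow (C : nzSemiRingType) m (G : 'M[C]_m) k := iter k (mulmx G) G.

(** After division by the largest value, each ratio is 1 or has powers tending to 0; the limiting
    denominator counts the maximal entries and so is nonzero. *)
Lemma cvg_power_ratio m (d : 'I_m -> R) (i0 : 'I_m) : (forall i, 0 <= d i <= d i0) -> 0 < d i0 ->
  forall i, (fun k => d i ^+ k.+1 / \sum_j d j ^+ k.+1) @ \oo -->
    ((d i == d i0)%:R / (\sum_j (d j == d i0)%:R) : R).
Proof.
move=> dle l0 i; set l := d i0 in dle l0 *.
have cq j : (fun k => (d j / l) ^+ k.+1) @ \oo --> ((d j == l)%:R : R).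
  have /andP[dj0 djl] := dle j.
  have q0 : 0 <= d j / l by rewrite divr_ge0// ltW.
  have [E|ne] := eqVneq (d j) l.
    by rewrite E divff ?gt_eqF//; under eq_fun do rewrite expr1n; exact: cvg_cst.
  have q1 : `|d j / l| < 1 by rewrite ger0_norm// ltr_pdivrMr// mul1r lt_neqAle ne.
  by have := cvg_expr q1; rewrite -(cvg_shiftS (GRing.exp (d j / l))).
have cs : (fun k => \sum_j (d j / l) ^+ k.+1) @ \oo --> (\sum_j (d j == l)%:R : R).
  by apply: cvg_big => [|j _]; [exact: add_continuous|exact: cq].
have s0 : \sum_j (d j == l)%:R != 0 :> R.
  rewrite (bigD1 i0)//= eqxx gt_eqF// ltr_pwDl// sumr_ge0// => j _.
rewrite (_ : (fun k => _) = (fun k => (d i / l) ^+ k.+1 * (\sum_j (d j / l) ^+ k.+1)^-1)).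
  by apply: cvgM; [exact: cq|exact: cvgV].
apply/funext => k; have lk : l ^+ k.+1 != 0 by rewrite expf_neq0// gt_eqF.
have -> : \sum_j (d j / l) ^+ k.+1 = (\sum_j d j ^+ k.+1) / l ^+ k.+1.
  by rewrite mulr_suml; apply: eq_bigr => j _; rewrite expr_div_n.
by rewrite expr_div_n invf_div mulrA divfK.
Qed.

Lemma psd_spectral m (G : 'M[R[i]]_m) : psdmx G -> exists (U : 'M[R[i]]_m) (d : 'I_m -> R),
  [/\ U *m U ^t* = 1%:M, U ^t* *m U = 1%:M, forall i, 0 <= d i &
    G = U ^t* *m diag_mx (\row_i ((d i)%:C)%C) *m U].
Proof.
move=> [hG pG]; have hm : G \is hermsymmx.
  by apply/is_hermitianmxP; rewrite expr0 scale1r hG.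
have /orthomx_spectralP := hermitian_normalmx hm; have := spectral_unitarymx G.
move: (spectralmx G) (spectral_diag G) => U D Uu; rewrite invmx_unitary// => GE.
have UU : U *m U ^t* = 1%:M by apply/unitarymxP.
have D0 i : 0 <= D 0 i.
  have := pG (row i U); rewrite /mform rowE GE !mulmxA.
  rewrite -(mulmxA (delta_mx 0 i)) UU mulmx1 ctrmx_mul mulmxA -(mulmxA _ U) UU mulmx1.
  by rewrite -/(mform _ _ _) mform_delta -rowE !mxE eqxx.
exists U, (fun i => ReC (D 0 i)); split => //.
- exact: mulmx1C.
- by move=> i; have := D0 i; rewrite lecE => /andP[].
- rewrite {1}GE; apply: (congr1 (fun x => U ^t* *m diag_mx x *m U)).
  apply/rowP => i; rewrite mxE.
  have := D0 i; rewrite lecE => /andP[/eqP im _].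
  by apply: complexP; rewrite //= im.
Qed.

Lemma power_limit m (G : 'M[R[i]]_m) : psdmx G -> G != 0 -> exists (A : 'M[R[i]]_m) lam,
  [/\ mxcvg (fun k => (\tr (mpow G k))^-1 *: mpow G k) A, A != 0, A *m G = lam *: A,
    forall u, mform G u u <= lam * (u *m u ^t*) 0 0 & 0 <= lam].
Proof.
move=> pG G0; have [U [d [UU UU' d0 GE]]] := psd_spectral pG.
have [i1 d1] : exists i1, 0 < d i1.
  apply: contrapT => H; move/negP: G0; apply; rewrite GE.
  rewrite (_ : \row_i _ = 0) ?linear0 ?mulmx0 ?mul0mx//.
  apply/rowP => i; rewrite !mxE; apply: complexP => //=.
  apply/eqP; rewrite eq_le d0 andbT leNgt; apply/negP => di; apply: H; by exists i.
have [i0 di0] : exists i0, forall i, d i <= d i0.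
  by case: (@arg_maxP _ _ _ i1 xpredT d) => // i0 _ H; exists i0 => i; exact: H.
have dle i : 0 <= d i <= d i0 by rewrite d0 di0.
have l0 : 0 < d i0 := lt_le_trans d1 (di0 i1).
pose e i : R := (d i == d i0)%:R / (\sum_j (d j == d i0)%:R).
have ce := cvg_power_ratio dle l0.
pose E := \row_i ((e i)%:C)%C : 'rV[R[i]]_m.
have diagM (x y : 'rV[R[i]]_m) : (U ^t* *m diag_mx x *m U) *m (U ^t* *m diag_mx y *m U) =
    U ^t* *m diag_mx (\row_i (x 0 i * y 0 i)) *m U.
  rewrite -mulmx_diag -!mulmxA (mulmxA U) UU mul1mx.
  by [].
have powC (x y : 'rV[R[i]]_m) : (forall i, x 0 i = y 0 i) ->
    U ^t* *m diag_mx x *m U = U ^t* *m diag_mx y *m U by move=> /rowP ->.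
have powE k : mpow G k = U ^t* *m diag_mx (\row_i ((d i ^+ k.+1)%:C)%C) *m U.
  elim: k => [|k IH].
    by rewrite [LHS]GE; apply: powC => i; rewrite mxE.
  rewrite /mpow iterS -/(mpow G k) IH {1}GE diagM.
  apply: powC => i; rewrite !mxE.
  by rewrite [in RHS]exprS; apply: complexP => /=; ring.
have trE k : \tr (mpow G k) = ((\sum_i d i ^+ k.+1)%:C)%C.
  rewrite powE mxtrace_mulC mulmxA UU mul1mx mxtrace_diag.
  apply: complexP; rewrite ?Re_sum ?Im_sum /=; first by apply: eq_bigr => i _; rewrite mxE.
  by rewrite big1// => i _; rewrite mxE.
exists (U ^t* *m diag_mx E *m U), ((d i0)%:C)%C; split.
- rewrite (_ : (fun k => _) = fun k => U ^t* *m
      diag_mx (\row_i ((d i ^+ k.+1 / \sum_j d j ^+ k.+1)%:C)%C) *m U).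
    apply: mxcvgM (mxcvg_cst _); apply: mxcvgM (mxcvg_cst _) _ => i j.
    under eq_fun do rewrite !mxE; rewrite !mxE.
    case: (i == j); rewrite ?mulr1n ?mulr0n; last exact: ccvg_cst.
    by split; [exact: ce|exact: cvg_cst].
  apply/funext => k; rewrite trE powE scalemxAl scalemxAr -linearZ /=.
  apply: powC => i; rewrite !mxE.
  rewrite -fmorphV -rmorphM /= mulrC; congr (_%:C)%C.
- apply/negP => /eqP AE; have : U *m (U ^t* *m diag_mx E *m U) *m U ^t* = diag_mx E.
    by rewrite !mulmxA UU mul1mx -mulmxA UU mulmx1.
  rewrite AE mulmx0 mul0mx => /matrixP /(_ i0 i0); rewrite !mxE eqxx mulr1n.
  move=> /(congr1 (fun z : R[i] => ReC z)) /= /esym /eqP; rewrite /e eqxx mul1r invr_eq0.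
  by rewrite (bigD1 i0)//= eqxx gt_eqF// ltr_pwDl// sumr_ge0// => j _.
- rewrite {1}GE diagM.
  rewrite scalemxAl scalemxAr -linearZ /=; apply: powC => i; rewrite !mxE.
  rewrite -!rmorphM /= /e; congr (_%:C)%C.
  by have [->|] := eqVneq (d i) (d i0); rewrite ?mul0r ?mulr0// mulrC.
- move=> u; rewrite /mform GE !mulmxA -(mulmxA _ U).
  have -> : U *m u ^t* = (u *m U ^t*) ^t* by rewrite ctrmx_mul trmxCK.
  have -> : u *m u ^t* = (u *m U ^t*) *m (u *m U ^t*) ^t*.
    by rewrite ctrmx_mul trmxCK mulmxA -(mulmxA u) UU' mulmx1.
  move: (u *m U ^t*) => y; rewrite !mxE mulr_sumr; apply: ler_sum => i _.
  rewrite mul_mx_diag !mxE -normCK mulrAC -normCK mulrC ler_wpM2r ?exprn_ge0//.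
  by rewrite lecR.
- by rewrite ler0c.
Qed.

End power_iteration.

Section normalized_row.
Context (R : realType).

Definition row_sqnorm m (A : 'M[R[i]]_m) j : R := ReC (\sum_b A j b * conjc (A j b)).

Definition row_scale m (A : 'M[R[i]]_m) j : R := row_sqnorm A j `^ (- 2^-1).

(* Selects the first nonzero row of A and normalizes it; written without case
   analysis ([0 `^ (-1/2)] is [0]) so that it is measurable in the entries. *)
Definition normalized_row m (A : 'M[R[i]]_m) : 'rV[R[i]]_m :=
  \row_b \sum_(j < m) (\prod_(i < m)
    (if (i < j)%N then 1 - ((row_scale A i ^+ 2 * row_sqnorm A i)%:C)%C else 1))
    * ((row_scale A j)%:C)%C * A j b.

Lemma row_sqnormE m (A : 'M[R[i]]_m) j :
  \sum_b A j b * conjc (A j b) = ((row_sqnorm A j)%:C)%C.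
Proof.
apply: complexP => //=; rewrite Im_sum big1// => b _.
by rewrite mulc_conj.
Qed.

Lemma row_sqnorm_ge0 m (A : 'M[R[i]]_m) j : 0 <= row_sqnorm A j.
Proof.
by rewrite /row_sqnorm Re_sum sumr_ge0// => b _; rewrite mulc_conj /= sqr_ge0.
Qed.

Lemma row_sqnorm_eq0 m (A : 'M[R[i]]_m) j : row_sqnorm A j = 0 -> forall b, A j b = 0.
Proof.
rewrite /row_sqnorm Re_sum => /eqP; rewrite psumr_eq0 => [|b _]; last first.
  by rewrite mulc_conj /= sqr_ge0.
move=> /allP H b; have := H b; rewrite mem_index_enum => /(_ isT) /=.
by rewrite mulc_conj /= sqrf_eq0 => /eqP /Normc.eq0_normc.
Qed.

Lemma row_scale0 m (A : 'M[R[i]]_m) j : row_sqnorm A j = 0 -> row_scale A j = 0.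
Proof. by rewrite /row_scale => ->; rewrite powR0// oppr_eq0 invr_eq0. Qed.

Lemma row_scaleK m (A : 'M[R[i]]_m) j : row_sqnorm A j != 0 ->
  row_scale A j ^+ 2 * row_sqnorm A j = 1.
Proof.
move=> n0; rewrite /row_scale -powR_mulrn ?powR_ge0// -powRrM mulNr mulVf// powR_inv1 ?row_sqnorm_ge0//.
by rewrite mulVf.
Qed.

Lemma normalized_row0 m : normalized_row (0 : 'M[R[i]]_m) = 0.
Proof.
by apply/rowP => b; rewrite !mxE big1// => j _; rewrite mxE mulr0.
Qed.

Lemma normalized_row_unit m (A : 'M[R[i]]_m) : A != 0 ->
  exists j (c : R), normalized_row A = (c%:C)%C *: row j A /\
    normalized_row A *m (normalized_row A) ^t* = 1%:M.
Proof.
move=> A0; have [j1 nj1] : exists j, row_sqnorm A j != 0.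
  apply: contrapT => H; move/negP: A0; apply; apply/eqP/matrixP => i b; rewrite mxE.
  by apply: row_sqnorm_eq0; apply/eqP/negPn/negP => n0; apply: H; exists i.
case: (@arg_minnP _ j1 (fun j => row_sqnorm A j != 0) (fun j => val j) nj1) => j nj jmin.
(* Zero rows have scale 0 and contribute a factor 1 to the product. The first nonzero row j
   contributes 1 - 1 = 0 to every later term, so only the term of j survives. *)
have E : normalized_row A = ((row_scale A j)%:C)%C *: row j A.
  apply/rowP => b; rewrite !mxE (bigD1 j)//= big1 ?mul1r => [|i _]; last first.
    case: ifP => // ij; have [n0|/jmin] := eqVneq (row_sqnorm A i) 0; last by rewrite leqNgt ij.
    by rewrite n0 mulr0 subr0.
  rewrite big1 ?addr0// => i ij; have [ltij|leji] := ltnP i j.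
    have [n0|/jmin] := eqVneq (row_sqnorm A i) 0; last by rewrite leqNgt ltij.
    by rewrite row_scale0// mulr0 mul0r.
  rewrite (bigD1 j)//= ltn_neqAle leji andbT eq_sym ij row_scaleK// subrr.
  by rewrite !mul0r.
exists j, (row_scale A j); split => //.
rewrite E ctrmxZ -scalemxAl -scalemxAr scalerA; apply/rowP => k; rewrite !ord1 !mxE eqxx.
have -> : \sum_b row j A 0 b * (row j A)^t* b 0 = ((row_sqnorm A j)%:C)%C.
  by rewrite -row_sqnormE; apply: eq_bigr => b _; rewrite !mxE.
have -> : ((row_scale A j)%:C%C)^* = ((row_scale A j)%:C%C) by apply: complexP => //=; rewrite oppr0.
by rewrite -!rmorphM /= -expr2 row_scaleK.
Qed.

End normalized_row.

Section measurable_eigenvector.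
Context (R : realType) d (T : measurableType d).

Definition mxmeas m n (A : T -> 'M[R[i]]_(m, n)) := forall i j, cmeas (fun t => A t i j).

Lemma mxmeasM m n p (A : T -> 'M[R[i]]_(m, n)) (B : T -> 'M[R[i]]_(n, p)) :
  mxmeas A -> mxmeas B -> mxmeas (fun t => A t *m B t).
Proof.
move=> mA mB i j; under eq_fun do rewrite mxE.
by apply: cmeas_sum => k; exact: cmeasM.
Qed.

Lemma cmeas_ccvg (f : nat -> T -> R[i]) g : (forall k, cmeas (f k)) ->
  (forall t, ccvg (f ^~ t) (g t)) -> cmeas g.
Proof.
move=> mf fg; split.
- by apply: (measurable_fun_cvg (h := fun k t => ReC (f k t))) => [k|t _];
    [case: (mf k)|case: (fg t)].
- by apply: (measurable_fun_cvg (h := fun k t => ImC (f k t))) => [k|t _];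
    [case: (mf k)|case: (fg t)].
Qed.

(** The inverse is expressed by a real power, which is measurable on the whole line including at
    0. *)
Lemma cmeasV_real (f : T -> R[i]) : cmeas f -> (forall t, 0 <= f t) -> cmeas (fun t => (f t)^-1).
Proof.
move=> [mf _] f0; rewrite (_ : (fun t => _) = fun t => ((ReC (f t) `^ (-1))%:C)%C).
  by apply: cmeas_real; apply: (measurableT_comp (@measurable_powR R (-1))) mf.
apply/funext => t; have := f0 t; rewrite lecE => /andP[/eqP im re].
rewrite powR_inv1// (_ : f t = ((ReC (f t))%:C)%C); last by apply: complexP.
by rewrite fmorphV.
Qed.

Lemma mxmeas_normalized_row m (A : T -> 'M[R[i]]_m) : mxmeas A ->
  mxmeas (fun t => normalized_row (A t)).
Proof.
move=> mA i b; under eq_fun do rewrite mxE; apply: cmeas_sum => j.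
have mn k : measurable_fun setT (fun t => row_sqnorm (A t) k).
  by apply: (proj1 (cmeas_sum _ _)) => c; apply: cmeasM => //; exact: cmeas_conj.
have ms k : measurable_fun setT (fun t => row_scale (A t) k).
  by apply: (measurableT_comp (@measurable_powR R (- 2^-1))) (mn k).
apply: cmeasM => //; apply: cmeasM; last exact: cmeas_real.
apply: cmeas_prod => k; case: (k < j)%N; last exact: cmeas_cst.
apply: cmeasB; first exact: cmeas_cst.
by apply: cmeas_real; apply: measurable_funM => //; exact: measurable_funX.
Qed.

Lemma mxmeas_mpow m (G : T -> 'M[R[i]]_m) k : mxmeas G -> mxmeas (fun t => mpow (G t) k).
Proof. by move=> mG; elim: k => [|k IH] //; exact: mxmeasM. Qed.

Lemma mpow_trace_ge0 m (G : 'M[R[i]]_m) k : psdmx G -> 0 <= \tr (mpow G k).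
Proof.
move=> pG; apply: psd_trace_ge0.
(* Two consecutive powers are carried along because G^(k+2) = G G^k G inherits positivity from
   G^k. *)
suff : psdmx (mpow G k) /\ psdmx (mpow G k.+1) by case.
have hpow l : (mpow G l) ^t* = mpow G l /\ mpow G l *m G = G *m mpow G l.
  elim: l => [|l [IH1 IH2]]; first by case: pG.
  rewrite /mpow iterS -/(mpow G l) ctrmx_mul IH1 pG.1 IH2; split => //.
  by rewrite -mulmxA IH2.
elim: k => [|k [IH1 IH2]].
  split; [exact: pG|split=> [|u]; first exact: (hpow 1%N).1].
  rewrite /mform (_ : _ *m _ = (u *m G) *m (u *m G) ^t*); last first.
    by rewrite ctrmx_mul pG.1 !mulmxA.
  by rewrite mxE sumr_ge0// => i _; rewrite !mxE -normCK exprn_ge0.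
split; [exact: IH2|split=> [|u]; first exact: (hpow _).1].
have := IH1.2 (u *m G); rewrite /mform ctrmx_mul pG.1.
by rewrite !mulmxA -(mulmxA (u *m G)) (hpow k).2 !mulmxA.
Qed.

(** The limit A of the normalized powers is measurable as a pointwise limit, and A G = lam A makes
    each of its rows a left eigenvector. Where G = 0 the powers vanish, so A and v are 0. The bound
    on the entries lets each of them act as a bracket multiplier. *)
Lemma measurable_top_eigen m (G : T -> 'M[R[i]]_m) : mxmeas G -> (forall t, psdmx (G t)) ->
  exists v : T -> 'rV[R[i]]_m, [/\ mxmeas v, forall t j, normcR (v t 0 j) <= 1 &
    forall t, exists lam, top_eigen (G t) (v t) lam].
Proof.
move=> mG pG.
have HA t : exists A : 'M[R[i]]_m, [/\ mxcvg (fun k => (\tr (mpow (G t) k))^-1 *: mpow (G t) k) A,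
    G t = 0 -> A = 0 & G t != 0 -> A != 0 /\ exists lam, [/\ A *m G t = lam *: A,
    forall u, mform (G t) u u <= lam * (u *m u ^t*) 0 0 & 0 <= lam]].
  have [G0|G0] := eqVneq (G t) 0.
    exists 0; split => //; rewrite G0 (_ : (fun k => _) = fun=> 0); first exact: mxcvg_cst.
    by apply/funext => -[|k]; rewrite /mpow ?iterS ?mul0mx scaler0.
  have [A [lam [cA A0 AG Gl l0]]] := power_limit (pG t) G0.
  by exists A; split => // [G0'|_]; [rewrite G0' eqxx in G0|split => //; exists lam].
have [A HA'] := choice HA.
have mA : mxmeas A.
  move=> i j; apply: (@cmeas_ccvg (fun k t => ((\tr (mpow (G t) k))^-1 *: mpow (G t) k) i j)).
    move=> k; under eq_fun do rewrite mxE; apply: cmeasM; last exact: mxmeas_mpow.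
    apply: cmeasV_real => [|t]; last exact: mpow_trace_ge0.
    by apply: cmeas_sum => l; exact: mxmeas_mpow.
  by move=> t; case: (HA' t) => + _ _; exact.
have Hv t : exists lam, top_eigen (G t) (normalized_row (A t)) lam /\
    (normalized_row (A t) = 0 \/ normalized_row (A t) *m (normalized_row (A t)) ^t* = 1%:M).
  have [cA A0 A1] := HA' t; have [G0|/A1[{}A1 [lam [AG Gl l0]]]] := eqVneq (G t) 0.
    exists 0; rewrite A0// normalized_row0; split; last by left.
    split => //; first by left.
    - by rewrite mul0mx scaler0.
    - by move=> u; rewrite G0 /mform mulmx0 mul0mx mxE mul0r.
  have [j [c [vE v1]]] := normalized_row_unit A1; exists lam; split; last by right.
  split => //; first by right.
  by rewrite vE -scalemxAl -row_mul AG scalerA linearZ/= scalerA mulrC.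
exists (fun t => normalized_row (A t)); split.
- exact: mxmeas_normalized_row.
- move=> t j; have [_ [_ [->|]]] := Hv t; first by rewrite mxE Normc.normc0.
  move: (normalized_row _) => v /matrixP /(_ 0 0); rewrite !mxE eqxx mulr1n.
  move=> /(congr1 (fun z : R[i] => ReC z)) /=; rewrite Re_sum (bigD1 j)//= !mxE.
  rewrite [v 0 j * _]mulc_conj /= => E.
  rewrite -(@expr_le1 _ 2)// ?normcR_ge0// -E lerDl sumr_ge0// => i _.
  by rewrite !mxE [v 0 i * _]mulc_conj /= sqr_ge0.
- by move=> t; have [lam []] := Hv t; exists lam.
Qed.

End measurable_eigenvector.

(** * Optimal spaces *)

Section gram.
Context (R : realType) (d : nat) (P : {finite_measure set (Rd R d) -> \bar R}).
Local Notation mu := (lebesgueX R d).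
Local Notation fct := (Rd R d -> R[i]).
Local Notation "<< f , g >>" := (L2dot f g).
Local Notation tc := (@torus_char R d).
Hypothesis Pk : forall k, cint P (tc k) = (k == zerok d)%:R.
Hypothesis Pu : forall h, cintegrable P h ->
  (forall k, cint P (fun t => h t * tc k t) = 0) -> {ae P, forall t, h t = 0}.
Local Notation br := (bracket P).

Definition gram m (F : 'I_m -> fct) t : 'M[R[i]]_m := \matrix_(i, j) br (F i) (F j) t.

Lemma bracketBl f g h : L2 f -> L2 g -> L2 h ->
  {ae P, forall t, br (f - g) h t = br f h t - br g h t}.
Proof.
move=> f2 g2 h2; rewrite oppE_cscale; have g2' := L2_scale (-1) g2.
apply: filterS2 (bracketDl Pk Pu f2 g2' h2) (bracketZl Pk Pu (-1) g2 h2) => t -> ->.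
by rewrite mulN1r.
Qed.

Lemma bracketBr f g h : L2 f -> L2 g -> L2 h ->
  {ae P, forall t, br h (f - g) t = br h f t - br h g t}.
Proof.
move=> f2 g2 h2; rewrite oppE_cscale; have g2' := L2_scale (-1) g2.
apply: filterS2 (bracketDr Pk Pu f2 g2' h2) (bracketZr Pk Pu (-1) g2 h2) => t -> ->.
by rewrite conjcN -[conjc 1]/(Complex 1 (-0)) oppr0 mulN1r.
Qed.

Lemma bracketBB f g h k : L2 f -> L2 g -> L2 h -> L2 k ->
  {ae P, forall t, br (f - g) (h - k) t =
    br f h t - br f k t - (br g h t - br g k t)}.
Proof.
move=> f2 g2 h2 k2; have hk2 := L2_sub h2 k2.
apply: filterS2 (bracketBl f2 g2 hk2) (filterI (bracketBr h2 k2 f2) (bracketBr h2 k2 g2)).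
by move=> t -> [-> ->].
Qed.

Lemma mxmeas_gram m (F : 'I_m -> fct) : (forall i, L2 (F i)) -> mxmeas (gram F).
Proof. by move=> F2 i j; under eq_fun do rewrite mxE; exact: cmeas_bracket. Qed.

Lemma gram_psdmx m (F : 'I_m -> fct) : (forall i, L2 (F i)) ->
  {ae P, forall t, psdmx (gram F t)}.
Proof.
move=> F2; have : {ae P, forall t, forall ij : 'I_m * 'I_m,
    br (F ij.2) (F ij.1) t = conjc (br (F ij.1) (F ij.2) t)}.
  by apply: ae_forall_countable => -[i j] /=; exact: (bracket_conj Pk Pu).
apply: filterS2 (gram_psd Pk Pu F2) => t psd cj; split.
  by apply/matrixP => i j; rewrite !mxE (cj (i, j)); exact: conjCK.
move=> u; have := psd (fun i => u 0 i); rewrite /mform mxE.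
have -> : \sum_j (u *m gram F t) 0 j * (u ^t* ) j 0 =
    \sum_j \sum_i u 0 i * conjc (u 0 j) * br (F i) (F j) t.
  apply: eq_bigr => j _; rewrite mxE mulr_suml; apply: eq_bigr => i _.
  by rewrite !mxE mulrAC.
by rewrite exchange_big.
Qed.

(** Setting the matrix to 0 on a measurable null set makes the eigenvector selection available at
    every t. *)
Lemma psdmx_everywhere m (G : Rd R d -> 'M[R[i]]_m) : mxmeas G ->
  {ae P, forall t, psdmx (G t)} ->
  exists G', [/\ mxmeas G', forall t, psdmx (G' t) & {ae P, forall t, G t = G' t}].
Proof.
move=> mG [A [mA A0 HA]].
have GA t : ~ A t -> psdmx (G t) by move=> At; apply: contrapT => H; apply: At; exact: HA.
exists (fun t => ((\1_(~` A) t : R)%:C)%C *: G t); split.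
- move=> i j; under eq_fun do rewrite mxE; apply: cmeasM => //; apply: cmeas_real.
  by apply: measurable_indic; exact: measurableC.
- move=> t; rewrite indicE; case: (boolP (t \in ~` A)) => [|_].
    by rewrite inE => /GA; rewrite scale1r.
  by rewrite scale0r; exact: psdmx0.
- exists A; split => // t /= H; apply: contrapT => At; apply: H.
  by rewrite indicE mem_set// scale1r.
Qed.

(** Formally psi = sum_j v_j F_j and h_i = conj(v_i) psi. The eigenvector equation gives [psi, F_j]
    = lam v_j, so each of [h_i, F_j], [F_i, h_j] and [h_i, h_j] equals lam conj(v_i) v_j, and
    exactly one copy is subtracted from the Gram matrix. *)
Lemma deflation_step m (F : 'I_m -> fct) W : (forall i, L2 (F i)) ->
  closed_subspace W -> shift_invariant W -> (forall i, W (F i)) ->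
  exists psi, exists h : 'I_m -> fct, [/\ W psi, forall i, sis (fun _ : 'I_1 => psi) (h i) &
    {ae P, forall t, deflation (gram F t) (gram (fun i => F i - h i) t)}].
Proof.
move=> F2 clW sW WF.
have [G [mG pG GF]] := psdmx_everywhere (mxmeas_gram F2) (gram_psdmx F2).
have [v [mv v1 Hv]] := measurable_top_eigen mG pG.
have Hx j : exists x, W x /\ forall g, L2 g -> {ae P, forall t, br x g t = v t 0 j * br (F j) g t}.
  have [x Wx xE] := bracket_multiplier Pk Pu (mv 0 j) (v1 ^~ j) clW sW (WF j).
  by exists x.
have [x HX] := choice Hx; have Wx j : W (x j) by case: (HX j).
have W2 : W `<=` @L2 R d by case: clW.
have x2 j : L2 (x j) by exact: W2.
pose psi := \sum_j x j; have Wpsi : W psi by exact: closed_subspace_sum.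
have psi2 : L2 psi by exact: W2.
have psiE g : L2 g -> {ae P, forall t, br psi g t = \sum_j v t 0 j * br (F j) g t}.
  move=> g2; apply: filterS2 (bracket_suml Pk Pu (index_enum 'I_m) x2 g2)
    (ae_forall_countable (fun j => (HX j).2 g g2)) => t -> H.
  by apply: eq_bigr => j _; exact: H.
pose Phi (l : 'I_1) := psi; have phi2 l : L2 (Phi l) by [].
have Phipsi : sis Phi psi by exact: (sub_sis (phi2 ord0)).
have cmv i : cmeas (fun t => conjc (v t 0 i)) by exact: cmeas_conj.
have cv1 i t : normcR (conjc (v t 0 i)) <= 1 by rewrite normcR_conj.
have Hh i : exists h, sis (fun _ : 'I_1 => psi) h /\
    forall g, L2 g -> {ae P, forall t, br h g t = conjc (v t 0 i) * br psi g t}.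
  have [h Wh hE] := bracket_multiplier Pk Pu (cmv i) (cv1 i) (closed_subspace_sis phi2)
    (shift_invariant_sis phi2) Phipsi.
  by exists h.
have [h Hh'] := choice Hh; have Wh i : sis (fun _ : 'I_1 => psi) (h i) by case: (Hh' i).
have h2 i : L2 (h i) by case: (Wh i).
exists psi, h; split => //.
have A1 : {ae P, forall t, forall ij : 'I_m * 'I_m, gram (fun i => F i - h i) t ij.1 ij.2 =
    br (F ij.1) (F ij.2) t - br (F ij.1) (h ij.2) t - (br (h ij.1) (F ij.2) t - br (h ij.1) (h ij.2) t)}.
  apply: ae_forall_countable => -[i j] /=.
  by apply: filterS (bracketBB (F2 i) (h2 i) (F2 j) (h2 j)) => t; rewrite mxE.
have A2 : {ae P, forall t, forall ij : 'I_m * 'I_m,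
    [/\ br (h ij.1) (F ij.2) t = conjc (v t 0 ij.1) * br psi (F ij.2) t,
      br (h ij.1) (h ij.2) t = conjc (v t 0 ij.1) * br psi (h ij.2) t,
      br (F ij.1) (h ij.2) t = conjc (br (h ij.2) (F ij.1) t),
      br psi (h ij.2) t = conjc (br (h ij.2) psi t) &
      br (F ij.2) psi t = conjc (br psi (F ij.2) t) ]}.
  apply: ae_forall_countable => -[i j] /=.
  apply: filterS (filterI (filterI ((Hh' i).2 _ (F2 j)) ((Hh' i).2 _ (h2 j)))
    (filterI (bracket_conj Pk Pu (h2 j) (F2 i)) (filterI (bracket_conj Pk Pu (h2 j) psi2)
      (bracket_conj Pk Pu psi2 (F2 j))))).
  by move=> t [[? ?] [? [? ?]]].
have A3 : {ae P, forall t, forall j : 'I_m, br psi (F j) t = \sum_k v t 0 k * br (F k) (F j) t /\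
    br (h j) psi t = conjc (v t 0 j) * br psi psi t}.
  apply: ae_forall_countable => j; apply: filterI; first exact: psiE.
  exact: (Hh' j).2.
apply: filterS2 (filterI A1 A2) (filterI A3 (filterI GF (psiE psi psi2))) =>
  t [{}A1 {}A2] [{}A3 [{}GF pp]].
have [lam [GE vG Gl l0]] := Hv t; exists (v t), lam; rewrite GF; split => //.
have lamr : conjc lam = lam by apply: CrealP; exact: ger0_real.
have pF j : br psi (F j) t = lam * v t 0 j.
  have := congr1 (fun A : 'rV_m => A 0 j) vG; rewrite -GF /= !mxE => <-.
  by rewrite (A3 j).1; apply: eq_bigr => k _; rewrite mxE.
have ppE : br psi psi t = lam * \sum_k v t 0 k * conjc (v t 0 k).
  rewrite pp mulr_sumr; apply: eq_bigr => k _.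
  have [_ _ _ _ ->] := A2 (k, k); rewrite pF conjcM lamr mulrCA; congr (_ * _).
(* When v is a unit vector, [psi, psi] = lam. When G = 0 it may not be one, but lam v = 0 makes both
   sides vanish; hence the equation is multiplied by v_j. *)
have ppv j : br psi psi t * v t 0 j = lam * v t 0 j.
  case: GE => [G0|/matrixP /(_ 0 0)].
    have lv k : lam * v t 0 k = 0.
      by have := congr1 (fun A : 'rV_m => A 0 k) vG; rewrite G0 mulmx0 !mxE.
    by rewrite ppE mulr_sumr mulr_suml lv big1// => k _; rewrite mulrA lv !mul0r.
  rewrite !mxE eqxx => E; rewrite ppE [X in _ * X * _](_ : _ = 1) ?mulr1//.
  by rewrite -[RHS]E; apply: eq_bigr => k _; rewrite !mxE.
have ppr : conjc (br psi psi t) = br psi psi t.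
  rewrite ppE conjcM lamr conjc_sum; congr (_ * _); apply: eq_bigr => k _.
  by rewrite conjcM conjcK mulrC.
apply/matrixP => i j; rewrite (A1 (i, j)) /=; have [hF hh Fh ph _] := A2 (i, j).
have [hF' _ _ _ _] := A2 (j, i); rewrite /= in hF hh Fh ph hF'.
rewrite Fh hF' hF hh ph (A3 j).2 !pF !conjcM !conjcK lamr ppr -GF !mxE big_ord1 !mxE.
have := ppv j; rewrite [conjc _ * (v t 0 j * _)]mulrCA => E.
rewrite -[(v t 0 i)^*]/(conjc (v t 0 i)).
have -> : v t 0 j * (conjc (v t 0 i) * br psi psi t) = conjc (v t 0 i) * (lam * v t 0 j).
  by rewrite -E; ring.
by ring.
Qed.

End gram.

(** * Iterated deflation and the lower bound for competitors *)

Section optimality.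
Context (R : realType) (d : nat) (P : {finite_measure set (Rd R d) -> \bar R}).
Local Notation mu := (lebesgueX R d).
Local Notation fct := (Rd R d -> R[i]).
Local Notation "<< f , g >>" := (L2dot f g).
Local Notation tc := (@torus_char R d).
Hypothesis Pk : forall k, cint P (tc k) = (k == zerok d)%:R.
Hypothesis Pu : forall h, cintegrable P h ->
  (forall k, cint P (fun t => h t * tc k t) = 0) -> {ae P, forall t, h t = 0}.
Local Notation br := (bracket P).
Local Notation gram := (gram P).

(** The residuals F_i - h0_i remain in W, so the step applies to them again. The corrections add up
    inside the space generated by all the psi. *)
Lemma deflation_iter n m (F : 'I_m -> fct) W : (forall i, L2 (F i)) ->
  closed_subspace W -> shift_invariant W -> (forall i, W (F i)) ->
  exists (psi : 'I_n -> fct) (h : 'I_m -> fct),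
    [/\ forall l, W (psi l), forall i, sis psi (h i) &
      {ae P, forall t, deflations n (gram F t) (gram (fun i => F i - h i) t)}].
Proof.
move=> + clW sW; have W2 : W `<=` @L2 R d by case: clW.
elim: n F => [|n IH] F F2 WF.
  exists (fun=> 0), (fun=> 0); split => [[]//|i|].
    by case: (@closed_subspace_sis R d 0 (fun=> 0) (fun=> L2_0 R d)).
  by apply: aeW => t /=; congr gram; apply/funext => i; rewrite subr0.
have [psi0 [h0 [Wpsi0 Sh0 D0]]] := deflation_step Pk Pu F2 clW sW WF.
have h0W i : W (h0 i) by exact: (sis_min clW sW (fun=> Wpsi0) (Sh0 i)).
have F'W i : W (F i - h0 i) by exact: closed_subspace_sub.
have [psi' [h' [Wpsi' Sh' D']]] := IH (fun i => F i - h0 i) (fun i => W2 _ (F'W i)) F'W.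
pose psi (l : 'I_n.+1) := if unlift ord0 l is Some j then psi' j else psi0.
have Wpsi l : W (psi l) by rewrite /psi; case: unlift.
have psi2 l : L2 (psi l) by exact: W2.
have clS := closed_subspace_sis psi2; have sS := shift_invariant_sis psi2.
exists psi, (fun i => h0 i + h' i); split => //.
  move=> i; have [_ _ SD _ _] := clS; apply: SD.
    apply: (sis_min clS sS _ (Sh0 i)) => _.
    by have := sub_sis (psi2 ord0); rewrite {2}/psi unlift_none.
  apply: (sis_min clS sS _ (Sh' i)) => l.
  by have := sub_sis (psi2 (lift ord0 l)); rewrite {2}/psi liftK.
apply: filterS2 D0 D' => t D0 D'; exists (gram (fun i => F i - h0 i) t) => //.
rewrite (_ : (fun i => F i - (h0 i + h' i)) = (fun i => F i - h0 i - h' i))//.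
by apply/funext => i; rewrite opprD addrA.
Qed.

(** A finite combination of translates has trigonometric polynomials as coefficients over the phi,
    so the Gram matrix factors through s columns. *)
Lemma rank_gram_span s m (phi : 'I_s -> fct) (q : 'I_m -> fct) : (forall l, L2 (phi l)) ->
  (forall i, span_translates phi (q i)) -> {ae P, forall t, (\rank (gram q t) <= s)%N}.
Proof.
move=> phi2 Sq; have q2 i : L2 (q i) by exact: span_translates_L2 (Sq i).
have Hq i : exists a : 'I_s -> Rd R d -> R[i], forall g, L2 g ->
    {ae P, forall t, br (q i) g t = \sum_l a l t * br (phi l) g t}.
  have [K [c ->]] := Sq i; rewrite span_translatesE.
  exists (fun l t => \sum_(k <- K) c l k * tc k t) => g g2.
  have tr2 l k : L2 (translate k (phi l)) by exact: L2_translate.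
  have ct2 l k : L2 (cscale (c l k) (translate k (phi l))) by exact: L2_scale.
  have cs2 l : L2 (\sum_(k <- K) cscale (c l k) (translate k (phi l))) by exact: L2_sum.
  have A : {ae P, forall t, forall lk : 'I_s * d.-tuple int,
      br (cscale (c lk.1 lk.2) (translate lk.2 (phi lk.1))) g t =
      c lk.1 lk.2 * tc lk.2 t * br (phi lk.1) g t}.
    apply: ae_forall_countable => -[l k] /=.
    apply: filterS2 (bracketZl Pk Pu (c l k) (tr2 l k) g2) (bracket_translate Pk Pu k (phi2 l) g2).
    by move=> t -> ->; rewrite mulrA.
  apply: filterS2 A (filterI (bracket_suml Pk Pu (index_enum 'I_s) cs2 g2)
    (ae_forall_countable (fun l => bracket_suml Pk Pu K (ct2 l) g2))) => t A [-> B].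
  apply: eq_bigr => l _; rewrite B mulr_suml; apply: eq_bigr => k _.
  exact: (A (l, k)).
have [a Ha] := choice Hq.
have : {ae P, forall t, forall ij : 'I_m * 'I_m,
    br (q ij.1) (q ij.2) t = \sum_l a ij.1 l t * br (phi l) (q ij.2) t}.
  by apply: ae_forall_countable => -[i j]; exact: Ha.
apply: filterS => t H.
rewrite (_ : gram q t = (\matrix_(i < m, l < s) a i l t) *m
    (\matrix_(l < s, j < m) br (phi l) (q j) t)); first exact: mulmx_max_rank.
apply/matrixP => i j; rewrite !mxE (H (i, j)).
by apply: eq_bigr => l _; rewrite !mxE.
Qed.

(** Approximate by finite combinations at rate 2^-n. The Gram matrices converge almost everywhere
    entry by entry, and the rank bound is kept in the limit. *)
Lemma rank_gram_sis s m (phi : 'I_s -> fct) (p : 'I_m -> fct) : (forall l, L2 (phi l)) ->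
  (forall i, sis phi (p i)) -> {ae P, forall t, (\rank (gram p t) <= s)%N}.
Proof.
move=> phi2 Sp; have p2 i : L2 (p i) by case: (Sp i).
have Hq (ni : nat * 'I_m) : exists q, span_translates phi q /\ L2norm (q - p ni.2) <= 2^-1 ^+ ni.1.
  have e0 : 0 < 2^-1 ^+ ni.1 :> R by rewrite exprn_gt0// invr_gt0.
  have [_ /(_ _ e0)[q Sq pq]] := Sp ni.2.
  by exists q; split => //; rewrite L2norm_distC ltW.
have [q HQ] := choice Hq.
have q2 n i : L2 (q (n, i)) by apply: (span_translates_L2 phi2); case: (HQ (n, i)).
have A : {ae P, forall t, forall n : nat, (\rank (gram (fun i => q (n, i)) t) <= s)%N}.
  apply: ae_forall_countable => n; apply: rank_gram_span => // i.
  by case: (HQ (n, i)).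
have B : {ae P, forall t, forall ij : 'I_m * 'I_m,
    ccvg (fun n => br (q (n, ij.1)) (q (n, ij.2)) t) (br (p ij.1) (p ij.2) t)}.
  apply: ae_forall_countable => -[i j] /=.
  apply: (bracket_cvg_ae Pk Pu (fun n => q2 n i) (fun n => q2 n j)) => // n.
  - by case: (HQ (n, i)).
  - by case: (HQ (n, j)).
apply: filterS2 A B => t A B; apply: (mxrank_lim (Mk := fun n => gram (fun i => q (n, i)) t)) => //.
by move=> i j; under eq_fun do rewrite mxE; rewrite mxE; exact: (B (i, j)).
Qed.

(** By shift invariance a residual is orthogonal to every translate of an element of V, so all
    Fourier coefficients of the mixed brackets vanish. *)
Lemma gram_pythagoras m (F p : 'I_m -> fct) V : closed_subspace V -> shift_invariant V ->
  (forall i, L2 (F i)) -> (forall i, is_orthogonal_projection V (F i) (p i)) ->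
  {ae P, forall t, gram F t = gram p t + gram (fun i => F i - p i) t}.
Proof.
move=> clV sV F2 pP; have Vp i : V (p i) by case: (pP i).
have [V2 _ _ _ _] := clV; have p2 i : L2 (p i) by exact: V2.
have r2 i : L2 (F i - p i) by exact: L2_sub.
have A : {ae P, forall t, forall ij : 'I_m * 'I_m,
  [/\ br (F ij.1 - p ij.1) (p ij.2) t = 0, br (p ij.1) (F ij.2 - p ij.2) t =
      conjc (br (F ij.2 - p ij.2) (p ij.1) t),
    br (F ij.1) (F ij.2) t =
      br (p ij.1) (F ij.2) t + br (F ij.1 - p ij.1) (F ij.2) t,
    br (p ij.1) (F ij.2) t = br (p ij.1) (p ij.2) t + br (p ij.1) (F ij.2 - p ij.2) t &
    br (F ij.1 - p ij.1) (F ij.2) t = br (F ij.1 - p ij.1) (p ij.2) t +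
      br (F ij.1 - p ij.1) (F ij.2 - p ij.2) t]}.
  apply: ae_forall_countable => -[i j] /=.
  have E k : p k + (F k - p k) = F k by rewrite addrC subrK.
  have H1 : {ae P, forall t, br (F i - p i) (p j) t = 0}.
    apply: (bracket_eq0 Pk Pu) => // k; rewrite L2dot_translateK//.
    by have [_] := pP i; apply; exact: sV.
  have := bracketDl Pk Pu (p2 i) (r2 i) (F2 j); rewrite E => H2.
  have := bracketDr Pk Pu (p2 j) (r2 j) (p2 i); rewrite E => H3.
  have := bracketDr Pk Pu (p2 j) (r2 j) (r2 i); rewrite E => H4.
  apply: filterS2 (filterI H1 (bracket_conj Pk Pu (r2 j) (p2 i))) (filterI H2 (filterI H3 H4)).
  by move=> t [? ?] [? [? ?]].
apply: filterS A => t A; apply/matrixP => i j; rewrite !mxE.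
have [/= E1 E2 -> -> ->] := A (i, j); have [/= E3 _ _ _ _] := A (j, i).
by rewrite E1 E2 E3 conjc0 addr0 add0r.
Qed.

Lemma cint_trace_gram m (F : 'I_m -> fct) : (forall i, L2 (F i)) ->
  cintegrable P (fun t => \tr (gram F t)) /\
  \int[P]_t ReC (\tr (gram F t)) = \sum_i L2norm (F i) ^+ 2.
Proof.
move=> F2; have iF i : cintegrable P (br (F i) (F i)) by exact: cintegrable_bracket.
have E t : \tr (gram F t) = \sum_i br (F i) (F i) t by apply: eq_bigr => i _; rewrite mxE.
under eq_fun do rewrite E; split; first exact: cintegrable_sum.
rewrite -[LHS]/(ReC (cint P (fun t => \tr (gram F t)))).
rewrite (cint_eq _ E) cint_sum// Re_sum; apply: eq_bigr => i _.
by rewrite cint_bracket// L2dot_self.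
Qed.

Lemma trace_gram_le m (F F' : 'I_m -> fct) : (forall i, L2 (F i)) -> (forall i, L2 (F' i)) ->
  {ae P, forall t, \tr (gram F t) <= \tr (gram F' t)} ->
  \sum_i L2norm (F i) ^+ 2 <= \sum_i L2norm (F' i) ^+ 2.
Proof.
move=> F2 F'2 FF'; have [[iF _] <-] := cint_trace_gram F2.
have [[iF' _] <-] := cint_trace_gram F'2.
apply: ae_le_Rintegral => //; apply: filterS FF' => t.
by rewrite lecE => /andP[].
Qed.

(** The Gram matrix of the projections is an admissible competitor: it is positive semidefinite,
    lies below that of F by the Pythagoras identity, and has rank at most s <= n. The trace
    comparison is then integrated. *)
Lemma sis_error_lower_bound n s m (F h : 'I_m -> fct) (phi : 'I_s -> fct) :
  (forall i, L2 (F i)) -> (forall i, L2 (h i)) -> (forall l, L2 (phi l)) -> (s <= n)%N ->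
  {ae P, forall t, deflations n (gram F t) (gram (fun i => F i - h i) t)} ->
  \sum_i L2norm (F i - h i) ^+ 2 <=
  \sum_i L2norm (F i - orthogonal_projection (sis phi) (F i)) ^+ 2.
Proof.
move=> F2 h2 phi2 sn D; have clV := closed_subspace_sis phi2.
have sV := shift_invariant_sis phi2.
pose p i := orthogonal_projection (sis phi) (F i).
have pP i : is_orthogonal_projection (sis phi) (F i) (p i) by exact: orthogonal_projectionP.
have Vp i : sis phi (p i) by case: (pP i).
have p2 i : L2 (p i) by case: (Vp i).
have r2 i : L2 (F i - p i) by exact: L2_sub.
apply: trace_gram_le => //; first by move=> i; exact: L2_sub.
apply: filterS2 (filterI D (gram_pythagoras clV sV F2 pP))
  (filterI (rank_gram_sis phi2 Vp) (filterI (gram_psdmx Pk Pu F2)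
  (filterI (gram_psdmx Pk Pu p2) (gram_psdmx Pk Pu r2)))).
move=> t [{}D E] [rp [pF [pp pr]]].
have pF' u : mform (gram p t) u u <= mform (gram F t) u u.
  by rewrite -subr_ge0 -mformBl E addrAC subrr add0r; exact: pr.2.
have := deflations_trace pF pp pF' (leq_trans rp sn) D.
by rewrite E -mxtraceB addrAC subrr add0r.
Qed.

End optimality.

Theorem theorem2p1 (R : realType) (d m n : nat) (f : 'I_m -> Rd R d -> R[i])
    (f_L2 : forall i, L2 (f i)) (n_gt0 : (0 < n)%N) :
  (exists V : set (Rd R d -> R[i]),
    fsis_length_le n V /\
    forall V' : set (Rd R d -> R[i]), fsis_length_le n V' ->
      \sum_(i < m) L2norm (f i - orthogonal_projection V (f i)) ^+ 2 <=
      \sum_(i < m) L2norm (f i - orthogonal_projection V' (f i)) ^+ 2) /\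
  (exists V : set (Rd R d -> R[i]),
    [/\ fsis_length_le n V,
        forall V' : set (Rd R d -> R[i]), fsis_length_le n V' ->
          \sum_(i < m) L2norm (f i - orthogonal_projection V (f i)) ^+ 2 <=
          \sum_(i < m) L2norm (f i - orthogonal_projection V' (f i)) ^+ 2
      & V `<=` sis f]).
Proof.
suff [V [V1 V2 V3]] : exists V : set (Rd R d -> R[i]),
    [/\ fsis_length_le n V,
        forall V' : set (Rd R d -> R[i]), fsis_length_le n V' ->
          \sum_(i < m) L2norm (f i - orthogonal_projection V (f i)) ^+ 2 <=
          \sum_(i < m) L2norm (f i - orthogonal_projection V' (f i)) ^+ 2
      & V `<=` sis f] by split; exists V.
have [P [Pk Pcube]] := torus_exists R d.
have Pu := torus_uniqueness Pcube.
have clW := closed_subspace_sis f_L2; have sW := shift_invariant_sis f_L2.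
have [psi [h [Wpsi Sh D]]] := deflation_iter Pk Pu n f_L2 clW sW (fun i => sub_sis (f_L2 i)).
have psi2 l : L2 (psi l) by case: (Wpsi l).
have h2 i : L2 (h i) by case: (Sh i).
have clV := closed_subspace_sis psi2.
exists (sis psi); split.
- by apply/fsis_length_leP; exists n, psi.
- move=> _ /fsis_length_leP[s [phi [sn phi2 ->]]].
  (* The lower bound is stated for the h_i. They lie in [sis psi], so the projections onto that
     space have errors at most as large. *)
  apply: le_trans (sis_error_lower_bound Pk Pu f_L2 h2 phi2 sn D).
  apply: ler_sum => i _; apply: (orthogonal_projection_le clV (f_L2 i)) => //.
  exact: orthogonal_projectionP.
- exact: sis_min.
Qed.
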